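(* Let assumptions (H1)-(H3) listed in the context hold and let $u^*\in\mathcal{U}$ be an optimal control with state process $\{X_k^*\}$. For $u\in\mathcal{U}$ and $\varepsilon\in(0,1]$ put $u^\varepsilon=u^*+\varepsilon(u-u^* )\in\mathcal{U}$. Then, for any $u\in\mathcal{U}$, there exists a $P^u\in\mathcal{P}^*$ such that $$\lim_{\varepsilon\to0}\varepsilon^{-1}[J(u^\varepsilon)-J(u^* )]=E_{P^u}[\Theta^u]=\sup_{P\in\mathcal{P}^*}E_P[\Theta^u].$$
   Context: Noise. Let $\Omega$ be a sample space, $N$ a positive integer, $W_k=(W_k^1,\ldots,W_k^d)^T:\Omega\to\mathbb{R}^d$, $k=1,\ldots,N$, given functions, $W=(W_1,\ldots,W_N)$, $\mathcal{F}_k=\sigma\{W_1,\ldots,W_k\}$, $\mathcal{F}_0=\{\emptyset,\Omega\}$. $C_{b,Lip}$ denotes bounded Lipschitz functions and $Lip(\mathcal{F}_k)=\{\phi(W_1,\ldots,W_k):\phi\in C_{b,Lip}(\mathbb{R}^{d\times k})\}$. Let $\{F_\theta:\theta\in\Theta\}$ be a family of probability measures on $\mathbb{R}^d$. Define $\hat{\mathbb{E}}[\varphi(W_k)]=\sup_{\theta\in\Theta}\int\varphi\,dF_\theta$ for $\varphi\in C_{b,Lip}(\mathbb{R}^d)$, and for $\phi\in C_{b,Lip}(\mathbb{R}^{d\times N})$ set $\phi_N=\phi$, $\phi_k(x_1,\ldots,x_k)=\hat{\mathbb{E}}[\phi_{k+1}(x_1,\ldots,x_k,W_{k+1})]$ for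 $k=N-1,\ldots,1$, and $\hat{\mathbb{E}}[\phi(W_1,\ldots,W_N)]=\hat{\mathbb{E}}[\phi_1(W_1)]$. Standing assumptions: (A1) $W(\Omega)=A_1\times\cdots\times A_N$ with $A_k=W_k(\Omega)$ and $F_\theta(\bar A_k)=1$ for all $\theta,k$ ($\bar A_k$ the closure of $A_k$); (A2) $\sup_\theta\int|x|F_\theta(dx)<\infty$; (A3) for each $Q\in\mathcal{A}$ there is a probability measure $P$ on $(\Omega,\mathcal{F}_N)$ with $Q=P\circ W^{-1}$, where $\mathcal{A}$ is the set of probability measures $Q$ on $\mathbb{R}^{d\times N}$ with $E_Q[\phi]\le\hat{\mathbb{E}}[\phi(W)]$ for all $\phi\in C_{b,Lip}(\mathbb{R}^{d\times N})$. Let $\mathcal{P}$ be the set of probability measures $P$ on $(\Omega,\mathcal{F}_N)$ with $E_P[\phi(W)]\le\hat{\mathbb{E}}[\phi(W)]$ for all $\phi\in C_{b,Lip}(\mathbb{R}^{d\times N})$. A set $B\in\mathcal{F}_N$ is polar if $\sup_{P\in\mathcal{P}}P(B)=0$; random variables equal outside a polar set are identified. $\hat{\mathbb{E}}$ is extended by $\hat{\mathbb{E}}[X]=\sup_{P\in\mathcal{P}}E_P[X]$ to all $\mathcal{F}_N$-measurable $X$ with $\sup_{P\in\mathcal{P}}E_P[|X|]<\infty$. $L_c^p(\mathcal{F}_k)$ is the completion of $Lip(\mathcal{F}_k)$ under $\|X\|_p=(\hat{\mathbb{E}}[|X|^p])^{1/p}$ (a closed subspace of the $\mathcal{F}_k$-measurable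 $X$ with $\hat{\mathbb{E}}[|X|^p]<\infty$), and $L_c^p(\mathcal{F}_0)=\mathbb{R}$. For vector-valued $Z$, ''$|Z|\in L_c^2(\mathcal{F}_k)$'' means that all components of $Z$ lie in $L_c^2(\mathcal{F}_k)$. Standing assumption: $|W_k|\in L_c^2(\mathcal{F}_k)$ for $k=1,\ldots,N$. Control problem. $U_k\subset\mathbb{R}^m$, $k=0,\ldots,N-1$, are nonempty convex sets; $\mathcal{U}$ is the set of admissible controls $u=\{u_k\}_{k=0}^{N-1}$ with $u_k:\Omega\to U_k$ and $|u_k|\in L_c^2(\mathcal{F}_k)$. The coefficients are $b(k,\cdot),\sigma^l(k,\cdot):\mathbb{R}^n\times U_k\times\Omega\to\mathbb{R}^n$, $f(k,\cdot):\mathbb{R}^n\times U_k\times\Omega\to\mathbb{R}$, $\varphi:\mathbb{R}^n\times\Omega\to\mathbb{R}$ ($l=1,\ldots,d$, $k=0,\ldots,N-1$), with $b,\sigma^l,f$ differentiable in $(x,u)$ and $\varphi$ differentiable in $x$; the argument $\omega$ is suppressed. The state process of $u\in\mathcal{U}$ is the solution of $X_{k+1}=b(k,X_k,u_k)+\sum_{l=1}^d\sigma^l(k,X_k,u_k)W_{k+1}^l$, $X_0=x_0\in\mathbb{R}^n$, $k=0,\ldots,N-1$, and the cost is $J(u)=\hat{\mathbb{E}}[\sum_{k=0}^{N-1}f(k,X_k,u_k)+\varphi(X_N)]$. A control $u^*\in\mathcal{U}$ is optimal if it minimizes $J$ over $\mathcal{U}$. (H1) $|b(k,x,u)|,|\sigma^l(k,x,u)|\in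 L_c^2(\mathcal{F}_k)$, $f(k,x,u)\in L_c^1(\mathcal{F}_k)$, $\varphi(x)\in L_c^1(\mathcal{F}_N)$ for all $x\in\mathbb{R}^n$, $u\in U_k$, $l$, $k$. (H2) There is $L>0$ with $|b_x(k,x,u)|+|b_u(k,x,u)|+|\sigma^l_x(k,x,u)|+|\sigma^l_u(k,x,u)|\le L$ and $|f_x(k,x,u)|+|f_u(k,x,u)|+|\varphi_x(x)|\le L(1+|x|+|u|)$ for all $x\in\mathbb{R}^n$, $u\in U_k$, $l$, $k$. (H3) For each $\alpha>0$ there is a modulus of continuity $\omega_\alpha:[0,\infty)\to[0,\infty)$ (nondecreasing, $\omega_\alpha(r)\to\omega_\alpha(0)=0$ as $r\downarrow0$) such that for all $x,x'\in\mathbb{R}^n$ with $|x|,|x'|\le\alpha$ and $u,u'\in U_k$ with $|u|,|u'|\le\alpha$, $|\phi(k,x,u)-\phi(k,x',u')|+|\varphi_x(x)-\varphi_x(x')|\le\omega_\alpha(|x-x'|+|u-u'|)$, where $\phi(k,\cdot,\cdot)$ is the derivative in $(x,u)$ of any of $b(k,\cdot,\cdot)$, $\sigma^l(k,\cdot,\cdot)$, $f(k,\cdot,\cdot)$. Variational objects. $b_x$ is the Jacobian matrix $(\partial b_i/\partial x_j)$, similarly $b_u,\sigma_x^l,\sigma_u^l$; $f_x,f_u,\varphi_x$ are row vectors. Write $b_x(k)=b_x(k,X_k^*,u_k^* )$ and similarly $b_u(k),\sigma_x^l(k),\sigma_u^l(k),f_x(k),f_u(k)$. Given $u\in\mathcal{U}$,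 $\{\hat X_k\}$ is the solution of $\hat X_0=0$, $$\hat X_{k+1}=b_x(k)\hat X_k+b_u(k)(u_k-u_k^* )+\sum_{l=1}^d\big[\sigma_x^l(k)\hat X_k+\sigma_u^l(k)(u_k-u_k^* )\big]W_{k+1}^l,\quad k=0,\ldots,N-1,$$ and $$\Theta^u=\sum_{k=0}^{N-1}\big[f_x(k)\hat X_k+f_u(k)(u_k-u_k^* )\big]+\varphi_x(X_N^* )\hat X_N.$$ Finally $\mathcal{P}^*=\{P\in\mathcal{P}:E_P[\sum_{k=0}^{N-1}f(k,X_k^*,u_k^* )+\varphi(X_N^* )]=\hat{\mathbb{E}}[\sum_{k=0}^{N-1}f(k,X_k^*,u_k^* )+\varphi(X_N^* )]\}$. *)

(* Defs.v *)
From HB Require Import structures.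
From mathcomp Require Import all_boot all_order all_algebra.
From mathcomp Require Import all_classical all_reals all_analysis.

Set Implicit Arguments.
Unset Strict Implicit.
Unset Printing Implicit Defensive.
Import Order.TTheory GRing.Theory Num.Theory.
Import numFieldNormedType.Exports.
Local Open Scope classical_set_scope.
Local Open Scope ring_scope.

(* Conventions.
   - Vectors are columns and R^(d x k) is 'M[R]_(d, k), whose j-th column is the
     j-th vector.  The norm is the library's (maximum of the absolute values of
     the entries); all bounds below are insensitive to the choice of a norm.
   - Time-indexed families are functions of nat: only W 1, ..., W N and the
     coefficients, controls and control sets of indices 0, ..., N-1 are used. *)

(* A topological space with its Borel sigma-algebra. *)
Notation borel V := (g_sigma_algebraType (@open V)).

Section noise.
Context (R : realType) (Omega : pointedType) (d : nat).
Context (W : nat -> Omega -> 'cV[R]_d).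

Definition noise_path (k : nat) (w : Omega) : 'M[R]_(d, k) :=
  \matrix_(i < d, j < k) W j.+1 w i ord0.

Definition noise_events (k : nat) : set (set Omega) :=
  [set W j @^-1` B | j in [set j | (1 <= j <= k)%N]
                   & B in (measurable : set (set (borel 'cV[R]_d)))].

End noise.

(* (Omega, F_k), with F_k = sigma(W_1, ..., W_k); F_0 is trivial because
   noise_events W 0 is empty. *)
Notation filtered W k := (g_sigma_algebraType (noise_events W k)).

Definition Cblip (R : realType) (V : normedModType R) : set (V -> R) :=
  [set phi | [bounded phi x | x in setT] /\ [lipschitz phi x | x in setT]].

Section sublinear_expectation.
Context (R : realType) (Omega : pointedType) (d N : nat).
Context (W : nat -> Omega -> 'cV[R]_d).
Context (Theta : Type) (F : Theta -> probability (borel 'cV[R]_d) R).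

Definition Ehat1 (phi : 'cV[R]_d -> R) : R :=
  sup [set \int[F theta]_x phi x | theta in [set: Theta]].

Definition add_col k (x : 'M[R]_(d, k)) (y : 'cV[R]_d) : 'M[R]_(d, k.+1) :=
  castmx (erefl d, addn1 k) (row_mx x y).

(* Ehat[phi(W_1, ..., W_k)] for phi in C_{b,Lip}(R^(d x k)): each step of the
   recursion replaces phi_{k+1} by phi_k. *)
Fixpoint Ehat_cyl (k : nat) : ('M[R]_(d, k) -> R) -> R :=
  match k with
  | 0 => fun phi => phi 0
  | k'.+1 => fun phi =>
      Ehat_cyl (fun x : 'M[R]_(d, k') => Ehat1 (fun y => phi (add_col x y)))
  end.

(* the set written with a calligraphic A *)
Definition dominated_laws : set (probability (borel 'M[R]_(d, N)) R) :=
  [set Q : probability (borel 'M[R]_(d, N)) R | forall phi : 'M[R]_(d, N) -> R, Cblip phi ->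
     ('E_Q[phi] <= (Ehat_cyl phi)%:E)%E].

(* the set written with a calligraphic P *)
Definition dominated_probs : set (probability (filtered W N) R) :=
  [set P : probability (filtered W N) R | forall phi : 'M[R]_(d, N) -> R, Cblip phi ->
     ('E_P[phi \o noise_path W N] <= (Ehat_cyl phi)%:E)%E].

Definition A1 : Prop :=
  [set noise_path W N w | w in setT] =
    [set x | forall j : 'I_N, range (W j.+1) (col j x)] /\
  forall theta k, (1 <= k <= N)%N -> F theta (closure (range (W k))) = 1%E.

Definition A2 : Prop :=
  (ereal_sup [set \int[F theta]_x (`|x|)%:E | theta in [set: Theta]] < +oo)%E.

Definition A3 : Prop :=
  forall Q, dominated_laws Q ->
  exists P : probability (filtered W N) R,
    forall B : set (borel 'M[R]_(d, N)), measurable B ->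
      Q B = P (noise_path W N @^-1` B).

Definition Ehat (X : Omega -> R) : \bar R :=
  ereal_sup [set 'E_P[X]%E | P in dominated_probs].

Definition polar (B : set Omega) : Prop :=
  measurable (B : set (filtered W N)) /\
  ereal_sup [set P B | P in dominated_probs] = 0%E.

Definition quasi_surely (A : set Omega) : Prop :=
  exists B, polar B /\ ~` B `<=` A.

Definition Lip (k : nat) : set (Omega -> R) :=
  [set phi \o noise_path W k | phi in @Cblip R 'M[R]_(d, k)].

Definition Ehat_norm (p : nat) (X : Omega -> R) : \bar R :=
  (Ehat (fun w => `|X w| ^+ p)%R `^ (p%:R^-1))%E.

(* L_c^p(F_k).  As random variables that are equal outside a polar set are
   identified, X is a representative of a class that contains an
   F_k-measurable limit of elements of Lip(F_k). *)
Definition Lc (p k : nat) : set (Omega -> R) :=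
  [set X : Omega -> R | measurable_fun [set: filtered W N] X /\
    exists X' : Omega -> R,
      [/\ quasi_surely [set w | X w = X' w],
          measurable_fun [set: filtered W k] X',
          (Ehat (fun w => `|X' w| ^+ p)%R < +oo)%E &
          forall e : R, 0 < e -> exists2 Y, Lip k Y &
            (Ehat_norm p (fun w => X' w - Y w)%R < e%:E)%E]].

Definition Lcv (q p k : nat) : set (Omega -> 'cV[R]_q) :=
  [set Z | forall i, Lc p k (fun w => Z w i ord0)].

End sublinear_expectation.
Arguments dominated_probs {R Omega d} N W {Theta} F.

(* z |-> L (z - z0) is a derivative at z0 of g, relatively to D (Frechet
   differentiability when D is a neighborhood of z0). *)
Definition diff_within (R : realType) (V V' : normedModType R) (D : set V)
    (g : V -> V') (z0 : V) (L : V -> V') : Prop :=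
  forall e : R, 0 < e ->
    \forall z \near within D (nbhs z0),
      `|g z - g z0 - L (z - z0)| <= e * `|z - z0|.

Record coefficients (R : realType) (Omega : Type) (d n m : nat) := Coefficients {
  drift : nat -> 'cV[R]_n -> 'cV[R]_m -> Omega -> 'cV[R]_n;
  diffu : 'I_d -> nat -> 'cV[R]_n -> 'cV[R]_m -> Omega -> 'cV[R]_n;
  rcost : nat -> 'cV[R]_n -> 'cV[R]_m -> Omega -> R;
  tcost : 'cV[R]_n -> Omega -> R }.

(* The Jacobian matrices b_x, b_u, sigma^l_x, sigma^l_u, f_x, f_u, phi_x. *)
Record jacobians (R : realType) (Omega : Type) (d n m : nat) := Jacobians {
  drift_x : nat -> 'cV[R]_n -> 'cV[R]_m -> Omega -> 'M[R]_(n, n);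
  drift_u : nat -> 'cV[R]_n -> 'cV[R]_m -> Omega -> 'M[R]_(n, m);
  diffu_x : 'I_d -> nat -> 'cV[R]_n -> 'cV[R]_m -> Omega -> 'M[R]_(n, n);
  diffu_u : 'I_d -> nat -> 'cV[R]_n -> 'cV[R]_m -> Omega -> 'M[R]_(n, m);
  rcost_x : nat -> 'cV[R]_n -> 'cV[R]_m -> Omega -> 'rV[R]_n;
  rcost_u : nat -> 'cV[R]_n -> 'cV[R]_m -> Omega -> 'rV[R]_m;
  tcost_x : 'cV[R]_n -> Omega -> 'rV[R]_n }.

Section control.
Context (R : realType) (Omega : pointedType) (d n m N : nat).
Context (W : nat -> Omega -> 'cV[R]_d).
Context (Theta : Type) (F : Theta -> probability (borel 'cV[R]_d) R).
Context (U : nat -> set 'cV[R]_m) (x0 : 'cV[R]_n).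
Context (c : coefficients R Omega d n m) (D : jacobians R Omega d n m).

(* The coefficients are only given on R^n x U_k, where U_k need not be open:
   they are differentiable relatively to R^n x U_k.  If U_k has an empty
   interior, the derivative in u is determined on the directions of U_k only,
   and D is any choice of derivatives. *)
Definition differentiable_coefficients : Prop :=
  (forall k w x u, (k < N)%N -> U k u ->
    let dom := [set z : 'cV[R]_n * 'cV[R]_m | U k z.2] in
    [/\ diff_within dom (fun z => drift c k z.1 z.2 w) (x, u)
          (fun h => drift_x D k x u w *m h.1 + drift_u D k x u w *m h.2),
        forall l, diff_within dom (fun z => diffu c l k z.1 z.2 w) (x, u)
          (fun h => diffu_x D l k x u w *m h.1 + diffu_u D l k x u w *m h.2) &
        diff_within dom (fun z => rcost c k z.1 z.2 w : R) (x, u)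
          (fun h => (rcost_x D k x u w *m h.1
                     + rcost_u D k x u w *m h.2) ord0 ord0 : R)]) /\
  (forall w x, diff_within setT (fun y => tcost c y w : R) x
    (fun h => (tcost_x D x w *m h) ord0 ord0 : R)).

Definition H1 : Prop :=
  (forall k x u, (k < N)%N -> U k u ->
    [/\ Lcv N W F 2 k (drift c k x u),
        forall l, Lcv N W F 2 k (diffu c l k x u) &
        Lc N W F 1 k (rcost c k x u)]) /\
  (forall x, Lc N W F 1 N (tcost c x)).

Definition H2 : Prop :=
  exists2 L : R, 0 < L &
  forall k w (x : 'cV[R]_n) (u : 'cV[R]_m), (k < N)%N -> U k u ->
    (forall l, `|drift_x D k x u w| + `|drift_u D k x u w|
      + `|diffu_x D l k x u w| + `|diffu_u D l k x u w| <= L) /\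
    `|rcost_x D k x u w| + `|rcost_u D k x u w| + `|tcost_x D x w|
      <= L * (1 + `|x| + `|u|).

Definition modulus (om : R -> R) : Prop :=
  [/\ forall r, 0 <= r -> 0 <= om r,
      {in `[0, +oo[ &, {homo om : r s / r <= s}},
      om 0 = 0 &
      om r @[r --> 0^'+] --> 0].

Definition H3 : Prop :=
  forall alpha : R, 0 < alpha ->
  exists2 om : R -> R, modulus om &
  forall k w (x x' : 'cV[R]_n) (u u' : 'cV[R]_m), (k < N)%N -> U k u -> U k u' ->
    `|x| <= alpha -> `|x'| <= alpha -> `|u| <= alpha -> `|u'| <= alpha ->
    let bound p q (A : nat -> 'cV[R]_n -> 'cV[R]_m -> Omega -> 'M[R]_(p, q)) B :=
      `|row_mx (A k x u w) (B k x u w) - row_mx (A k x' u' w) (B k x' u' w)|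
        + `|tcost_x D x w - tcost_x D x' w| <= om (`|x - x'| + `|u - u'|) in
    [/\ bound _ _ (drift_x D) (drift_u D),
        forall l, bound _ _ (diffu_x D l) (diffu_u D l) &
        bound _ _ (rcost_x D) (rcost_u D)].

Definition admissible (u : nat -> Omega -> 'cV[R]_m) : Prop :=
  forall k, (k < N)%N -> (forall w, U k (u k w)) /\ Lcv N W F 2 k (u k).

Fixpoint state (u : nat -> Omega -> 'cV[R]_m) (k : nat) (w : Omega)
    : 'cV[R]_n :=
  match k with
  | 0 => x0
  | k'.+1 =>
      let x := state u k' w in
      drift c k' x (u k' w) w
      + \sum_(l < d) W k'.+1 w l ord0 *: diffu c l k' x (u k' w) w
  end.

Definition pathcost (u : nat -> Omega -> 'cV[R]_m) (w : Omega) : R :=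
  \sum_(k < N) rcost c k (state u k w) (u k w) w + tcost c (state u N w) w.

Definition J (u : nat -> Omega -> 'cV[R]_m) : \bar R :=
  Ehat N W F (pathcost u).

Definition optimal (us : nat -> Omega -> 'cV[R]_m) : Prop :=
  admissible us /\ forall u, admissible u -> (J us <= J u)%E.

Definition perturb (us u : nat -> Omega -> 'cV[R]_m) (eps : R)
    : nat -> Omega -> 'cV[R]_m :=
  fun k w => us k w + eps *: (u k w - us k w).

Fixpoint var_state (us u : nat -> Omega -> 'cV[R]_m) (k : nat) (w : Omega)
    : 'cV[R]_n :=
  match k with
  | 0 => 0
  | k'.+1 =>
      let x := state us k' w in
      let v := us k' w in
      let dx := var_state us u k' w in
      let du := u k' w - v in
      drift_x D k' x v w *m dx + drift_u D k' x v w *m du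
      + \sum_(l < d) W k'.+1 w l ord0 *:
          (diffu_x D l k' x v w *m dx + diffu_u D l k' x v w *m du)
  end.

(* Theta^u *)
Definition var_cost (us u : nat -> Omega -> 'cV[R]_m) (w : Omega) : R :=
  \sum_(k < N)
    (rcost_x D k (state us k w) (us k w) w *m var_state us u k w
     + rcost_u D k (state us k w) (us k w) w *m (u k w - us k w)) ord0 ord0
  + (tcost_x D (state us N w) w *m var_state us u N w) ord0 ord0.

(* the set written with a calligraphic P and a star *)
Definition optimal_probs (us : nat -> Omega -> 'cV[R]_m)
    : set (probability (filtered W N) R) :=
  [set P : probability (filtered W N) R | dominated_probs N W F P /\
           'E_P[pathcost us]%E = Ehat N W F (pathcost us)].

End control.
Arguments optimal_probs {R Omega d n m} N W {Theta} F x0 c us.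

(* Main.v *)
(* J(u) is the supremum over P of the linear functionals E_P[cost of u].  The
   difference quotients of the cost along u^eps converge to Theta^u in L^1
   uniformly over P (H1-H3 and the boundedness of second moments), so that
   eps |-> J(u^eps) is, up to o(eps), a supremum of affine functions.  Danskin's
   argument then gives the derivative as the maximum of E_P[Theta^u] over the
   maximizers P of the cost of u^*, provided that approximate maximizers cluster
   at a dominated probability.  Such cluster points come from limits of E_P[phi]
   along an ultrafilter: by tightness the limit is a Daniell integral on bounded
   Lipschitz functions, hence a probability law (Daniell-Riesz), which (A3) lifts
   to Omega; the convergence extends to the L^1 closure of the Lipschitz
   functions of the noise, where the costs and Theta^u live.

   That the state stays in L^2 is the delicate point: for X known at time k, the
   product X W_{k+1} is square integrable since the second moment of W_{k+1} given
   the past is bounded by its sublinear expectation, which comes from testing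
   the domination on X^2 psi(W_{k+1}) for truncations psi. *)
Require Import Defs.
From HB Require Import structures.
From mathcomp Require Import all_boot all_order all_algebra.
From mathcomp Require Import all_classical all_reals all_analysis.
From mathcomp Require Import measurable_realfun ring lra.

Set Implicit Arguments.
Unset Strict Implicit.
Unset Printing Implicit Defensive.
Import Order.TTheory GRing.Theory Num.Theory.
Import numFieldNormedType.Exports.
Local Open Scope classical_set_scope.
Local Open Scope ring_scope.

(** * Bounded Lipschitz functions *)

(** The hypotheses control the coefficients at fixed (x, u) only, while the state equation evaluates
    them at random arguments, and the derivatives come without any measurability. The completions
    offer few operations: linear combinations, minima, maxima and limits in norm (a product drops
    from L^2 to L^1). Hence [comp_min], which approximates g at a random point from above by a
    minimum of finitely many g z plus a Lipschitz penalty; derivatives are then reached as limits of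
    difference quotients. Every estimate is an integral under one P, uniform over P. Polar sets are
    invisible to it, so after [Lc_Lcl] the quasi-sure identification is gone and [Lcl] is used,
    except for the admissibility of u^eps. One scheme serves state and costs: the pairs (p, a) = (2,
    0) and (1, 1) of integrability exponent and growth of the Lipschitz constant satisfy p (a + 1) =
    2, so errors are always dominated by the square of an L^2 variable, and [vanish_dominated]
    stands in for dominated convergence, uniformly over the family of measures. *)

Section cblip.
Context (R : realType) (V : normedModType R).
Implicit Types phi psi : V -> R.

Lemma CblipP phi : Cblip phi <->
  exists2 B : R, 0 < B & (forall x, `|phi x| <= B) /\
    (forall x y, `|phi x - phi y| <= B * `|x - y|).
Proof.
split.
  case=> hb hl.
  have [B1 B10 hB1] : exists2 M, 0 < M & globally setT [set x | `|phi x| <= M].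
    exact: (pinfty_ex_gt0 hb).
  have [B2 B20 hB2] := pinfty_ex_gt0 hl.
  exists (B1 + B2); first exact: addr_gt0.
  split=> [x|x y].
    by rewrite (le_trans (hB1 x I))// lerDl ltW.
  by rewrite (le_trans (hB2 (x, y) (conj I I)))//= ler_wpM2r// lerDr ltW.
case=> B B0 [hb hl]; split; exists B; split; rewrite ?num_real// => M BM.
  by move=> x _ /=; rewrite (le_trans (hb x))// ltW.
by move=> [x y] _ /=; rewrite (le_trans (hl x y))// ler_wpM2r// ltW.
Qed.

Lemma Cblip_cst (a : R) : Cblip (fun _ : V => a).
Proof.
apply/CblipP; exists (`|a| + 1); first by rewrite ltr_wpDl.
split=> [x|x y]; first by rewrite lerDl.
by rewrite subrr normr0 mulr_ge0// addr_ge0.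
Qed.

(** Sums, differences, multiples, maxima and minima are globally Lipschitz maps of the plane, so one
    estimate treats them all; [Lipk_lip2] and [Lcl_lip2] carry it over to random variables. The
    product is only locally Lipschitz and needs the bounds. *)
Lemma Cblip_lip2 (H : R -> R -> R) (K : R) phi psi :
  (forall a b a' b', `|H a b - H a' b'| <= K * (`|a - a'| + `|b - b'|)) ->
  Cblip phi -> Cblip psi -> Cblip (fun x => H (phi x) (psi x)).
Proof.
move=> hH /CblipP[B B0 [bB lB]] /CblipP[C C0 [bC lC]].
have K0 : 0 <= K.
  have := hH 1 0 0 0; rewrite !subr0 normr1 normr0 addr0 mulr1.
  exact: le_trans.
have KBC : 0 <= K * (B + C) by rewrite mulr_ge0// addr_ge0// ltW.
apply/CblipP; exists (`|H 0 0| + K * (B + C) + 1).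
  by rewrite ltr_wpDl// addr_ge0.
split=> [x|x y].
  have := hH (phi x) (psi x) 0 0; rewrite !subr0 => h.
  have -> : H (phi x) (psi x) = H 0 0 + (H (phi x) (psi x) - H 0 0) by ring.
  rewrite (le_trans (ler_normD _ _))// -addrA lerD//.
  rewrite (le_trans h)// (@le_trans _ _ (K * (B + C)))//; last by rewrite lerDl.
  by rewrite ler_wpM2l// lerD.
rewrite (le_trans (hH _ _ _ _))// (@le_trans _ _ (K * (B + C) * `|x - y|))//.
  by rewrite -mulrA ler_wpM2l// mulrDl lerD.
by rewrite ler_wpM2r// -addrA addrC -addrA lerDl addr_ge0.
Qed.

Lemma CblipD phi psi : Cblip phi -> Cblip psi -> Cblip (fun x => phi x + psi x).
Proof.
apply: (@Cblip_lip2 (fun a b => a + b) 1) => a b a' b'; rewrite mul1r.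
by rewrite opprD addrACA ler_normD.
Qed.

Lemma CblipB phi psi : Cblip phi -> Cblip psi -> Cblip (fun x => phi x - psi x).
Proof.
apply: (@Cblip_lip2 (fun a b => a - b) 1) => a b a' b'; rewrite mul1r.
have -> : a - b - (a' - b') = (a - a') - (b - b') by ring.
exact: ler_normB.
Qed.

Lemma CblipZ (k : R) phi : Cblip phi -> Cblip (fun x => k * phi x).
Proof.
move=> h; apply: (@Cblip_lip2 (fun a b => k * a) `|k| _ _ _ h h) => a b a' b'.
by rewrite -mulrBr normrM ler_wpM2l// lerDl.
Qed.

Lemma lip_maxr (a b a' b' : R) :
  `|Num.max a b - Num.max a' b'| <= 1 * (`|a - a'| + `|b - b'|).
Proof.
rewrite mul1r.
have [aa' bb'] := (ler_norm (a - a'), ler_norm (b - b')).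
have := ler_norm (b' - b); have := ler_norm (a' - a).
rewrite (distrC a') (distrC b') => h1 h2.
by rewrite ler_norml; case: (leP a b); case: (leP a' b') => ? ?; apply/andP; split; lra.
Qed.

Lemma lip_minr (a b a' b' : R) :
  `|Num.min a b - Num.min a' b'| <= 1 * (`|a - a'| + `|b - b'|).
Proof.
rewrite mul1r.
have [aa' bb'] := (ler_norm (a - a'), ler_norm (b - b')).
have := ler_norm (b' - b); have := ler_norm (a' - a).
rewrite (distrC a') (distrC b') => h1 h2.
by rewrite ler_norml; case: (leP a b); case: (leP a' b') => ? ?; apply/andP; split; lra.
Qed.

Lemma Cblip_max phi psi :
  Cblip phi -> Cblip psi -> Cblip (fun x => Num.max (phi x) (psi x)).
Proof. exact: (Cblip_lip2 lip_maxr). Qed.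

Lemma Cblip_min phi psi :
  Cblip phi -> Cblip psi -> Cblip (fun x => Num.min (phi x) (psi x)).
Proof. exact: (Cblip_lip2 lip_minr). Qed.

Lemma CblipM phi psi : Cblip phi -> Cblip psi -> Cblip (fun x => phi x * psi x).
Proof.
move=> /CblipP[B B0 [bB lB]] /CblipP[C C0 [bC lC]].
apply/CblipP; exists (2 * (B * C)); first by rewrite !mulr_gt0.
split=> [x|x y].
  rewrite normrM (@le_trans _ _ (B * C))//; first exact: ler_pM.
  by rewrite ler_peMl ?ler1n// mulr_ge0// ltW.
have -> : phi x * psi x - phi y * psi y =
  phi x * (psi x - psi y) + psi y * (phi x - phi y) by ring.
rewrite (le_trans (ler_normD _ _))// !normrM.
have -> : 2 * (B * C) * `|x - y| = B * (C * `|x - y|) + C * (B * `|x - y|) by ring.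
by apply: lerD; apply: ler_pM.
Qed.

Lemma Cblip_sum (I : Type) (r : seq I) (f : I -> V -> R) :
  (forall i, Cblip (f i)) -> Cblip (fun x => \sum_(i <- r) f i x).
Proof.
move=> hf; elim: r => [|i r ih].
  by under eq_fun do rewrite big_nil; exact: Cblip_cst.
by under eq_fun do rewrite big_cons; exact: CblipD.
Qed.

Lemma lipschitz_continuous (B : R) phi :
  (forall x y, `|phi x - phi y| <= B * `|x - y|) -> continuous phi.
Proof.
move=> lB x; apply/cvgrPdist_lt => e e0.
have B1 : 0 < `|B| + 1 by rewrite ltr_wpDl.
near=> y; apply: (@le_lt_trans _ _ ((`|B| + 1) * `|x - y|)).
  rewrite (le_trans (lB _ _))// ler_wpM2r// (le_trans (ler_norm _))//.
  by rewrite lerDl.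
rewrite mulrC -ltr_pdivlMr//.
near: y; apply: cvgr_dist_lt => //; exact: divr_gt0.
Unshelve. all: by end_near. Qed.

Lemma Cblip_continuous phi : Cblip phi -> continuous phi.
Proof. by move=> /CblipP[B B0 [_ /lipschitz_continuous]]. Qed.

Lemma continuous_borel_measurable phi :
  continuous phi -> measurable_fun [set: borel V] phi.
Proof.
move=> /continuousP cphi.
apply: (measurability _ (RGenOpens.measurableE R)).
by move=> _ [_ [a [b ->]] <-]; rewrite setTI; apply: sub_sigma_algebra; exact/cphi/interval_open.
Qed.

Lemma Cblip_measurable phi : Cblip phi -> measurable_fun [set: borel V] phi.
Proof. by move=> /Cblip_continuous; exact: continuous_borel_measurable. Qed.

Lemma Cblip_integrable phi (mu : probability (borel V) R) : Cblip phi ->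
  mu.-integrable setT (EFin \o phi).
Proof.
move=> cphi; apply: measurable_bounded_integrable => //.
- by rewrite [X in (X < _)%E](_ : _ = 1%E) ?ltry//; exact: probability_setT.
- exact: Cblip_measurable.
by have [] := cphi.
Qed.

Lemma open_Cblip (O : set V) : open O ->
  exists2 h, Cblip h /\ (forall x, 0 <= h x <= 1) & O = [set x | 0 < h x].
Proof.
move=> oO.
(* The value 1 is adjoined so that [D x] is nonempty, with infimum 1, when O is the whole space;
   otherwise it does not change the infimum. *)
pose D x := [set Num.min 1 `|x - y| | y in ~` O] `|` [set 1].
have D0 x : D x !=set0 by exists 1; right.
have Dlb x : has_lbound (D x).
  by exists 0 => _ [[y _ <-]|->//]; rewrite le_min ler01 normr_ge0.
(* the distance to the complement of O, truncated at 1 *)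
exists (fun x => inf (D x)); last first.
  apply/seteqP; split => x /=.
    move=> Ox; have [e /= e0 he] := (nbhs_ballP x O).1 (open_nbhs_nbhs (conj oO Ox)).
    apply: (@lt_le_trans _ _ (Num.min 1 e)); first by rewrite lt_min ltr01.
    apply: lb_le_inf => // _ [[y nOy <-]|->]; last by rewrite ge_min lexx.
    rewrite le_min !ge_min lexx/=; apply/orP; right.
    rewrite leNgt; apply/negP => xye; apply: nOy; apply: he.
    by rewrite -ball_normE.
  move=> h; apply: contrapT => nOx.
  suff : inf (D x) <= 0 by rewrite leNgt h.
  apply: (ge_inf (Dlb x)); left; exists x => //.
by rewrite subrr normr0; apply: min_r.
split; last first.
  move=> x; apply/andP; split; last by apply: (ge_inf (Dlb x)); right.
  by apply: lb_le_inf => // _ [[y _ <-]|->//]; rewrite le_min ler01 normr_ge0.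
apply/CblipP; exists 1 => //; split=> [x|].
  rewrite ger0_norm; first by apply: (ge_inf (Dlb x)); right.
  by apply: lb_le_inf => // _ [[y _ <-]|->//]; rewrite le_min ler01 normr_ge0.
have key x y : inf (D x) - inf (D y) <= `|x - y|.
  rewrite lerBlDr -lerBlDl; apply: lb_le_inf => // z Dz.
  rewrite lerBlDl; case: Dz => [[t Ot <-]|->]; last first.
    rewrite (@le_trans _ _ 1)//; last by rewrite lerDr.
    by apply: (ge_inf (Dlb x)); right.
  apply: (@le_trans _ _ (Num.min 1 `|x - t|)).
    by apply: (ge_inf (Dlb x)); left; exists t.
  have := ler_distD y x t; have := normr_ge0 (x - y).
  by case: (leP 1 `|x - t|); case: (leP 1 `|y - t|) => *; lra.
move=> x y; rewrite mul1r ler_norml key andbT lerNl opprB distrC; exact: key.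
Qed.

End cblip.

Lemma Cblip_comp (R : realType) (V V' : normedModType R) (f : V -> V') (phi : V' -> R) :
  (forall x y, `|f x - f y| <= `|x - y|) -> Cblip phi -> Cblip (phi \o f).
Proof.
move=> lf /CblipP[B B0 [bB lB]]; apply/CblipP; exists B => //; split=> [x|x y] //=.
by rewrite (le_trans (lB _ _))// ler_wpM2l// ltW.
Qed.

(** * The Daniell-Riesz representation theorem *)

Section riesz.
Context (R : realType) (V : normedModType R) (I : (V -> R) -> R).
Hypothesis ID : forall phi psi, Cblip phi -> Cblip psi ->
  I (fun x => phi x + psi x) = I phi + I psi.
Hypothesis IZ : forall k phi, Cblip phi -> I (fun x => k * phi x) = k * I phi.
Hypothesis Ile : forall phi psi, Cblip phi -> Cblip psi ->
  (forall x, phi x <= psi x) -> I phi <= I psi.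
Hypothesis I1 : I (fun=> 1) = 1.
Hypothesis Idaniell : forall f : nat -> V -> R, (forall n, Cblip (f n)) ->
  (forall n x, 0 <= f n.+1 x <= f n x) -> (forall x, f n x @[n --> \oo] --> 0) ->
  I (f n) @[n --> \oo] --> 0.

Let I0 : I (fun=> 0) = 0.
Proof.
by have := IZ 0 (Cblip_cst V 1); rewrite !mul0r.
Qed.

Let Isum (J : Type) (r : seq J) (f : J -> V -> R) : (forall i, Cblip (f i)) ->
  I (fun x => \sum_(i <- r) f i x) = \sum_(i <- r) I (f i).
Proof.
move=> cf; elim: r => [|i r ih].
  by rewrite big_nil -[RHS]I0; congr I; apply/funext => x; rewrite big_nil.
rewrite big_cons -ih -ID//; last exact: Cblip_sum.
by congr I; apply/funext => x; rewrite big_cons.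
Qed.

Definition supported_below (O : set V) : set (V -> R) :=
  [set phi | [/\ Cblip phi, forall x, 0 <= phi x <= 1 &
                 forall x, ~ O x -> phi x = 0]].

Definition riesz_open (O : set V) : R := sup (I @` supported_below O).

Let below0 O : supported_below O (fun=> 0).
Proof. by split => //; [exact: Cblip_cst|move=> x; rewrite lexx ler01]. Qed.

Let lam_n0 O : I @` supported_below O !=set0.
Proof. by exists (I (fun=> 0)); exists (fun=> 0). Qed.

Let lam_ub O : has_ubound (I @` supported_below O).
Proof.
exists 1 => _ [phi [cphi b _] <-]; rewrite -I1; apply: Ile => //.
  exact: Cblip_cst.
by move=> x; have /andP[] := b x.
Qed.

Let lam_ge O phi : supported_below O phi -> I phi <= riesz_open O.
Proof. by move=> h; apply: (ub_le_sup (lam_ub O)); exists phi. Qed.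

Let lam_le O c : (forall phi, supported_below O phi -> I phi <= c) ->
  riesz_open O <= c.
Proof. by move=> h; apply: ge_sup => // _ [phi p <-]; exact: h. Qed.

Let lam_ge0 O : 0 <= riesz_open O.
Proof. by rewrite -I0; exact: lam_ge. Qed.

Let lam_mono A B : A `<=` B -> riesz_open A <= riesz_open B.
Proof.
move=> AB; apply: lam_le => phi [c b s]; apply: lam_ge; split => // x nBx.
by apply: s => /AB.
Qed.

Let lam_adherent O e : 0 < e ->
  exists2 phi, supported_below O phi & riesz_open O - e < I phi.
Proof.
move=> e0; have [|_ [phi p <-] h] := @sup_adherent _ (I @` supported_below O) e e0.
  by split.
by exists phi.
Qed.

(** The functions min(1, k h_n) increase to the indicator of O n. What phi exceeds the sum of the
    first k of them by decreases to 0 pointwise, so the Daniell hypothesis does here what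
    compactness of the support of phi does in the classical proof. *)
Let lam_sub (O : (set V)^nat) : (forall n, open (O n)) ->
  ((riesz_open (\bigcup_n O n))%:E <= \sum_(i <oo) (riesz_open (O i))%:E)%E.
Proof.
move=> oO.
have /choice[h hP] : forall n, exists h, [/\ Cblip h, forall x, 0 <= h x <= 1 &
    O n = [set x | 0 < h x]].
  by move=> n; have [h [ch bh] eh] := open_Cblip (oO n); exists h.
have ch n : Cblip (h n) by have [] := hP n.
have hge0 n x : 0 <= h n x by have [_ /(_ x)/andP[]] := hP n.
have hO n : O n = [set x | 0 < h n x] by have [] := hP n.
pose psi k n x := Num.min 1 (k%:R * h n x).
have bpsi k n : supported_below (O n) (psi k n).
  split => [|x|x].
  - by apply: Cblip_min; [exact: Cblip_cst|exact: CblipZ].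
  - by rewrite /psi le_min ge_min lexx ler01 mulr_ge0.
  - rewrite hO /psi /= => /negP; rewrite -leNgt => h0.
    have -> : h n x = 0 by apply/eqP; rewrite eq_le h0 hge0.
    by rewrite mulr0 min_r.
have psi_ge0 k n x : 0 <= psi k n x by have [_ /(_ x)/andP[]] := bpsi k n.
have cpsi k n : Cblip (psi k n) by have [] := bpsi k n.
pose S := (\sum_(i <oo) (riesz_open (O i))%:E)%E.
have leS k : ((\sum_(i < k) riesz_open (O i))%:E <= S)%E.
  rewrite -sumEFin -(big_mkord xpredT (fun i => (riesz_open (O i))%:E)).
  by apply: nneseries_lim_ge => i _ _; rewrite lee_fin.
suff key phi : supported_below (\bigcup_n O n) phi -> ((I phi)%:E <= S)%E.
  rewrite -/S; have : (0 <= S)%E by apply: nneseries_ge0 => *; rewrite lee_fin.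
  move: S key {leS} => [s| |]// key s0; last by rewrite leey.
  rewrite lee_fin; apply: lam_le => phi /key; by rewrite lee_fin.
move=> [cphi bphi sphi].
pose f k x := Num.max 0 (phi x - \sum_(i < k) psi k i x).
have cf k : Cblip (f k).
  apply: Cblip_max; first exact: Cblip_cst.
  by apply: CblipB => //; exact: Cblip_sum.
have If : I (f n) @[n --> \oo] --> 0.
  apply: Idaniell => // [n x|x].
    rewrite /f le_max lexx/= ge_max !le_max lexx/=; apply/orP; right.
    rewrite lerB// big_ord_recr/= ler_wpDr//; apply: ler_sum => i _.
    rewrite /psi le_min !ge_min lexx/=; apply/orP; right.
    by rewrite ler_wpM2r// ler_nat.
  have [[n _ Onx]|nOx] := pselect ((\bigcup_n O n) x); last first.
    rewrite (_ : (fun n => f n x) = fun=> 0); first exact: cvg_cst.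
    apply/funext => n; rewrite /f sphi//; apply: max_l.
    by rewrite sub0r oppr_le0 sumr_ge0.
  rewrite hO/= in Onx.
  apply: cvg_near_cst; near=> k.
  rewrite /f; apply: max_l; rewrite subr_le0.
  have /andP[_ /le_trans] := bphi x; apply.
  have nk : (n < k)%N by near: k; exact: nbhs_infty_gt.
  rewrite (bigD1 (Ordinal nk))//= (_ : psi k n x = 1); last first.
    apply: min_l; rewrite -ler_pdivrMr//.
    by near: k; exact: nbhs_infty_ger.
  by rewrite lerDl sumr_ge0.
apply/lee_addgt0Pr => e e0.
move/cvgr0Pnorm_lt : If => /(_ _ e0)[k _ /(_ k (leqnn k))/= hk].
apply: (@le_trans _ _ ((\sum_(i < k) riesz_open (O i))%:E + e%:E)%E); last first.
  by rewrite leeD2r.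
rewrite -EFinD lee_fin.
apply: (@le_trans _ _ (I (fun x => \sum_(i < k) psi k i x + f k x))).
  apply: Ile => //; first by apply: CblipD => //; exact: Cblip_sum.
  by move=> x; rewrite -lerBlDl /f le_max lexx orbT.
rewrite ID//; last exact: Cblip_sum.
rewrite Isum//; apply: lerD.
  by apply: ler_sum => i _; exact: lam_ge.
exact: le_trans (ler_norm _) (ltW hk).
Unshelve. all: by end_near. Qed.

Definition riesz_outer (A : set V) : \bar R :=
  (inf [set riesz_open O | O in [set O | open O /\ A `<=` O]])%:E.

Let mu_n0 A : [set riesz_open O | O in [set O | open O /\ A `<=` O]] !=set0.
Proof. by exists (riesz_open setT); exists setT => //; split => //; exact: openT. Qed.

Let mu_lb A : has_lbound [set riesz_open O | O in [set O | open O /\ A `<=` O]].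
Proof. by exists 0 => _ [G _ <-]. Qed.

Let mu_le A O : open O -> A `<=` O -> (riesz_outer A <= (riesz_open O)%:E)%E.
Proof. by move=> oO AO; rewrite lee_fin; apply: (ge_inf (mu_lb A)); exists O. Qed.

Let mu_ge A c : (forall O, open O -> A `<=` O -> c <= riesz_open O) ->
  (c%:E <= riesz_outer A)%E.
Proof. by move=> h; rewrite lee_fin; apply: lb_le_inf => // _ [G [oG AG] <-]; exact: h. Qed.

Let mu_open O : open O -> riesz_outer O = (riesz_open O)%:E.
Proof.
move=> oO; apply/eqP; rewrite eq_le mu_le//=; apply: mu_ge => O2 _; exact: lam_mono.
Qed.

Let mu_ge0 A : (0 <= riesz_outer A)%E.
Proof. exact: mu_ge. Qed.

Let mu0 : riesz_outer set0 = 0%E.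
Proof.
rewrite mu_open; last exact: open0.
congr EFin; apply/eqP; rewrite eq_le lam_ge0 andbT.
apply: lam_le => phi [_ _ s]; rewrite -I0 (_ : phi = fun=> 0)//.
by apply/funext => x; exact: s.
Qed.

Let mu_mono : {homo riesz_outer : A B / A `<=` B >-> (A <= B)%E}.
Proof.
move=> A B AB; apply: mu_ge => O oO BO; rewrite -lee_fin; apply: mu_le => //.
exact: subset_trans BO.
Qed.

Let mu_sub : sigma_subadditive riesz_outer.
Proof.
move=> A; apply/lee_addgt0Pr => e e0.
have /choice[G GP] : forall n, exists G, [/\ open G, A n `<=` G &
    ((riesz_open G)%:E <= riesz_outer (A n) + (e / (2 ^ n.+1)%:R)%:E)%E].
  move=> n; have en0 : 0 < e / (2 ^ n.+1)%:R by rewrite divr_gt0// ltr0n expn_gt0.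
  have [_ [H [oH AH] <-] h] := @inf_adherent _ _ _ en0 (conj (mu_n0 (A n)) (mu_lb (A n))).
  by exists H; split => //; rewrite lee_fin ltW.
apply: (@le_trans _ _ (riesz_open (\bigcup_n G n))%:E).
  apply: mu_le; first by apply: bigcup_open => n _; have [] := GP n.
  by apply: subset_bigcup => n _; have [] := GP n.
apply: (le_trans (lam_sub _)) => [n|]; first by have [] := GP n.
have mA0 n : (0 <= riesz_outer (A n))%E by exact: mu_ge0.
apply: le_trans (epsilon_trick xpredT mA0 (ltW e0)).
by apply: lee_nneseries => n _; [rewrite lee_fin|have [] := GP n].
Qed.

HB.instance Definition _ :=
  isOuterMeasure.Build R V riesz_outer mu0 mu_ge0 mu_mono mu_sub.

(** A nearly optimal phi below O and G is cut at height e / 3. The cut function lives where phi >= e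
    / 3, and [O2], which contains A minus G, is the part of O where phi < e / 3; so the cut function
    plus any test function below [O2] stays below O. The three losses of e / 3 are the two
    near-optimality errors and the cut. *)
Let cara_open G : open G -> (riesz_outer).-caratheodory G.
Proof.
move=> oG; apply: le_caratheodory_measurable => A.
rewrite -EFinD; apply: mu_ge => O oO AO.
rewrite -lee_fin EFinD.
apply/lee_addgt0Pr => e e0.
have e3 : 0 < e / 3 by rewrite divr_gt0.
have [phi [cphi bphi sphi] hphi] := lam_adherent (O `&` G) e3.
pose phi' x := Num.max 0 (phi x - e / 3).
pose O2 := O `&` [set x | phi x < e / 3].
have oO2 : open O2.
  apply: openI => //; move/Cblip_continuous/continuousP : (cphi) => /(_ `]-oo, e / 3[%classic).
  rewrite (_ : _ @^-1` _ = [set x | phi x < e / 3]); last first.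
    by apply/seteqP; split => x; rewrite /= in_itv.
  by apply; exact: interval_open.
have [psi [cpsi bpsi spsi] hpsi] := lam_adherent O2 e3.
have cphi' : Cblip phi'.
  by apply: Cblip_max; [exact: Cblip_cst|apply: CblipB => //; exact: Cblip_cst].
have : I (fun x => phi' x + psi x) <= riesz_open O.
  apply: lam_ge; split; first exact: CblipD.
    move=> x; have /andP[p0 p1] := bphi x; have /andP[q0 q1] := bpsi x.
    have [h|h] := ltP (phi x) (e / 3).
      by rewrite (_ : phi' x = 0) ?add0r ?q0//; apply: max_l; lra.
    rewrite (spsi x) ?addr0; last by case=> _ /=; rewrite ltNge h.
    by apply/andP; split; rewrite /phi' ?le_max ?lexx// ge_max ler01/=; lra.
  move=> x nOx; rewrite spsi ?addr0; last by case.
  rewrite /phi' sphi; last by case.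
  by apply: max_l; lra.
rewrite ID// => h.
have hphi' : I phi - e / 3 <= I phi'.
  have Ie : I (fun=> e / 3 * 1) = e / 3.
    by rewrite IZ ?I1 ?mulr1//; exact: Cblip_cst.
  have ce : Cblip (fun _ : V => e / 3 * 1) by exact: Cblip_cst.
  rewrite lerBlDr -[e / 3]Ie -ID//.
  apply: Ile => //; first exact: CblipD.
  by move=> x; rewrite mulr1 -lerBlDr /phi' le_max lexx orbT.
apply: (@le_trans _ _ ((riesz_open (O `&` G))%:E + (riesz_open O2)%:E)%E).
  apply: leeD.
    by apply: mu_le; [exact: openI|exact: setSI].
  apply: mu_le => // x [Ax nGx]; split; first exact: AO.
  by rewrite /= sphi// => -[].
by rewrite -!EFinD lee_fin; lra.
Qed.

Definition riesz_measure : set (borel V) -> \bar R := riesz_outer.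

Let cara_borel (A : set (borel V)) : measurable A -> riesz_outer.-cara.-measurable A.
Proof.
move: A; apply: smallest_sub; last exact: cara_open.
exact: sigma_algebra_measurable.
Qed.

Let riesz0 : riesz_measure set0 = 0%E. Proof. exact: mu0. Qed.

Let riesz_sigma : semi_sigma_additive riesz_measure.
Proof.
move=> A mA tA mUA.
apply: (@caratheodory_measure_sigma_additive _ _ riesz_outer A) => //.
  by move=> n; exact: cara_borel.
exact: cara_borel.
Qed.

HB.instance Definition _ := isMeasure.Build _ _ _ riesz_measure riesz0 mu_ge0 riesz_sigma.

Let riesz1 : riesz_measure setT = 1%E.
Proof.
rewrite /riesz_measure mu_open; last exact: openT.
congr EFin; apply/eqP; rewrite eq_le; apply/andP; split.
  apply: lam_le => phi [c b _]; rewrite -I1; apply: Ile => //; first exact: Cblip_cst.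
  by move=> x; have /andP[] := b x.
rewrite -[leLHS]I1; apply: lam_ge; split => //; first exact: Cblip_cst.
  by move=> x; rewrite ler01 lexx.
by move=> x [].
Qed.

HB.instance Definition _ := Measure_isProbability.Build _ _ _ riesz_measure riesz1.

(** The j-th unit layer of y in a discrete layer-cake decomposition: for y >= 0 the first K layers
    add up to min(y, K). *)
Let clamp (y : R) (j : nat) : R := Num.min 1 (Num.max 0 (y - j%:R)).

Let sum_clamp (y : R) K : 0 <= y -> \sum_(j < K) clamp y j = Num.min y K%:R.
Proof.
move=> y0; elim: K => [|K ih]; first by rewrite big_ord0 min_r.
rewrite big_ord_recr/= ih /clamp -natr1.
have : (0 : R) <= K%:R by [].
move: (K%:R : R) => k k0.
case: (leP y k) => yk.
  by rewrite (max_l (_ : y - k <= 0)) ?subr_le0// min_r// addr0 min_l//; lra.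
by rewrite max_r ?subr_ge0 ?ltW//; case: (leP 1 (y - k)) => h;
  case: (leP y (k + 1)) => h'; lra.
Qed.

Let sum_level (y : R) K :
  Num.min y K.+1%:R <= 1 + \sum_(j < K) \1_[set t : R | j.+1%:R < t] y.
Proof.
elim: K => [|K ih]; first by rewrite big_ord0 addr0 ge_min lexx orbT.
rewrite big_ord_recr/= addrA.
have [h|h] := ltP K.+1%:R y.
  rewrite [X in _ + X]indicE mem_set//= -[K.+2%:R]natr1.
  move: ih; rewrite (min_r (ltW h)) => ih.
  by rewrite ge_min lerD// orbT.
rewrite [X in _ + X]indicE memNset/=; last by apply/negP; rewrite -leNgt.
by rewrite addr0 (le_trans _ ih)// (min_l h) ge_min lexx.
Qed.

(** K phi is sliced into K unit layers. Layer j equals 1 on the open set [G j], hence dominates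
    every test function below it, and the content of [G j] is at most I of the layer. Summing costs
    one extra unit, that is 1 / K < e after division by K. *)
Let integral_le01 phi : Cblip phi -> (forall x, 0 <= phi x <= 1) ->
  (\int[riesz_measure]_x (phi x)%:E <= (I phi)%:E)%E.
Proof.
move=> cphi bphi; apply/lee_addgt0Pr => e e0.
pose K := (Num.trunc e^-1).+1.
have K0 : 0 < K%:R :> R by [].
have Ke : K%:R^-1 < e.
  by rewrite invf_plt ?posrE// truncnS_gt.
have mphi := Cblip_measurable cphi.
pose G (j : nat) := [set x | j.+1%:R < K%:R * phi x].
have oG j : open (G j).
  have /Cblip_continuous/continuousP/(_ `]j.+1%:R, +oo[%classic) := CblipZ K%:R cphi.
  rewrite (_ : _ @^-1` _ = G j); last first.
    by apply/seteqP; split => x; rewrite /= in_itv/= andbT.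
  by apply; exact: interval_open.
have mG j : measurable (G j : set (borel V)) by exact: sub_sigma_algebra.
have cc j : Cblip (fun x => clamp (K%:R * phi x) j).
  apply: Cblip_min; first exact: Cblip_cst.
  apply: Cblip_max; first exact: Cblip_cst.
  by apply: CblipB; [exact: CblipZ|exact: Cblip_cst].
have le1 : (\int[riesz_measure]_x (K%:R * phi x)%:E <= (1 + \sum_(j < K) I (fun x => clamp (K%:R * phi x) j))%:E)%E.
  pose S (x : borel V) : \bar R := (1 + \sum_(j < K) (\1_(G j) x : R)%:E)%E.
  have int_S : (\int[riesz_measure]_x (K%:R * phi x)%:E <= \int[riesz_measure]_x S x)%E.
    apply: ge0_le_integral => //.
    - by move=> x _; rewrite lee_fin mulr_ge0//; have /andP[] := bphi x.
    - by apply/measurable_EFinP; exact: Cblip_measurable (CblipZ _ cphi).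
    - apply: emeasurable_funD => //; apply: emeasurable_sum => j.
      by apply/measurable_EFinP; exact: measurable_indic.
    move=> x _; rewrite /S sumEFin -EFinD lee_fin.
    have := sum_level (K%:R * phi x) K; apply: le_trans.
    rewrite le_min lexx/= -[leRHS]mulr1 ler_pM//.
    - by have /andP[] := bphi x.
    - by rewrite ler_nat.
    by have /andP[] := bphi x.
  apply: (le_trans int_S); rewrite /S ge0_integralD//; last 2 first.
  - by move=> x _; apply: sume_ge0 => j _; rewrite lee_fin.
  - apply: emeasurable_sum => j; apply/measurable_EFinP; exact: measurable_indic.
  rewrite integral_cst// mul1e [X in (X + _)%E](_ : _ = 1%E); last exact: riesz1.
  rewrite EFinD leeD2l//.
  rewrite ge0_integral_sum//; last first.
    by move=> j; apply/measurable_EFinP; exact: measurable_indic.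
  rewrite -sumEFin; apply: lee_sum => j _.
  rewrite integral_indic// setIT [leLHS](_ : _ = (riesz_open (G j))%:E); last exact: mu_open.
  rewrite lee_fin.
  apply: lam_le => psi [cpsi bpsi spsi]; apply: Ile => // x.
  have [Gx|/spsi->] := pselect (G j x).
    have /andP[_ /le_trans] := bpsi x; apply.
    rewrite le_min lexx/= le_max; apply/orP; right.
    by rewrite lerBrDr addrC natr1 ltW.
  by rewrite le_min ler01 le_max lexx.
have : (K%:R%:E * \int[riesz_measure]_x (phi x)%:E <= (1 + K%:R * I phi)%:E)%E.
  rewrite -ge0_integralZl_EFin//; last 2 first.
  - by move=> x _; rewrite lee_fin; have /andP[] := bphi x.
  - exact/measurable_EFinP.
  apply: (le_trans le1); rewrite lee_fin lerD2l -IZ// -Isum//.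
  apply: Ile; [exact: Cblip_sum|exact: CblipZ|move=> x].
  by rewrite sum_clamp ?ge_min ?lexx// mulr_ge0//; have /andP[] := bphi x.
rewrite -lee_pdivlMl// => /le_trans; apply.
rewrite -EFinM -EFinD lee_fin mulrDr mulr1 mulKf ?gt_eqF// addrC lerD2l.
exact: ltW.
Qed.

(** The inequality <= for all test functions suffices, since applied to -phi it gives the
    converse. *)
Lemma integral_riesz phi : Cblip phi ->
  (\int[riesz_measure]_x (phi x)%:E = (I phi)%:E)%E.
Proof.
have int psi : Cblip psi -> riesz_measure.-integrable setT (EFin \o psi).
  move=> cpsi; apply: measurable_bounded_integrable => //.
  - by rewrite [X in (X < _)%E](_ : _ = 1%E) ?ltry//; exact: riesz1.
  - exact: Cblip_measurable.
  by have [] := cpsi.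
have le psi : Cblip psi -> (\int[riesz_measure]_x (psi x)%:E <= (I psi)%:E)%E.
  move=> cpsi; have /CblipP[B B0 [bB _]] := cpsi.
  (* This affine change of values maps [-B, B] onto [0, 1], the range treated by [integral_le01]. *)
  have cq : Cblip (fun x => (2 * B)^-1 * psi x + 2^-1).
    by apply: CblipD; [exact: CblipZ|exact: Cblip_cst].
  have := integral_le01 cq.
  have -> : I (fun x => (2 * B)^-1 * psi x + 2^-1) = (2 * B)^-1 * I psi + 2^-1.
    rewrite ID ?IZ//; [|exact: CblipZ|exact: Cblip_cst].
    by have := IZ 2^-1 (Cblip_cst V 1); rewrite I1 !mulr1 => ->.
  under eq_integral do rewrite EFinD.
  rewrite integralD//; last 2 first.
  - by apply: (int (fun x => (2 * B)^-1 * psi x)); exact: CblipZ.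
  - by apply: (int (fun=> 2^-1)); exact: Cblip_cst.
  under eq_integral do rewrite EFinM.
  rewrite integralZl//; last exact: int.
  rewrite integral_cst// [X in (_ + _ * X)%E](_ : _ = 1%E); last exact: riesz1.
  rewrite mule1 EFinD leeD2rE//.
  rewrite EFinM lee_pmul2l//; last by rewrite lte_fin invr_gt0 mulr_gt0.
  apply=> x; have := bB x; rewrite ler_norml => /andP[h1 h2].
  have B20 : 0 < 2 * B by rewrite mulr_gt0.
  have -> : (2 * B)^-1 * psi x + 2^-1 = (psi x + B) / (2 * B).
    by field; rewrite gt_eqF.
  by rewrite ler_pdivlMr// ler_pdivrMr// mul0r mul1r; apply/andP; split; lra.
move=> cphi; apply/eqP; rewrite eq_le le//=.
have cN : Cblip (fun x => -1 * phi x) by exact: CblipZ.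
have := le _ cN; rewrite IZ//.
under eq_integral do rewrite EFinM.
rewrite integralZl//; last exact: int.
by rewrite EFinM EFinN !mulN1e leeN2.
Qed.

Lemma daniell_riesz : exists Q : probability (borel V) R,
  forall phi, Cblip phi -> (\int[Q]_x (phi x)%:E = (I phi)%:E)%E.
Proof. by exists (riesz_measure : probability _ _); exact: integral_riesz. Qed.

End riesz.

(** * Compactness, and measurability of compositions *)

Lemma ultra_compact_cvg (I : Type) (T : topologicalType) (A : set T) (U : set_system I)
    (f : I -> T) : UltraFilter U -> compact A -> U (f @^-1` A) ->
  exists2 p, A p & f i @[i --> U] --> p.
Proof.
move=> UU cA UA; have [p [Ap clp]] := cA (f @ U) _ UA.
exists p => // B Bp; have [//|UnB] := in_ultra_setVsetC (f @^-1` B) UU.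
have {}UnB : (f @ U) (~` B) by exact: UnB.
by have [q [nBq /nBq]] := clp _ _ UnB Bp.
Qed.

(** * The maximum norm of matrices and its compact balls *)

Section matrix_norm.
Context (R : realType) (p q : nat).
Implicit Types A : 'M[R]_(p, q).

Lemma mx_norm_le A c : 0 <= c -> (forall i j, `|A i j| <= c) -> `|A| <= c.
Proof.
by move=> c0 h; rewrite [leLHS]/Num.norm/= mx_normrE; apply/bigmax_leP; split.
Qed.

Lemma mx_entry_le A i j : `|A i j| <= `|A|.
Proof.
by rewrite [leRHS]/Num.norm/= mx_normrE; apply/bigmax_geP; right; exists (i, j).
Qed.

Lemma mx_ball_compact (r : R) : compact [set A : 'M[R]_(p, q) | `|A| <= r].
Proof.
rewrite compact_ultra => F FF Fr.
have /choice[L hL] : forall ij : 'I_p * 'I_q, exists l, `|l| <= r /\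
    (fun A => A ij.1 ij.2) @ F --> l.
  move=> ij; have [|l] := @ultra_compact_cvg _ _ _ F (fun A : 'M[R]_(p, q) => A ij.1 ij.2)
      FF (@segment_compact R (- r) r).
    apply: filterS Fr => A /= Ar; rewrite in_itv/= -ler_norml.
    exact: le_trans (mx_entry_le _ _ _) Ar.
  by rewrite /= in_itv/= -ler_norml => lr h; exists l.
pose A : 'M[R]_(p, q) := \matrix_(i, j) L (i, j).
have r0 : 0 <= r.
  by have [B /=] := filter_ex Fr; exact: le_trans.
exists A; split.
  by apply: mx_norm_le => // i j; rewrite mxE; have [] := hL (i, j).
move=> B /nbhs_ballP[e /= e0 AB]; apply: (filterS AB).
have : \forall y \near F, forall ij, ball (L ij) e ((y : 'M[R]_(p, q)) ij.1 ij.2).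
  apply: filter_forall => ij; have [_] := hL ij.
  by move/cvg_ballP; apply.
by apply: filterS => y yL; split => // i j; rewrite mxE; exact: (yL (i, j)).
Qed.

End matrix_norm.

Section nets.
Context (R : realType) (V : normedModType R).

(** D need not be closed, so the compactness used is that of the ball of V: each centre of a finite
    cover by balls of radius e / 2 is replaced by a point of D in its ball, or by [d0] if the ball
    misses D. *)
Lemma totally_bounded_net (D : set V) (r e : R) : 0 < e ->
  compact [set x : V | `|x| <= r] -> exists zs : seq V, (forall z, z \in zs -> D z) /\
    forall z, D z -> `|z| <= r -> exists2 y, y \in zs & `|z - y| < e.
Proof.
move=> e0 cr.
have [[d0 Dd0]|D0] := pselect (D !=set0); last first.
  by exists [::]; split => // z Dz; absurd (D !=set0) => //; exists z.
have e20 : 0 < e / 2 by rewrite divr_gt0.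
rewrite compact_cover in cr.
have [||G _ hG] := cr V setT (fun x => ball x (e / 2)).
- by move=> x _; exact: ball_open.
- by move=> x _; exists x => //; exact: ballxx.
pose pt c := xget d0 [set z | D z /\ ball c (e / 2) z].
exists [seq pt c | c <- finmap.enum_fset G]; split => [_ /mapP[c _ ->]|z Dz zr].
  by rewrite /pt; case: xgetP => [? _ []|].
have [c /= Gc cz] := hG z zr.
exists (pt c); first exact: map_f.
have [_ cy] : [set z | D z /\ ball c (e / 2) z] (pt c) by apply: (@xgetI _ d0 _ z).
suff : ball z e (pt c) by rewrite -ball_normE.
by rewrite [e]splitr; apply: ball_triangle cy; exact: ball_sym.
Qed.

End nets.

(* g (Z t) t is the limit over finer and finer finite nets of the minimum of
   z |-> g z t + lipker (Z t) z; only finitely many values g z are involved, so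
   measurability and approximability pass from the g z to the composition. *)
Section composition.
Context (R : realType) (V : normedModType R) (T : Type) (D : set V).
Context (g : V -> T -> R) (K : R) (a : nat) (Z : T -> V) (z0 : V).

(** For a = 0 a global Lipschitz bound; for a = 1 the bound of a function whose derivative grows
    linearly. *)
Definition lipker (z z' : V) : R := K * (1 + `|z| + `|z'|) ^+ a * `|z - z'|.

Hypothesis K_ge0 : 0 <= K.
Hypothesis ballc : forall r, compact [set x : V | `|x| <= r].
Hypothesis glip : forall z z' t, D z -> D z' -> `|g z t - g z' t| <= lipker z z'.
Hypothesis ZD : forall t, D (Z t).
Hypothesis Dz0 : D z0.

Definition comp_term z t := g z t + lipker (Z t) z.

(** The default term at z0 gives sense to the minimum over an empty net and, since it always
    competes, bounds the error by 2 [lipker (Z t) z0] whatever the net. Every term lies above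
    [g (Z t) t], so the error has a sign. *)
Definition comp_min (zs : seq V) t :=
  \big[Num.min/comp_term z0 t]_(z <- zs) comp_term z t.

Lemma comp_min_ge zs t : (forall z, z \in zs -> D z) -> g (Z t) t <= comp_min zs t.
Proof.
have ge z : D z -> g (Z t) t <= comp_term z t.
  move=> Dz; rewrite /comp_term -lerBlDl.
  by rewrite (le_trans (ler_norm _))// glip.
rewrite /comp_min; elim: zs => [|z zs ih] Dzs; first by rewrite big_nil ge.
rewrite big_cons le_min ge; last by apply: Dzs; rewrite mem_head.
by apply: ih => y yzs; apply: Dzs; rewrite in_cons yzs orbT.
Qed.

Lemma comp_min_le zs t z : D z -> (z == z0) || (z \in zs) ->
  comp_min zs t <= g (Z t) t + 2 * lipker (Z t) z.
Proof.
move=> Dz hz; apply: (@le_trans _ _ (comp_term z t)); last first.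
  rewrite /comp_term mulr_natl mulr2n addrA lerD2r -lerBlDl.
  rewrite (le_trans (ler_norm _))// distrC glip//.
rewrite /comp_min; elim: zs hz => [|y zs ih].
  by rewrite big_nil orbF => /eqP->.
rewrite in_cons big_cons ge_min => /or3P[/eqP zz0|/eqP->|h].
- by rewrite ih ?orbT// zz0 eqxx.
- by rewrite lexx.
- by rewrite ih ?orbT// h orbT.
Qed.

Definition comp_net (j : nat) : seq V := projT1 (cid
  (totally_bounded_net D (divr_gt0 ltr01 (ltr0Sn R j)) (@ballc j%:R))).

Lemma comp_netD j z : z \in comp_net j -> D z.
Proof. by rewrite /comp_net; case: cid => /= zs [+ _]; apply. Qed.

Lemma comp_netP j z : D z -> `|z| <= j%:R ->
  exists2 y, y \in comp_net j & `|z - y| < 1 / j.+1%:R.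
Proof. by rewrite /comp_net; case: cid => /= zs [_]; apply. Qed.

Lemma comp_net_le j t : `|Z t| <= j%:R ->
  `|comp_min (comp_net j) t - g (Z t) t| <=
  2 * K * (2 * (1 + `|Z t|)) ^+ a * j.+1%:R^-1.
Proof.
move=> Ztj; have [y yj hy] := comp_netP (ZD t) Ztj.
rewrite ger0_norm ?subr_ge0; last by apply: comp_min_ge => ?; exact: comp_netD.
have yz : (y == z0) || (y \in comp_net j) by rewrite yj orbT.
rewrite lerBlDl (le_trans (comp_min_le t (comp_netD yj) yz))//.
rewrite lerD2l /lipker -!mulrA ler_wpM2l// ler_wpM2l// ler_pM ?exprn_ge0 ?addr_ge0//.
  apply: lerXn2r; rewrite ?nnegrE ?mulr_ge0 ?addr_ge0//.
  (* The net point is within 1 of [Z t], so that 1 + |Z t| + |y| <= 2 (1 + |Z t|). *)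
  have : `|y| <= `|Z t| + 1.
    rewrite -lerBlDl (le_trans (lerB_dist _ _))// distrC (le_trans (ltW hy))//.
    by rewrite ler_pdivrMr// mul1r ler1n.
  by move=> ?; rewrite mulrDr mulr1; lra.
by rewrite -[_^-1]mul1r ltW.
Qed.

Lemma comp_min_le0 j t :
  `|comp_min (comp_net j) t - g (Z t) t| <= 2 * lipker (Z t) z0.
Proof.
rewrite ger0_norm ?subr_ge0; last by apply: comp_min_ge => ?; exact: comp_netD.
by rewrite lerBlDl; apply: comp_min_le; rewrite ?eqxx.
Qed.

Lemma comp_net_cvg t : comp_min (comp_net j) t @[j --> \oo] --> g (Z t) t.
Proof.
apply/cvgrPdist_le => e e0.
pose C := 2 * K * (2 * (1 + `|Z t|)) ^+ a.
have C0 : 0 <= C by rewrite !mulr_ge0// exprn_ge0// mulr_ge0// addr_ge0.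
near=> j; rewrite distrC (le_trans (comp_net_le _))//.
  by near: j; exact: nbhs_infty_ger.
rewrite -/C ler_pdivrMr// -ler_pdivrMl// (@le_trans _ _ j%:R)//.
  by near: j; exact: nbhs_infty_ger.
by rewrite ler_nat.
Unshelve. all: by end_near. Qed.

End composition.

Section composition_measurable.
Context d (T : measurableType d) (R : realType) (V : normedModType R) (D : set V).
Context (g : V -> T -> R) (K : R) (a : nat) (Z : T -> V).
Hypothesis K_ge0 : 0 <= K.
Hypothesis ballc : forall r, compact [set x : V | `|x| <= r].
Hypothesis glip : forall z z' t, D z -> D z' -> `|g z t - g z' t| <= lipker K a z z'.
Hypothesis ZD : forall t, D (Z t).
Hypothesis mZ : forall z, measurable_fun setT (fun t => `|Z t - z|).
Hypothesis mg : forall z, D z -> measurable_fun setT (g z).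

Lemma measurable_lipker z : measurable_fun setT (fun t => lipker K a (Z t) z).
Proof.
apply: measurable_funM => //; apply: measurable_funM => //.
apply: measurable_funX; apply: measurable_funD => //; apply: measurable_funD => //.
by have := mZ 0; under eq_fun do rewrite subr0.
Qed.

Lemma measurable_comp_min z0 zs : D z0 -> (forall z, z \in zs -> D z) ->
  measurable_fun setT (comp_min g K a Z z0 zs).
Proof.
have mt z : D z -> measurable_fun setT (comp_term g K a Z z).
  by move=> Dz; apply: measurable_funD; [exact: mg|exact: measurable_lipker].
move=> Dz0; elim: zs => [|z zs ih] Dzs.
  by apply: (eq_measurable_fun (comp_term g K a Z z0)); [move=> t _; rewrite /comp_min big_nil|exact: mt].
apply: (eq_measurable_fun (fun t => Num.min (comp_term g K a Z z t) (comp_min g K a Z z0 zs t))).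
  by move=> t _; rewrite /comp_min big_cons.
apply: measurable_minr; first by apply: mt; apply: Dzs; rewrite mem_head.
by apply: ih => y yzs; apply: Dzs; rewrite in_cons yzs orbT.
Qed.

(** Measurability of Z enters only through the distances |Z - z|, which are all that the minima
    involve; no sigma-algebra on V has to be chosen. *)
Lemma measurable_composition : measurable_fun setT (fun t => g (Z t) t).
Proof.
(* An empty T would provide no base point [Z t0] for the minima. *)
have [[t0 _]|T0] := pselect ([set: T] !=set0); last first.
  move=> _ Y mY; rewrite (_ : _ `&` _ = set0)//.
  by apply/seteqP; split => // t; absurd ([set: T] !=set0) => //; exists t.
pose h j := comp_min g K a Z (Z t0) (comp_net D (@ballc) j).
apply: (@measurable_fun_cvg _ _ _ _ h); last by move=> t _; exact: comp_net_cvg.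
by move=> j; apply: measurable_comp_min => // z; exact: comp_netD.
Qed.

End composition_measurable.

Lemma measurable_mx_norm d (T : measurableType d) (R : realType) p q (Z : T -> 'M[R]_(p, q)) :
  (forall i j, measurable_fun setT (fun t => Z t i j)) ->
  measurable_fun setT (fun t => `|Z t|).
Proof.
move=> mZ; apply: (eq_measurable_fun
    (fun t => \big[Num.max/0]_(ij : 'I_p * 'I_q) `|Z t ij.1 ij.2|)).
  by move=> t _; rewrite [RHS]/Num.norm/= mx_normrE.
elim: (index_enum _) => [|ij s ih].
  by apply: (eq_measurable_fun (fun=> 0 : R)) => // t _; rewrite big_nil.
apply: (eq_measurable_fun (fun t => Num.max `|Z t ij.1 ij.2|
    (\big[Num.max/0]_(ij <- s) `|Z t ij.1 ij.2|))).
  by move=> t _; rewrite big_cons.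
by apply: measurable_maxr => //; exact: measurableT_comp.
Qed.

(** * Functions of the noise *)

Section noise_measurable.
Context (R : realType) (Omega : pointedType) (d : nat) (W : nat -> Omega -> 'cV[R]_d).

Lemma noise_entry_measurable n j i : (1 <= j <= n)%N ->
  measurable_fun [set: filtered W n] (fun w => W j w i ord0).
Proof.
move=> jn.
have mW : measurable_fun [set: filtered W n] (W j : _ -> borel 'cV[R]_d).
  move=> _ B mB; rewrite setTI; apply: sub_sigma_algebra.
  by exists j => //; exists B.
apply: (measurableT_comp (f := fun x : borel 'cV[R]_d => x i ord0)) => //.
apply: continuous_borel_measurable; apply: (@lipschitz_continuous _ _ 1) => x y.
by have := mx_entry_le (x - y) i ord0; rewrite !mxE mul1r.
Qed.

(** The sigma-algebra of the matrix space is generated by open sets, not by entries. An open set is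
    {h > 0} with h Lipschitz, and h of the noise is measurable by [measurable_composition] with
    exponent 0, from the entries alone. *)
Lemma noise_path_measurable n k : (k <= n)%N ->
  measurable_fun [set: filtered W n] (noise_path W k : _ -> borel 'M[R]_(d, k)).
Proof.
move=> kn; have := @measurability _ _ (filtered W n) (borel 'M[R]_(d, k)) setT
  (noise_path W k) (@open _) erefl.
apply => _ [G oG <-].
have [h [ch _] ->] := open_Cblip oG.
rewrite setTI.
suff mh : measurable_fun [set: filtered W n] (fun w => h (noise_path W k w)).
  have := mh (measurableT) `]0, +oo[%classic (measurable_itv _).
  rewrite setTI; congr measurable; apply/seteqP.
  by split => w; rewrite /= in_itv/= andbT.
have /CblipP[B B0 [_ lB]] := ch.
have := @measurable_composition _ (filtered W n) R _ setT (fun z _ => h z) B 0%N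
  (noise_path W k).
apply.
- exact: ltW.
- exact: mx_ball_compact.
- by move=> z z' t _ _; rewrite /lipker expr0 mulr1.
- by [].
- move=> z; apply: measurable_mx_norm => i j.
  apply: (eq_measurable_fun (fun t : filtered W n => W j.+1 t i ord0 - z i j)).
    by move=> t _; rewrite !mxE.
  apply: measurable_funB => //; apply: noise_entry_measurable.
  by rewrite /= (leq_trans (ltn_ord j)).
- by [].
Qed.

Lemma Cblip_noise_measurable n k (phi : 'M[R]_(d, k) -> R) : (k <= n)%N -> Cblip phi ->
  measurable_fun [set: filtered W n] (fun w => phi (noise_path W k w)).
Proof.
move=> kn cphi; apply: (measurableT_comp (f := phi : borel 'M[R]_(d, k) -> R)).
  exact: Cblip_measurable.
exact: noise_path_measurable.
Qed.

Lemma filtered_measurable_fun n k (X : Omega -> R) : (k <= n)%N ->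
  measurable_fun [set: filtered W k] X -> measurable_fun [set: filtered W n] X.
Proof.
move=> kn mX _ B mB; have := mX measurableT B mB.
apply: sub_sigma_algebra2 => _ [j /= /andP[j1 jk] [C mC <-]].
by exists j; [rewrite /= j1 (leq_trans jk)|exists C].
Qed.

End noise_measurable.

(** * Initial columns and single columns of a matrix *)

Section columns.
Context (R : realType) (d : nat).

(** Total in k and j, with zero as default for missing columns, so that no dimension has to be cast.
    Columns are numbered from 0 and the noise from 1, hence column k carries W_{k+1}. *)
Definition take_cols k j (x : 'M[R]_(d, j)) : 'M[R]_(d, k) :=
  \matrix_(i, l) oapp (x i) 0 (insub (l : nat)).

Definition nth_col k j (x : 'M[R]_(d, j)) : 'cV[R]_d :=
  \col_i oapp (x i) 0 (insub k).

Lemma take_cols_id k (x : 'M[R]_(d, k)) : take_cols k x = x.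
Proof.
by apply/matrixP => i l; rewrite mxE valK.
Qed.

Lemma add_colE k (x : 'M[R]_(d, k)) y i (l : 'I_k.+1) :
  add_col x y i l = oapp (x i) (y i ord0) (insub (l : nat)).
Proof.
rewrite /add_col castmxE cast_ord_id mxE; case: splitP => l' /= hl.
  by rewrite hl valK.
rewrite insubF; last by rewrite hl ltnNge leq_addr.
by rewrite (ord1 l').
Qed.

Lemma take_add_col k j (x : 'M[R]_(d, j)) y : (k <= j)%N ->
  take_cols k (add_col x y) = take_cols k x.
Proof.
move=> kj; apply/matrixP => i l; rewrite !mxE.
have lj : (l < j)%N by rewrite (leq_trans (ltn_ord l)).
have lj1 : (l < j.+1)%N by rewrite ltnW.
by rewrite !insubT/= add_colE insubT.
Qed.

Lemma nth_add_col k (x : 'M[R]_(d, k)) y : nth_col k (add_col x y) = y.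
Proof.
apply/matrixP => i l; rewrite !mxE insubT// => h /=.
by rewrite add_colE insubF ?ord1//= ltnn.
Qed.

Lemma take_cols_lip k j (x x' : 'M[R]_(d, j)) :
  `|take_cols k x - take_cols k x'| <= `|x - x'|.
Proof.
apply: mx_norm_le => // i l; rewrite !mxE; case: insubP => [l' _ _|_]/=; last first.
  by rewrite subrr normr0.
by have := mx_entry_le (x - x') i l'; rewrite !mxE.
Qed.

Lemma nth_col_lip k j (x x' : 'M[R]_(d, j)) :
  `|nth_col k x - nth_col k x'| <= `|x - x'|.
Proof.
apply: mx_norm_le => // i l; rewrite !mxE; case: insubP => [l' _ _|_]/=; last first.
  by rewrite subrr normr0.
by have := mx_entry_le (x - x') i l'; rewrite !mxE.
Qed.

Lemma add_col_lip k (x x' : 'M[R]_(d, k)) y y' :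
  `|add_col x y - add_col x' y'| <= Num.max `|x - x'| `|y - y'|.
Proof.
apply: mx_norm_le => [|i l]; first by rewrite le_max normr_ge0.
rewrite !mxE !add_colE; case: insubP => [l' _ _|_]/=; rewrite le_max.
  by have := mx_entry_le (x - x') i l'; rewrite !mxE => ->.
by have := mx_entry_le (y - y') i ord0; rewrite !mxE => ->; rewrite orbT.
Qed.

Lemma Cblip_add_colr k (phi : 'M[R]_(d, k.+1) -> R) (x : 'M[R]_(d, k)) : Cblip phi ->
  Cblip (fun y => phi (add_col x y)).
Proof.
apply: Cblip_comp => y y'; rewrite (le_trans (add_col_lip _ _ _ _))//.
by rewrite subrr normr0 ge_max lexx normr_ge0.
Qed.

Context (Omega : pointedType) (W : nat -> Omega -> 'cV[R]_d).

Lemma take_noise_path k n w : (k <= n)%N ->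
  take_cols k (noise_path W n w) = noise_path W k w.
Proof.
move=> kn; apply/matrixP => i l; rewrite !mxE insubT ?(leq_trans (ltn_ord l))//= => h.
by rewrite mxE.
Qed.

Lemma nth_noise_path k n w : (k < n)%N -> nth_col k (noise_path W n w) = W k.+1 w.
Proof.
by move=> kn; apply/matrixP => i l; rewrite !mxE insubT/= mxE (ord1 l).
Qed.

End columns.

(** * The recursive expectation, for one law and for the family of laws *)

Section cylinder.
Context (R : realType) (d : nat).
Implicit Types E : ('cV[R]_d -> R) -> R.

(* the recursion of Ehat_cyl with an arbitrary one-step functional *)
Fixpoint cyl E (k : nat) : ('M[R]_(d, k) -> R) -> R :=
  match k with
  | 0 => fun phi => phi 0
  | k'.+1 => fun phi => cyl E (fun x : 'M[R]_(d, k') => E (fun y => phi (add_col x y)))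
  end.

(** A step over a column on which the function does not depend sees a constant, which E
    preserves. *)
Lemma cyl_take_cols E k j (phi : 'M[R]_(d, k) -> R) : (forall c, E (fun=> c) = c) ->
  (k <= j)%N -> cyl E (fun x : 'M[R]_(d, j) => phi (take_cols k x)) = cyl E phi.
Proof.
move=> Ecst; elim: j => [|j ih].
  rewrite leqn0 => /eqP k0; subst k; congr cyl; apply/funext => x.
  by rewrite take_cols_id.
rewrite leq_eqVlt => /predU1P[kj|kj].
  by subst k; congr cyl; apply/funext => x; rewrite take_cols_id.
rewrite -ih//=; congr cyl; apply/funext => x.
by under eq_fun do rewrite take_add_col//; rewrite Ecst.
Qed.

Lemma cyl_cst E k c : (forall c, E (fun=> c) = c) ->
  cyl E (fun _ : 'M[R]_(d, k) => c) = c.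
Proof. by move=> Ecst; elim: k => //= k ih; rewrite Ecst ih. Qed.

Section one_step_law.
Context (mu : probability (borel 'cV[R]_d) R).
Let E (phi : 'cV[R]_d -> R) : R := \int[mu]_x phi x.

Lemma Rintegral_prob_cst c : E (fun=> c) = c.
Proof.
rewrite /E Rintegral_cst// [X in fine X](_ : _ = 1%E) ?mulr1//.
exact: probability_setT.
Qed.

Lemma Rintegral_prob_le phi psi : Cblip phi -> Cblip psi ->
  (forall x, phi x <= psi x) -> E phi <= E psi.
Proof. by move=> cphi cpsi h; apply: le_Rintegral => //; exact: Cblip_integrable. Qed.

Lemma Rintegral_prob_norm_le phi B : Cblip phi -> (forall x, `|phi x| <= B) ->
  `|E phi| <= B.
Proof.
move=> cphi bB; have cB := Cblip_cst 'cV[R]_d.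
rewrite ler_norml; apply/andP; split.
  have := @Rintegral_prob_le (fun=> - B) phi (cB _) cphi.
  by rewrite Rintegral_prob_cst; apply=> x; have := bB x; rewrite ler_norml => /andP[].
have := @Rintegral_prob_le phi (fun=> B) cphi (cB _).
by rewrite Rintegral_prob_cst; apply=> x; have := bB x; rewrite ler_norml => /andP[].
Qed.

Lemma Cblip_Rintegral_add_col k (phi : 'M[R]_(d, k.+1) -> R) : Cblip phi ->
  Cblip (fun x => E (fun y => phi (add_col x y))).
Proof.
move=> cphi; have /CblipP[B B0 [bB lB]] := cphi.
apply/CblipP; exists B => //; split=> [x|x x'].
  by apply: Rintegral_prob_norm_le => //; exact: Cblip_add_colr.
rewrite /E -RintegralB//; try by apply: Cblip_integrable; exact: Cblip_add_colr.
apply: Rintegral_prob_norm_le => [|y].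
  by apply: CblipB; exact: Cblip_add_colr.
rewrite (le_trans (lB _ _))// ler_pM2l// (le_trans (add_col_lip _ _ _ _))//.
by rewrite subrr normr0 ge_max lexx normr_ge0.
Qed.

Lemma cyl_lawD k (phi psi : 'M[R]_(d, k) -> R) : Cblip phi -> Cblip psi ->
  cyl E (fun x => phi x + psi x) = cyl E phi + cyl E psi.
Proof.
elim: k phi psi => //= k ih phi psi cphi cpsi.
rewrite -ih; try exact: Cblip_Rintegral_add_col.
congr cyl; apply/funext => x; rewrite /E RintegralD//; apply: Cblip_integrable;
  exact: Cblip_add_colr.
Qed.

Lemma cyl_lawZ k c (phi : 'M[R]_(d, k) -> R) : Cblip phi ->
  cyl E (fun x => c * phi x) = c * cyl E phi.
Proof.
elim: k phi => //= k ih phi cphi.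
rewrite -ih; try exact: Cblip_Rintegral_add_col.
congr cyl; apply/funext => x; rewrite /E RintegralZl//; apply: Cblip_integrable;
  exact: Cblip_add_colr.
Qed.

Lemma cyl_law_le k (phi psi : 'M[R]_(d, k) -> R) : Cblip phi -> Cblip psi ->
  (forall x, phi x <= psi x) -> cyl E phi <= cyl E psi.
Proof.
elim: k phi psi => //= k ih phi psi cphi cpsi h.
apply: ih; try exact: Cblip_Rintegral_add_col.
by move=> x; apply: Rintegral_prob_le => //; exact: Cblip_add_colr.
Qed.

(** Integrating out the last column keeps the sequence decreasing and, by dominated convergence
    under [f 0], convergent to 0 pointwise; so the induction goes through. *)
Lemma cyl_law_daniell k (f : nat -> 'M[R]_(d, k) -> R) : (forall n, Cblip (f n)) ->
  (forall n x, 0 <= f n.+1 x <= f n x) -> (forall x, f n x @[n --> \oo] --> 0) ->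
  cyl E (f n) @[n --> \oo] --> 0.
Proof.
elim: k f => [|k ih] f cf decf f0 /=; first exact: f0.
have f_ge0 n x : 0 <= f n x.
  by have /andP[h1 h2] := decf n x; exact: le_trans h2.
have f_le n x : f n x <= f 0%N x.
  elim: n => // n; apply: le_trans; by have /andP[] := decf n x.
apply: ih => [n|n x|x].
- exact: Cblip_Rintegral_add_col.
- apply/andP; split; first by apply: Rintegral_ge0.
  apply: Rintegral_prob_le; try exact: Cblip_add_colr.
  by move=> y; have /andP[] := decf n (add_col x y).
have -> : 0 = fine (\int[mu]_y (0 : R)%:E)%E by rewrite integral0.
apply: fine_cvg; rewrite integral0/=.
have := @dominated_cvg _ (borel 'cV[R]_d) R mu setT measurableT
  (fun n y => (f n (add_col x y))%:E) (fun=> 0%E) (fun y => (f 0%N (add_col x y))%:E).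
rewrite integral0; apply.
- by move=> n; apply/measurable_EFinP; apply: Cblip_measurable; exact: Cblip_add_colr.
- move=> y _; apply: cvg_EFin; last exact: f0.
  by apply: nearW.
- by [].
- by apply: (@Cblip_integrable _ _ (fun y => f 0%N (add_col x y))); exact: Cblip_add_colr.
- by move=> n y _; rewrite /= lee_fin ger0_norm.
Unshelve. all: by end_near. Qed.

(** The law of k independent columns distributed as mu. The representation theorem yields it
    directly on the Borel sets of the matrix space, without comparing them with a product
    sigma-algebra. *)
Lemma product_law k : exists Q : probability (borel 'M[R]_(d, k)) R,
  forall phi, Cblip phi -> (\int[Q]_x (phi x)%:E = (cyl E phi)%:E)%E.
Proof.
apply: daniell_riesz.
- exact: cyl_lawD.
- by move=> c phi; exact: cyl_lawZ.
- exact: cyl_law_le.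
- exact: cyl_cst Rintegral_prob_cst.
- exact: cyl_law_daniell.
Qed.

End one_step_law.

Section sublinear.
Context (Theta : Type) (F : Theta -> probability (borel 'cV[R]_d) R).
Hypothesis Theta_n0 : inhabited Theta.

Lemma Ehat_cylE k (phi : 'M[R]_(d, k) -> R) : Ehat_cyl F phi = cyl (Ehat1 F) phi.
Proof. by elim: k phi => //= k ih phi; rewrite ih. Qed.

Lemma Ehat1_cst c : Ehat1 F (fun=> c) = c.
Proof.
rewrite /Ehat1 [X in sup X](_ : _ = [set c]) ?sup1//.
case: Theta_n0 => th; apply/seteqP; split=> [_ [t _ <-]|_ ->] /=.
  exact: Rintegral_prob_cst.
by exists th => //; exact: Rintegral_prob_cst.
Qed.

Lemma Ehat1_ge psi th : Cblip psi -> \int[F th]_x psi x <= Ehat1 F psi.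
Proof.
move=> cpsi; apply: ub_le_sup; last by exists th.
have /CblipP[B B0 [bB _]] := cpsi.
exists B => _ [t _ <-]; rewrite -(Rintegral_prob_cst (F t) B).
apply: Rintegral_prob_le => //; first exact: Cblip_cst.
by move=> x; exact: le_trans (ler_norm _) (bB x).
Qed.

Lemma Ehat1_le psi c : (forall th, \int[F th]_x psi x <= c) -> Ehat1 F psi <= c.
Proof.
move=> h; apply: ge_sup => [|_ [t _ <-]//].
by case: Theta_n0 => th; exists (\int[F th]_x psi x); exists th.
Qed.

Lemma Ehat1_affine psi a b : 0 <= a -> Cblip psi ->
  Ehat1 F (fun y => a * psi y + b) = a * Ehat1 F psi + b.
Proof.
move=> a0 cpsi.
have cab : Cblip (fun y => a * psi y + b).
  by apply: CblipD; [exact: CblipZ|exact: Cblip_cst].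
have Eab th : \int[F th]_y (a * psi y + b) = a * (\int[F th]_y psi y) + b.
  rewrite RintegralD//; [|exact: (Cblip_integrable _ (CblipZ _ cpsi))|
    exact: (Cblip_integrable _ (Cblip_cst _ b))].
  by rewrite RintegralZl ?Rintegral_prob_cst//; exact: Cblip_integrable.
apply/eqP; rewrite eq_le; apply/andP; split.
  apply: Ehat1_le => th; rewrite Eab lerD2r ler_wpM2l//; exact: Ehat1_ge.
have [->|an0] := eqVneq a 0.
  by rewrite mul0r add0r; under eq_fun do rewrite mul0r add0r; rewrite Ehat1_cst.
have {an0}a0 : 0 < a by rewrite lt_neqAle eq_sym an0.
rewrite -lerBrDr mulrC -ler_pdivlMr//; apply: Ehat1_le => th.
by rewrite ler_pdivlMr// lerBrDr mulrC -Eab; exact: Ehat1_ge.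
Qed.

(** Bound and Lipschitz constant are uniform in theta and survive the supremum, so the recursion
    stays within the test functions. *)
Lemma Cblip_Ehat1_add_col k (phi : 'M[R]_(d, k.+1) -> R) : Cblip phi ->
  Cblip (fun x => Ehat1 F (fun y => phi (add_col x y))).
Proof.
move=> cphi; have /CblipP[B B0 [bB lB]] := cphi.
apply/CblipP; exists B => //; split=> [x|x x'].
  rewrite ler_norml; apply/andP; split; last first.
    apply: Ehat1_le => th; rewrite -[leRHS](Rintegral_prob_cst (F th) B).
    apply: Rintegral_prob_le; [exact: Cblip_add_colr|exact: Cblip_cst|move=> y].
    by have := bB (add_col x y); rewrite ler_norml => /andP[].
  case: Theta_n0 => th; apply: le_trans (Ehat1_ge th _); last exact: Cblip_add_colr.
  rewrite -(Rintegral_prob_cst (F th) (- B)).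
  apply: Rintegral_prob_le; [exact: Cblip_cst|exact: Cblip_add_colr|move=> y].
  by have := bB (add_col x y); rewrite ler_norml => /andP[].
have key z z' : Ehat1 F (fun y => phi (add_col z y)) -
    Ehat1 F (fun y => phi (add_col z' y)) <= B * `|z - z'|.
  rewrite lerBlDr; apply: Ehat1_le => th.
  rewrite -lerBlDl; apply: le_trans (Ehat1_ge th _); last exact: Cblip_add_colr.
  rewrite -[X in _ - X](Rintegral_prob_cst (F th)).
  rewrite -RintegralB//; try (by apply: Cblip_integrable; exact: Cblip_add_colr);
    try (by apply: Cblip_integrable; exact: Cblip_cst).
  apply: Rintegral_prob_le; try exact: Cblip_add_colr.
    by apply: CblipB; [exact: Cblip_add_colr|exact: Cblip_cst].
  move=> y; rewrite lerBlDr -lerBlDl (le_trans (ler_norm _))//.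
  rewrite (le_trans (lB _ _))// ler_pM2l// (le_trans (add_col_lip _ _ _ _))//.
  by rewrite subrr normr0 ge_max lexx normr_ge0.
by rewrite ler_norml key andbT lerNl opprB distrC key.
Qed.

Lemma cyl_law_le_Ehat th k (phi : 'M[R]_(d, k) -> R) : Cblip phi ->
  cyl (fun psi => \int[F th]_y psi y) phi <= Ehat_cyl F phi.
Proof.
elim: k phi => //= k ih phi cphi.
apply: le_trans (ih _ (Cblip_Ehat1_add_col cphi)).
apply: cyl_law_le; [exact: Cblip_Rintegral_add_col|exact: Cblip_Ehat1_add_col|].
by move=> x; apply: Ehat1_ge; exact: Cblip_add_colr.
Qed.

End sublinear.

End cylinder.

(** * Closures of Lip(F_k) *)

Section integral_bounds.
Context dT (T : measurableType dT) (R : realType) (P : probability T R).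
Implicit Types f g h : T -> R.

Lemma integral_prob_cst (c : R) : (\int[P]_w (c%:E) = c%:E)%E.
Proof.
by rewrite integral_cst// [X in (_ * X)%E](_ : _ = 1%E) ?mule1//; exact: probability_setT.
Qed.

Lemma ge0_integral_le f g (e : R) : measurable_fun setT f -> measurable_fun setT g ->
  (forall w, 0 <= f w <= g w) -> (\int[P]_w (g w)%:E <= e%:E)%E ->
  (\int[P]_w (f w)%:E <= e%:E)%E.
Proof.
move=> mf mg fg; apply: le_trans; apply: ge0_le_integral => //.
- by move=> w _; rewrite lee_fin; have /andP[] := fg w.
- exact/measurable_EFinP.
- exact/measurable_EFinP.
- by move=> w _; rewrite lee_fin; have /andP[] := fg w.
Qed.

(** The common form of the mean estimates below: a triangle, convexity or AM-GM inequality between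
    nonnegative functions is proved pointwise and integrated afterwards, so that integrability is
    never an issue. *)
Lemma ge0_integral_le2 f g h (a b e1 e2 : R) : measurable_fun setT f ->
  measurable_fun setT g -> measurable_fun setT h -> 0 <= a -> 0 <= b ->
  (forall w, 0 <= f w) -> (forall w, 0 <= g w) ->
  (forall w, 0 <= h w <= a * f w + b * g w) ->
  (\int[P]_w (f w)%:E <= e1%:E)%E -> (\int[P]_w (g w)%:E <= e2%:E)%E ->
  (\int[P]_w (h w)%:E <= (a * e1 + b * e2)%:E)%E.
Proof.
move=> mf mg mh a0 b0 f0 g0 hfg If Ig.
have maf : measurable_fun setT (fun w => a * f w) by exact: measurable_funM.
have mbg : measurable_fun setT (fun w => b * g w) by exact: measurable_funM.
apply: (@ge0_integral_le _ (fun w => a * f w + b * g w)) => //.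
  exact: measurable_funD.
under eq_integral do rewrite EFinD.
rewrite ge0_integralD//.
- under eq_integral do rewrite EFinM.
  under [in X in (_ + X)%E]eq_integral do rewrite EFinM.
  rewrite !ge0_integralZl_EFin//; try exact/measurable_EFinP.
  + by rewrite EFinD !EFinM leeD// lee_wpmul2l.
  + by move=> w _; rewrite lee_fin.
  + by move=> w _; rewrite lee_fin.
- by move=> w _; rewrite lee_fin mulr_ge0.
- exact/measurable_EFinP.
- by move=> w _; rewrite lee_fin mulr_ge0.
- exact/measurable_EFinP.
Qed.

End integral_bounds.

Lemma exprD_le (R : realType) p (x y : R) : 0 <= x -> 0 <= y ->
  (x + y) ^+ p <= 2 ^+ p * (x ^+ p + y ^+ p).
Proof.
move=> x0 y0; wlog xy : x y x0 y0 / x <= y.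
  by move=> h; case: (leP x y) => [|/ltW] xy; [|rewrite addrC [in leRHS]addrC]; exact: h.
apply: (@le_trans _ _ ((2 * y) ^+ p)).
  by apply: lerXn2r; rewrite ?nnegrE ?addr_ge0 ?mulr_ge0//; lra.
by rewrite exprMn ler_wpM2l ?exprn_ge0// lerDr exprn_ge0.
Qed.

Section approximable.
Context (R : realType) (Omega : pointedType) (d N : nat).
Context (W : nat -> Omega -> 'cV[R]_d).
Local Notation T := (filtered W N).
Context (PP : set (probability T R)).
Implicit Types (X Y : Omega -> R) (P : probability T R).

Definition Lipk k X := exists2 phi : 'M[R]_(d, k) -> R, Cblip phi &
  X = (fun w => phi (noise_path W k w)).

(* The closure of Lip(F_k) in L^p, uniformly over PP: L_c^p(F_k) without the
   identification of random variables, hence only F_N-measurable. *)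
Definition Lcl (p k : nat) X := measurable_fun [set: T] X /\
  forall e : R, 0 < e -> exists2 Y, Lipk k Y &
    forall P, PP P -> (\int[P]_w (`|X w - Y w| ^+ p)%:E <= e%:E)%E.

Lemma Lipk_bounded k X : Lipk k X -> exists2 B : R, 0 < B & forall w, `|X w| <= B.
Proof. by move=> [phi /CblipP[B B0 [bB _]] ->]; exists B. Qed.

Lemma Lipk_lip2 (H : R -> R -> R) (K : R) k X Y :
  (forall a b a' b', `|H a b - H a' b'| <= K * (`|a - a'| + `|b - b'|)) ->
  Lipk k X -> Lipk k Y -> Lipk k (fun w => H (X w) (Y w)).
Proof.
move=> hH [phi cphi ->] [psi cpsi ->].
by exists (fun x => H (phi x) (psi x)) => //; exact: Cblip_lip2 cphi cpsi.
Qed.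

Lemma LipkM k X Y : Lipk k X -> Lipk k Y -> Lipk k (fun w => X w * Y w).
Proof.
by move=> [phi cphi ->] [psi cpsi ->]; exists (fun x => phi x * psi x) => //; exact: CblipM.
Qed.

Lemma Lipk_cst k c : Lipk k (fun=> c).
Proof. by exists (fun=> c) => //; exact: Cblip_cst. Qed.

Lemma Lipk_widen k j X : (k <= j)%N -> Lipk k X -> Lipk j X.
Proof.
move=> kj [phi cphi ->]; exists (phi \o @take_cols R d k j).
  by apply: Cblip_comp cphi => x x'; exact: take_cols_lip.
by apply/funext => w /=; rewrite take_noise_path.
Qed.

Section bounded_index.
Context (k : nat).
Hypothesis kN : (k <= N)%N.

Lemma Lipk_measurable X : Lipk k X -> measurable_fun [set: T] X.
Proof. by move=> [phi cphi ->]; exact: Cblip_noise_measurable. Qed.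

Lemma measurable_distX p X Y : measurable_fun [set: T] X -> measurable_fun [set: T] Y ->
  measurable_fun [set: T] (fun w => `|X w - Y w| ^+ p).
Proof.
move=> mX mY; apply: measurable_funX; apply: measurableT_comp => //.
exact: measurable_funB.
Qed.

Lemma Lipk_Lcl p X : (0 < p)%N -> Lipk k X -> Lcl p k X.
Proof.
move=> p0 LX; split; first exact: Lipk_measurable.
move=> e e0; exists X => // P _.
under eq_integral do rewrite subrr normr0 expr0n gtn_eqF//=.
by rewrite integral0 lee_fin ltW.
Qed.

Lemma Lcl_cst p c : (0 < p)%N -> Lcl p k (fun=> c).
Proof. by move=> p0; apply: Lipk_Lcl => //; exact: Lipk_cst. Qed.

Lemma Lcl_closed p X : measurable_fun [set: T] X ->
  (forall e : R, 0 < e -> exists2 Y, Lcl p k Y &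
    forall P, PP P -> (\int[P]_w (`|X w - Y w| ^+ p)%:E <= e%:E)%E) -> Lcl p k X.
Proof.
move=> mX h; split => // e e0.
pose c : R := 2 ^+ p.
have c0 : 0 < c by rewrite exprn_gt0.
have e1 : 0 < e / (2 * c) by rewrite divr_gt0// mulr_gt0.
have [Y [mY aY] hY] := h _ e1.
have [Y' LY' hY'] := aY _ e1.
have mY' := Lipk_measurable LY'.
exists Y' => // P PPP.
have -> : e = c * (e / (2 * c)) + c * (e / (2 * c)) by field; rewrite gt_eqF.
apply: (ge0_integral_le2 (P := P) (f := fun w => `|X w - Y w| ^+ p)
  (g := fun w => `|Y w - Y' w| ^+ p)); try (by exact: ltW);
  try (by exact: measurable_distX); try (by move=> w; rewrite exprn_ge0).
- move=> w; rewrite exprn_ge0//= -mulrDr.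
  apply: le_trans (exprD_le p (normr_ge0 _) (normr_ge0 _)).
  by apply: lerXn2r; rewrite ?nnegrE ?addr_ge0// ler_distD.
- exact: hY.
- exact: hY'.
Qed.

Lemma Lcl_lip2 p (H : R -> R -> R) (K : R) X Y :
  measurable_fun [set: T] (fun w => H (X w) (Y w)) ->
  (forall a b a' b', `|H a b - H a' b'| <= K * (`|a - a'| + `|b - b'|)) ->
  Lcl p k X -> Lcl p k Y -> Lcl p k (fun w => H (X w) (Y w)).
Proof.
move=> mH hH [mX aX] [mY aY]; split=> // e e0.
have K0 : 0 <= K.
  have := hH 1 0 0 0; rewrite !subr0 normr1 normr0 addr0 mulr1.
  exact: le_trans.
pose c : R := (K * 2) ^+ p + 1.
have c0 : 0 < c by rewrite ltr_wpDl// exprn_ge0// mulr_ge0.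
have e1 : 0 < e / (2 * c) by rewrite divr_gt0// mulr_gt0.
have [X' LX' hX'] := aX _ e1.
have [Y' LY' hY'] := aY _ e1.
exists (fun w => H (X' w) (Y' w)) => [|P PPP]; first exact: Lipk_lip2 LX' LY'.
have mHL := Lipk_measurable (Lipk_lip2 hH LX' LY').
have -> : e = c * (e / (2 * c)) + c * (e / (2 * c)) by field; rewrite gt_eqF.
have mX' := Lipk_measurable LX'.
have mY' := Lipk_measurable LY'.
apply: (ge0_integral_le2 (P := P) (f := fun w => `|X w - X' w| ^+ p)
  (g := fun w => `|Y w - Y' w| ^+ p)); try (by exact: ltW);
  try (by exact: measurable_distX); try (by move=> w; rewrite exprn_ge0).
- move=> w; rewrite exprn_ge0//= -mulrDr.
  apply: (@le_trans _ _ ((K * (`|X w - X' w| + `|Y w - Y' w|)) ^+ p)).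
    by apply: lerXn2r; rewrite ?nnegrE ?mulr_ge0 ?addr_ge0.
  rewrite exprMn (@le_trans _ _ (K ^+ p * (2 ^+ p * (`|X w - X' w| ^+ p + `|Y w - Y' w| ^+ p))))//.
    by rewrite ler_wpM2l ?exprn_ge0// exprD_le.
  by rewrite mulrA -exprMn ler_wpM2r ?addr_ge0 ?exprn_ge0// lerDl.
- exact: hX'.
- exact: hY'.
Qed.

Lemma Lcl_add p X Y : Lcl p k X -> Lcl p k Y -> Lcl p k (fun w => X w + Y w).
Proof.
move=> aX aY; apply: (@Lcl_lip2 p (fun a b => a + b) 1 _ _ _ _ aX aY) => [|a b a' b'].
  by apply: measurable_funD; [exact: aX.1|exact: aY.1].
by rewrite mul1r opprD addrACA ler_normD.
Qed.

Lemma Lcl_sub p X Y : Lcl p k X -> Lcl p k Y -> Lcl p k (fun w => X w - Y w).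
Proof.
move=> aX aY; apply: (@Lcl_lip2 p (fun a b => a - b) 1 _ _ _ _ aX aY) => [|a b a' b'].
  by apply: measurable_funB; [exact: aX.1|exact: aY.1].
rewrite mul1r; have -> : a - b - (a' - b') = (a - a') - (b - b') by ring.
exact: ler_normB.
Qed.

Lemma Lcl_scale p c X : Lcl p k X -> Lcl p k (fun w => c * X w).
Proof.
move=> aX; apply: (@Lcl_lip2 p (fun a b => c * a) `|c| _ _ _ _ aX aX) => [|a b a' b'].
  by apply: measurable_funM => //; exact: aX.1.
by rewrite -mulrBr normrM ler_wpM2l// lerDl.
Qed.

Lemma Lcl_max p X Y : Lcl p k X -> Lcl p k Y -> Lcl p k (fun w => Num.max (X w) (Y w)).
Proof.
move=> aX aY; apply: (Lcl_lip2 _ (@lip_maxr R) aX aY).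
by apply: measurable_maxr; [exact: aX.1|exact: aY.1].
Qed.

Lemma Lcl_min p X Y : Lcl p k X -> Lcl p k Y -> Lcl p k (fun w => Num.min (X w) (Y w)).
Proof.
move=> aX aY; apply: (Lcl_lip2 _ (@lip_minr R) aX aY).
by apply: measurable_minr; [exact: aX.1|exact: aY.1].
Qed.

Lemma Lcl_abs p X : Lcl p k X -> Lcl p k (fun w => `|X w|).
Proof.
move=> aX; apply: (@Lcl_lip2 p (fun a b => `|a|) 1 _ _ _ _ aX aX) => [|a b a' b'].
  by apply: measurableT_comp => //; exact: aX.1.
by rewrite mul1r (le_trans (ler_dist_dist _ _))// lerDl.
Qed.

Lemma Lcl_sum p (I : Type) (s : seq I) (X : I -> Omega -> R) : (0 < p)%N ->
  (forall i, Lcl p k (X i)) -> Lcl p k (fun w => \sum_(i <- s) X i w).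
Proof.
move=> p0 aX; elim: s => [|i s ih].
  by under eq_fun do rewrite big_nil; exact: Lcl_cst.
by under eq_fun do rewrite big_cons; exact: Lcl_add.
Qed.

Lemma Lcl2_bound X : Lcl 2 k X ->
  exists2 M : R, 0 < M & forall P, PP P -> (\int[P]_w (X w ^+ 2)%:E <= M%:E)%E.
Proof.
move=> [mX aX]; have [Y LY hY] := aX 1 ltr01.
have [B B0 bB] := Lipk_bounded LY.
exists (2 * 1 + 2 * B ^+ 2) => [|P PPP]; first by rewrite addr_gt0// mulr_gt0// exprn_gt0.
apply: (ge0_integral_le2 (P := P) (f := fun w => `|X w - Y w| ^+ 2) (g := fun=> B ^+ 2)) => //.
- by apply: measurable_distX => //; exact: Lipk_measurable.
- exact: measurable_funX.
- by move=> w; rewrite exprn_ge0// ltW.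
- move=> w; rewrite sqr_ge0/= real_normK ?num_real//; have h := bB w.
  have h2 : Y w ^+ 2 <= B ^+ 2.
    by rewrite -[Y w ^+ 2]real_normK ?num_real// lerXn2r ?nnegrE// ltW.
  by have := sqr_ge0 (X w - 2 * Y w); nra.
- exact: hY.
- by rewrite integral_prob_cst.
Qed.

(** If |Y| <= B then the positive part of X - B is at most |X - Y|: closeness to a bounded variable
    is uniform integrability. *)
Lemma Lcl2_tail X (e : R) : Lcl 2 k X -> 0 < e ->
  exists2 B : R, 0 < B & forall P, PP P ->
    (\int[P]_w (Num.max 0 (X w - B) ^+ 2)%:E <= e%:E)%E.
Proof.
move=> [mX aX] e0; have [Y LY hY] := aX _ e0.
have [B B0 bB] := Lipk_bounded LY; exists B => // P PPP.
apply: (ge0_integral_le (P := P)) (hY P PPP).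
- by apply: measurable_funX; apply: measurable_maxr => //; exact: measurable_funB.
- by apply: measurable_distX => //; exact: Lipk_measurable.
move=> w; rewrite sqr_ge0/=; apply: lerXn2r; rewrite ?nnegrE ?le_max ?lexx//.
rewrite ge_max normr_ge0/= (le_trans _ (ler_norm _))// lerB//.
exact: le_trans (ler_norm _) (bB w).
Qed.

(** In X Y - X' Y' = X (Y - Y') + Y' (X - X') the choice has two stages: Y' against the second
    moment of X, then X' against the bound of Y'. Weighted AM-GM plays the part of
    Cauchy-Schwarz. *)
Lemma Lcl_mul X Y : Lcl 2 k X -> Lcl 2 k Y -> Lcl 1 k (fun w => X w * Y w).
Proof.
move=> AX AY; have [M M0 bM] := Lcl2_bound AX.
have [mX aX] := AX; have [mY aY] := AY.
have mXY : measurable_fun [set: T] (fun w => X w * Y w) by exact: measurable_funM.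
split=> // e e0.
(* [eta], and [s] below, are AM-GM weights. The first product costs e / 4 + e / 8, the second e / 8
   + e / 8, and 3 e / 8 is left over. *)
pose eta := e / (2 * M).
have eta0 : 0 < eta by rewrite divr_gt0// mulr_gt0.
have [Y' LY' hY'] := aY (e / 4 * eta) (mulr_gt0 (divr_gt0 e0 (ltr0Sn _ 3)) eta0).
have [B B0 bB] := Lipk_bounded LY'.
pose s := e / (4 * B).
have s0 : 0 < s by rewrite divr_gt0// mulr_gt0.
have es0 : 0 < s * (e / (4 * B)) by rewrite mulr_gt0.
have [X' LX' hX'] := aX _ es0.
have [mX' mY'] := (Lipk_measurable LX', Lipk_measurable LY').
exists (fun w => X' w * Y' w) => [|P PPP]; first exact: LipkM.
have h1 : (\int[P]_w (`|X w| * `|Y w - Y' w|)%:E <= (eta / 2 * M + (2 * eta)^-1 * (e / 4 * eta))%:E)%E.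
  apply: (ge0_integral_le2 (P := P) (f := fun w => X w ^+ 2) (g := fun w => `|Y w - Y' w| ^+ 2)).
  - exact: measurable_funX.
  - exact: measurable_distX.
  - by apply: measurable_funM; apply: measurableT_comp => //; exact: measurable_funB.
  - by rewrite ltW// divr_gt0.
  - by rewrite invr_ge0 ltW// mulr_gt0.
  - by move=> w; exact: sqr_ge0.
  - by move=> w; exact: sqr_ge0.
  - move=> w; rewrite mulr_ge0//= -[X w ^+ 2]real_normK ?num_real//.
    move: `|X w| `|_ - _| => x y.
    rewrite -subr_ge0 (_ : _ - _ = (2 * eta)^-1 * (eta * x - y) ^+ 2).
      by rewrite mulr_ge0 ?sqr_ge0// invr_ge0 ltW// mulr_gt0.
    by field; rewrite gt_eqF.
  - exact: bM.
  - exact: hY'.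
have h2 : (\int[P]_w (`|X w - X' w|)%:E <= (1 / (2 * s) * (s * (e / (4 * B))) + s / 2 * 1)%:E)%E.
  apply: (ge0_integral_le2 (P := P) (f := fun w => `|X w - X' w| ^+ 2) (g := fun=> 1)) => //.
  - exact: measurable_distX.
  - by apply: measurableT_comp => //; exact: measurable_funB.
  - by rewrite ltW// divr_gt0// mulr_gt0.
  - by rewrite ltW// divr_gt0.
  - move=> w; rewrite normr_ge0/=; move: `|_ - _| => x.
    rewrite -subr_ge0 (_ : _ - _ = (2 * s)^-1 * (x - s) ^+ 2).
      by rewrite mulr_ge0 ?sqr_ge0// invr_ge0 ltW// mulr_gt0.
    by field; rewrite gt_eqF.
  - exact: hX'.
  - by rewrite integral_prob_cst.
have -> : e = 1 * (eta / 2 * M + (2 * eta)^-1 * (e / 4 * eta)) +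
    (B * (1 / (2 * s) * (s * (e / (4 * B))) + s / 2 * 1) + 3 / 8 * e).
  by rewrite /eta /s; field; rewrite !gt_eqF.
apply: (@le_trans _ _ (1 * (eta / 2 * M + (2 * eta)^-1 * (e / 4 * eta)) +
    (B * (1 / (2 * s) * (s * (e / (4 * B))) + s / 2 * 1)))%:E).
  apply: (ge0_integral_le2 (P := P) (f := fun w => `|X w| * `|Y w - Y' w|)
    (g := fun w => `|X w - X' w|)) => //.
  - by apply: measurable_funM; apply: measurableT_comp => //; exact: measurable_funB.
  - by apply: measurableT_comp => //; exact: measurable_funB.
  - by apply: measurable_distX => //; exact: measurable_funM.
  - exact: ltW.
  - move=> w; rewrite expr1 normr_ge0/= mul1r.
    have -> : X w * Y w - X' w * Y' w = X w * (Y w - Y' w) + Y' w * (X w - X' w) by ring.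
    rewrite (le_trans (ler_normD _ _))// !normrM lerD2l ler_wpM2r//; exact: bB.
by rewrite lee_fin addrA lerDl mulr_ge0// ltW.
Qed.

(* Uniform integrability of the squares of M turns a domination by M ^ 2 and a
   uniform convergence on each set M <= alpha into convergence of the means. *)
Lemma vanish_dominated (I : Type) (G : set_system I) (FG : Filter G)
    (Y : I -> Omega -> R) (M : Omega -> R) (C : R) :
  Lcl 2 k M -> (forall w, 0 <= M w) -> 0 <= C ->
  (\forall i \near G, measurable_fun [set: T] (Y i) /\
     forall w, 0 <= Y i w <= C * M w ^+ 2) ->
  (forall alpha e : R, 0 < alpha -> 0 < e ->
     \forall i \near G, forall w, M w <= alpha -> Y i w <= e) ->
  forall e : R, 0 < e -> \forall i \near G, forall P, PP P ->
    (\int[P]_w (Y i w)%:E <= e%:E)%E.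
Proof.
move=> aM M0 C0 dom unif e e0.
pose c := 4 * C + 1.
have c0 : 0 < c by rewrite ltr_wpDl// mulr_ge0.
have [B B0 hB] := Lcl2_tail aM (divr_gt0 e0 (mulr_gt0 (ltr0Sn R 1) c0)).
have e2 : 0 < e / 2 by rewrite divr_gt0.
near=> i.
have [mY domi] : measurable_fun [set: T] (Y i) /\ forall w, 0 <= Y i w <= C * M w ^+ 2.
  by near: i.
have unifi : forall w, M w <= 2 * B -> Y i w <= e / 2.
  by near: i; apply: unif; rewrite ?mulr_gt0.
move=> P PPP.
have -> : e = 1 * (e / 2) + c * (e / (2 * c)) by field; rewrite gt_eqF.
apply: (ge0_integral_le2 (P := P) (f := fun=> e / 2) (g := fun w => Num.max 0 (M w - B) ^+ 2)) => //.
- by apply: measurable_funX; apply: measurable_maxr => //; apply: measurable_funB => //; exact: aM.1.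
- exact: ltW.
- by move=> _; exact: ltW.
- by move=> w; exact: sqr_ge0.
- move=> w; have /andP[Yi0 YiM] := domi w; rewrite Yi0/= mul1r.
  (* Beyond 2 B one has M <= 2 (M - B), which turns the domination by C M^2 into 4 C times the
     squared tail. *)
  have [h|h] := leP (M w) (2 * B).
    by rewrite (le_trans (unifi _ h))// lerDl mulr_ge0 ?sqr_ge0// ltW.
  rewrite max_r; last by rewrite subr_ge0; lra.
  have : C * M w ^+ 2 <= 4 * C * (M w - B) ^+ 2.
    rewrite (mulrC 4) -mulrA ler_wpM2l// -subr_ge0.
    have -> : 4 * (M w - B) ^+ 2 - M w ^+ 2 = (M w - 2 * B) * (3 * M w - 2 * B) by ring.
    by rewrite mulr_ge0//; lra.
  have := sqr_ge0 (M w - B); rewrite /c; lra.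
- by rewrite integral_prob_cst.
- exact: hB.
Unshelve. all: by end_near. Qed.

End bounded_index.

Lemma Lcl_widen p k j X : (k <= j)%N -> Lcl p k X -> Lcl p j X.
Proof.
move=> kj [mX aX]; split => // e e0; have [Y LY hY] := aX e e0.
by exists Y => //; exact: Lipk_widen LY.
Qed.

End approximable.

(** * Differentiable functions of approximable variables *)

Section mean_value.
Context (R : realType) (V : normedModType R) (D : set V).
Context (g : V -> R) (Dg : V -> V -> R).
Hypothesis Dconv : forall z z' (t : R), D z -> D z' -> 0 <= t <= 1 -> D (z + t *: (z' - z)).
Hypothesis Dg_diff : forall z, D z -> diff_within D g z (Dg z).
Hypothesis DgZ : forall z (t : R) h, D z -> Dg z (t *: h) = t * Dg z h.
Hypothesis Dg_bound : forall z, D z -> exists C : R, forall h, `|Dg z h| <= C * `|h|.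

(** Differentiability holds relatively to D only, so g may not be evaluated off the segment.
    Clamping the parameter to [0, 1] makes the path, and g along it, a continuous function on the
    whole line to which the classical theorem applies. *)
Lemma segment_mean_value z z' : D z -> D z' ->
  exists2 t : R, 0 <= t <= 1 & g z' - g z = Dg (z + t *: (z' - z)) (z' - z).
Proof.
move=> Dz Dz'; set h := z' - z.
pose clamp (s : R) : R := Num.max 0 (Num.min 1 s).
have clamp01 s : 0 <= clamp s <= 1.
  by rewrite /clamp le_max lexx ge_max ler01 ge_min lexx.
have clamp_id s : 0 <= s <= 1 -> clamp s = s.
  by move=> /andP[s0 s1]; rewrite /clamp (min_r s1) (max_r s0).
have clamp_lip s s' : `|clamp s - clamp s'| <= `|s - s'|.
  have h1 := @lip_maxr R 0 (Num.min 1 s) 0 (Num.min 1 s').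
  have h2 := @lip_minr R 1 s 1 s'.
  by move: h1 h2; rewrite !subrr normr0 !add0r !mul1r => h1 h2; exact: le_trans h2.
pose c (s : R) : V := z + clamp s *: h.
have Dc s : D (c s) by exact: Dconv.
have cB s s' : c s - c s' = (clamp s - clamp s') *: h.
  by rewrite /c opprD addrACA subrr add0r scalerBl.
have c_lip s s' : `|c s - c s'| <= `|h| * `|s - s'|.
  by rewrite cB normrZ mulrC ler_wpM2l.
have c_cvg s : c s' @[s' --> s] --> c s.
  apply/cvgrPdist_lt => e e0; near=> s'.
  rewrite (le_lt_trans (c_lip _ _))// (@le_lt_trans _ _ ((`|h| + 1) * `|s - s'|))//.
    by rewrite ler_wpM2r// lerDl.
  rewrite mulrC -ltr_pdivlMr ?ltr_wpDl//.
  by near: s'; apply: cvgr_dist_lt => //; rewrite divr_gt0// ltr_wpDl.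
have F_near (e s : R) : 0 < e -> \forall s' \near s,
    `|g (c s') - g (c s) - Dg (c s) (c s' - c s)| <= e * `|c s' - c s|.
  move=> e0; have := Dg_diff (Dc s) e0; rewrite /within/= => Pc.
  have {}Pc : \forall s' \near s, D (c s') ->
      `|g (c s') - g (c s) - Dg (c s) (c s' - c s)| <= e * `|c s' - c s|.
    exact: (c_cvg s _ Pc).
  by apply: filterS Pc => s' Ps'; apply: Ps'; exact: Dc.
have F_cont : continuous (fun s => g (c s)).
  move=> s; have [C hC] := Dg_bound (Dc s).
  apply/cvgrPdist_lt => e e0.
  pose B := (1 + `|C|) * `|h| + 1.
  have B0 : 0 < B by rewrite ltr_wpDl// mulr_ge0// addr_ge0.
  near=> s'.
  have h1 : `|g (c s') - g (c s) - Dg (c s) (c s' - c s)| <= 1 * `|c s' - c s|.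
    by near: s'; exact: F_near.
  have h2 := hC (c s' - c s).
  rewrite distrC (@le_lt_trans _ _ (B * `|s - s'|))//.
    have -> : g (c s') - g (c s) = (g (c s') - g (c s) - Dg (c s) (c s' - c s)) +
      Dg (c s) (c s' - c s) by ring.
    rewrite (le_trans (ler_normD _ _))//.
    apply: (@le_trans _ _ ((1 + `|C|) * `|c s' - c s|)).
      by rewrite mulrDl lerD// (le_trans h2)// ler_wpM2r// ler_norm.
    apply: (@le_trans _ _ ((1 + `|C|) * (`|h| * `|s - s'|))).
      by rewrite ler_wpM2l ?addr_ge0// (distrC s) c_lip.
    by rewrite mulrA ler_wpM2r// lerDl.
  rewrite mulrC -ltr_pdivlMr//.
  by near: s'; apply: cvgr_dist_lt => //; rewrite divr_gt0.
have F_der (s : R) : s \in `]0, 1[%R -> is_derive s (1 : R) (fun s => g (c s)) (Dg (c s) h).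
  rewrite in_itv/= => /andP[s0 s1].
  have cvgF : (t^-1 *: (g (c (t *: (1 : R) + s)) - g (c s))) @[t --> 0^'] --> Dg (c s) h.
    apply/cvgrPdist_le => e e0.
    have e1 : 0 < e / (`|h| + 1) by rewrite divr_gt0// ltr_wpDl.
    have shift : (fun t : R => t *: (1 : R) + s) @ 0^' --> s.
      apply: cvg_trans (_ : (fun t : R => t *: (1 : R) + s) @ 0 --> s).
        by apply: cvg_app; exact: nbhs_dnbhs.
      have : (fun t : R => t *: (1 : R) + s) @ 0 --> (0 : R) *: (1 : R) + s.
        by apply: cvgD; [apply: cvgZr_tmp|exact: cvg_cst].
      by rewrite scale0r add0r.
    (* Around an interior s the clamp is the identity, and the increment of [c] is exactly t times
       h. *)
    have near01 : \forall s' \near s, 0 <= s' <= 1.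
      have := @near_in_itvoo R 0 1 s; rewrite in_itv/= s0 s1 => /(_ isT).
      by apply: filterS => x; rewrite in_itv/= => /andP[x0 x1]; rewrite !ltW.
    near=> t.
    have tn0 : t != 0 by near: t; exact: nbhs_dnbhs_neq.
    have t01 : 0 <= t *: (1 : R) + s <= 1 by near: t; exact: shift near01.
    have ht : `|g (c (t *: (1 : R) + s)) - g (c s) - Dg (c s) (c (t *: (1 : R) + s) - c s)|
        <= e / (`|h| + 1) * `|c (t *: (1 : R) + s) - c s|.
      by near: t; exact: (shift _ (F_near _ s e1)).
    move: ht; rewrite cB !clamp_id// ?(ltW s0) ?(ltW s1)// addrK DgZ// [t *: 1]mulr1 => ht.
    rewrite distrC -(ler_pM2l (_ : 0 < `|t|)) ?normr_gt0// -normrM mulrBr.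
    rewrite [t * (t^-1 *: _)]mulrA divff// mul1r (le_trans ht)// normrZ.
    rewrite mulrCA ler_wpM2l// -mulrA ler_piMr//; first exact: ltW.
    by rewrite ler_pdivrMl ?mulr1 ?lerDl// ltr_wpDl.
  by apply: DeriveDef; [apply/cvg_ex; exists (Dg (c s) h)|exact: cvg_lim cvgF].
have [t /[!in_itv]/= /andP[t0 t1]] := MVT ltr01 F_der (continuous_subspaceT F_cont).
rewrite subr0 mulr1 /c !clamp_id ?lexx ?ler01 ?(ltW t0) ?(ltW t1)//.
rewrite scale0r scale1r addr0 (_ : z + h = z'); last by rewrite /h addrC subrK.
by move=> h1; exists t; rewrite ?(ltW t0) ?(ltW t1).
Unshelve. all: by end_near. Qed.
End mean_value.

Lemma weighted_amgm (R : realFieldType) (t x y : R) : 0 < t ->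
  2 * x * y <= 2 * t * x ^+ 2 + 2 / t * y ^+ 2.
Proof.
move=> t0; rewrite -subr_ge0.
rewrite (_ : _ - _ = (t * x - y) ^+ 2 / t + (t * x ^+ 2 + y ^+ 2 / t)).
  apply: addr_ge0; last apply: addr_ge0.
  - exact: divr_ge0 (sqr_ge0 _) (ltW t0).
  - exact: mulr_ge0 (ltW t0) (sqr_ge0 _).
  - exact: divr_ge0 (sqr_ge0 _) (ltW t0).
by field; rewrite gt_eqF.
Qed.

Section differentiable_composition.
Context (R : realType) (Omega : pointedType) (d N : nat).
Context (W : nat -> Omega -> 'cV[R]_d).
Local Notation T := (filtered W N).
Context (PP : set (probability T R)) (k : nat).
Hypothesis kN : (k <= N)%N.
Context (V : normedModType R) (D : set V).
Hypothesis ballc : forall r : R, compact [set x : V | `|x| <= r].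
Context (p a : nat) (K : R).
Hypothesis K_ge0 : 0 <= K.
(* Lipschitz coefficients are handled in L^2, and costs, whose Lipschitz
   constant grows linearly, in L^1 *)
Hypothesis pa : (p = 1%N /\ a = 1%N) \/ (p = 2%N /\ a = 0%N).

Let p0 : (0 < p)%N. Proof. by case: pa => -[->]. Qed.

(** Both pairs satisfy p (a + 1) = 2: the p-th power of an error of order M^(a + 1) is of order M^2,
    as [vanish_dominated] requires. *)
Let powM (M : R) : (M ^+ a * M) ^+ p = M ^+ 2.
Proof. by case: pa => -[-> ->]; rewrite ?expr1 ?expr0 ?mul1r// expr2. Qed.

Section composition.
Context (g : V -> Omega -> R).
Hypothesis glip : forall z z' w, D z -> D z' -> `|g z w - g z' w| <= lipker K a z z'.
Hypothesis Ag : forall z, D z -> Lcl PP p k (g z).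

(** The approximants [B j] are finite minima of approximable variables. Their error is at most 2
    [lipker (Z w) z0], hence of order M^2 after the power p, and tends to 0 uniformly where M is
    bounded. *)
Lemma Lcl_composition (Z : Omega -> V) : (forall w, D (Z w)) ->
  (forall z, Lcl PP 2 k (fun w => `|Z w - z|)) ->
  Lcl PP p k (fun w => g (Z w) w).
Proof.
move=> ZD AZ; pose z0 := Z point; have Dz0 : D z0 by exact: ZD.
have AZ0 : Lcl PP 2 k (fun w => `|Z w|).
  by have := AZ 0; under eq_fun do rewrite subr0.
have mZ z : measurable_fun [set: T] (fun w => `|Z w - z|) by exact: (AZ z).1.
have mg z : D z -> measurable_fun [set: T] (g z) by move=> Dz; exact: (Ag Dz).1.
have mgZ : measurable_fun [set: T] (fun w => g (Z w) w).
  exact: (@measurable_composition _ T R V D g K a Z K_ge0 ballc glip ZD mZ mg).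
have Alip z : Lcl PP p k (fun w => lipker K a (Z w) z).
  rewrite /lipker; case: pa => -[-> ->].
    under eq_fun do rewrite expr1 -mulrA.
    apply: (Lcl_scale kN); apply: (Lcl_mul kN) => //.
    have A1 := Lcl_cst PP kN (1 + `|z|) (isT : (0 < 2)%N).
    by have := Lcl_add kN A1 AZ0; congr Lcl; apply/funext => w; rewrite addrAC.
  under eq_fun do rewrite expr0 mulr1.
  exact: (Lcl_scale kN).
have Aterm z : D z -> Lcl PP p k (comp_term g K a Z z).
  by move=> Dz; apply: (Lcl_add kN) => //; exact: Ag.
have Amin zs : (forall z, z \in zs -> D z) -> Lcl PP p k (comp_min g K a Z z0 zs).
  elim: zs => [|z zs ih] Dzs.
    rewrite (_ : comp_min _ _ _ _ _ _ = comp_term g K a Z z0); first exact: Aterm.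
    by apply/funext => w; rewrite /comp_min big_nil.
  rewrite (_ : comp_min _ _ _ _ _ _ =
      fun w => Num.min (comp_term g K a Z z w) (comp_min g K a Z z0 zs w)); last first.
    by apply/funext => w; rewrite /comp_min big_cons.
  apply: (Lcl_min kN); first by apply: Aterm; apply: Dzs; rewrite mem_head.
  by apply: ih => y yzs; apply: Dzs; rewrite in_cons yzs orbT.
pose B j := comp_min g K a Z z0 (comp_net D (@ballc) j).
have AB j : Lcl PP p k (B j) by apply: Amin => z; exact: comp_netD.
pose M w := 1 + `|z0| + `|Z w|.
have M1 w : 1 <= M w by rewrite /M -addrA lerDl addr_ge0.
have M0 w : 0 <= M w by exact: le_trans ler01 (M1 w).
have AM : Lcl PP 2 k M.
  by apply: (Lcl_add kN) => //; exact: (Lcl_cst _ kN).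
have vanish e : 0 < e -> \forall j \near \oo, forall P, PP P ->
    (\int[P]_w (`|g (Z w) w - B j w| ^+ p)%:E <= e%:E)%E.
  apply: (vanish_dominated kN _ (C := (2 * K) ^+ p) AM M0).
  - by rewrite exprn_ge0// mulr_ge0.
  - apply: nearW => j; split; first exact: (measurable_distX p mgZ (AB j).1).
    move=> w; rewrite exprn_ge0//= -powM -exprMn.
    apply: lerXn2r; rewrite ?nnegrE ?mulr_ge0 ?exprn_ge0//.
    rewrite distrC (le_trans (comp_min_le0 ballc glip ZD Dz0 _ _))//.
    rewrite /lipker -!mulrA ler_wpM2l// ler_wpM2l// ler_pM ?exprn_ge0 ?addr_ge0//.
      by apply: lerXn2r; rewrite ?nnegrE ?addr_ge0// /M addrAC.
    by rewrite (le_trans (ler_normB _ _))// /M addrC lerD2r lerDr.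
  - move=> alpha e1 alpha0 e10.
    pose c := 2 * K * (2 * alpha) ^+ a + 1.
    have c0 : 0 < c by rewrite ltr_wpDl// !mulr_ge0// exprn_ge0// mulr_ge0// ltW.
    (* Below 1 a p-th power is at most its base, so e2 ^ p <= e1 for either p. *)
    pose e2 := Num.min 1 e1.
    have e20 : 0 < e2 by rewrite lt_min ltr01.
    near=> j => w Mw.
    have Zal : 1 + `|Z w| <= alpha by rewrite (le_trans _ Mw)// /M addrAC lerDl.
    have h1 : `|g (Z w) w - B j w| <= e2.
      rewrite distrC (le_trans (comp_net_le K_ge0 ballc glip ZD Dz0 _))//.
        rewrite (@le_trans _ _ alpha)//; first by rewrite (le_trans _ Zal)// lerDr.
        by near: j; exact: nbhs_infty_ger.
      rewrite ler_pdivrMr//.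
      apply: (@le_trans _ _ c).
        rewrite /c ler_wpDr// ler_wpM2l ?mulr_ge0//.
        apply: lerXn2r; rewrite ?nnegrE ?mulr_ge0 ?addr_ge0//; first exact: ltW.
        by rewrite ler_pM2l.
      rewrite -ler_pdivrMl// (@le_trans _ _ j%:R)//; last by rewrite ler_nat.
      by near: j; exact: nbhs_infty_ger.
    have h2 : e2 ^+ p <= e1.
      rewrite (@le_trans _ _ e2)//; last by rewrite /e2 ge_min lexx orbT.
      have e21 : e2 <= 1 by rewrite /e2 ge_min lexx.
      by case: (p) p0 => // q _; rewrite exprS ler_piMr ?exprn_ile1// ltW.
    by rewrite (le_trans _ h2)//; apply: lerXn2r; rewrite ?nnegrE// ltW.
apply: (Lcl_closed kN mgZ) => e e0.
have [j _ hj] := vanish e e0.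
by exists (B j) => // P PPP; apply: (hj j) => //=.
Unshelve. all: by end_near. Qed.

End composition.

Section derivative.
Context (g : V -> Omega -> R) (Dg : V -> Omega -> V -> R).
Hypothesis Dconv : forall z z' (t : R), D z -> D z' -> 0 <= t <= 1 -> D (z + t *: (z' - z)).
Hypothesis Dg_diff : forall z w, D z -> diff_within D (g^~ w : V -> R) z (Dg z w).
Hypothesis DgZ : forall z w (t : R) h, D z -> Dg z w (t *: h) = t * Dg z w h.
Hypothesis Dg_bound : forall z w h, D z -> `|Dg z w h| <= K * (1 + `|z|) ^+ a * `|h|.
Hypothesis Dg_modulus : forall alpha e : R, 0 < alpha -> 0 < e ->
  exists2 eta : R, 0 < eta & forall z z' w h, D z -> D z' ->
    `|z| <= alpha -> `|z'| <= alpha -> `|z - z'| <= eta ->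
    `|Dg z w h - Dg z' w h| <= e * `|h|.
Hypothesis Ag : forall z, D z -> Lcl PP p k (g z).

Let mean_value z z' w : D z -> D z' ->
  exists2 t : R, 0 <= t <= 1 & g z' w - g z w = Dg (z + t *: (z' - z)) w (z' - z).
Proof.
move=> Dz Dz'.
apply: (@segment_mean_value _ _ D (g^~ w) (fun z => Dg z w)) => //.
- by move=> y Dy; exact: Dg_diff.
- by move=> y t h Dy; exact: DgZ.
- by move=> y Dy; exists (K * (1 + `|y|) ^+ a) => h; exact: Dg_bound.
Qed.

Lemma derivative_lip z z' w : D z -> D z' -> `|g z w - g z' w| <= lipker K a z z'.
Proof.
move=> Dz Dz'; rewrite distrC.
have [t /andP[t0 t1] ->] := mean_value w Dz Dz'.
have Dt : D (z + t *: (z' - z)) by apply: Dconv => //; rewrite t0.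
rewrite (le_trans (Dg_bound _ _ Dt))// /lipker (distrC z).
rewrite ler_wpM2r// ler_wpM2l//; apply: lerXn2r; rewrite ?nnegrE ?addr_ge0//.
rewrite -addrA lerD2l.
have -> : z + t *: (z' - z) = (1 - t) *: z + t *: z'.
  by rewrite scalerBl scale1r scalerBr addrA addrAC.
rewrite (le_trans (ler_normD _ _))// !normrZ !ger0_norm ?subr_ge0//.
by apply: lerD; rewrite ler_piMl// lerBlDr lerDl.
Qed.

Section quotient.
Context (Z H : Omega -> V).
Hypothesis ZD : forall w, D (Z w).
Hypothesis ZHD : forall w, D (Z w + H w).
Hypothesis AZH : forall eps z, 0 <= eps <= 1 ->
  Lcl PP 2 k (fun w => `|Z w + eps *: H w - z|).
Hypothesis AH : Lcl PP 2 k (fun w => `|H w|).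

Let M w := 1 + `|Z w| + `|H w|.

Let Dseg w (eps : R) : 0 <= eps <= 1 -> D (Z w + eps *: H w).
Proof.
by move=> /(Dconv (ZD w) (ZHD w)); rewrite addrAC subrr add0r.
Qed.

Let G eps w := (g (Z w + eps *: H w) w - g (Z w) w) / eps - Dg (Z w) w (H w).

(** By the mean value theorem the error of the quotient along the segment is a difference of two
    derivatives in the same direction H, which the growth bound and the modulus of Dg control. *)
Let G_mean eps w : 0 < eps <= 1 -> exists2 t : R, 0 <= t <= 1 &
  G eps w = Dg (Z w + (t * eps) *: H w) w (H w) - Dg (Z w) w (H w).
Proof.
move=> /andP[eps0 eps1]; have Deps : D (Z w + eps *: H w) by apply: Dseg; rewrite ltW.
have [t /andP[t0 t1] ht] := mean_value w (ZD w) Deps.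
exists t; first by rewrite t0.
have Dt : D (Z w + (t * eps) *: H w).
  by apply: Dseg; rewrite mulr_ge0 ?(ltW eps0)//= mulr_ile1 ?(ltW eps0).
have E : Z w + eps *: H w - Z w = eps *: H w by rewrite addrAC subrr add0r.
by rewrite /G ht E scalerA DgZ// mulrAC divff ?gt_eqF// mul1r.
Qed.

Let M1 w : 1 <= M w. Proof. by rewrite /M -addrA lerDl addr_ge0. Qed.
Let M0 w : 0 <= M w. Proof. exact: le_trans ler01 (M1 w). Qed.

Let ZM (eps : R) w : 0 <= eps <= 1 -> `|Z w + eps *: H w| <= `|Z w| + `|H w|.
Proof.
move=> /andP[e0 e1]; rewrite (le_trans (ler_normD _ _))// lerD2l normrZ ger0_norm//.
by rewrite ler_piMl.
Qed.

Let G_bound eps w : 0 < eps <= 1 -> `|G eps w| <= 2 * K * (M w ^+ a * M w).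
Proof.
move=> /[dup] /andP[eps0 eps1] /(G_mean w)[t /andP[t0 t1] ->].
have te : 0 <= t * eps <= 1 by rewrite mulr_ge0 ?(ltW eps0)//= mulr_ile1 ?(ltW eps0).
have key z : D z -> `|z| <= `|Z w| + `|H w| -> `|Dg z w (H w)| <= K * (M w ^+ a * M w).
  move=> Dz zM; rewrite (le_trans (Dg_bound _ _ Dz))// -mulrA ler_wpM2l// ler_pM ?exprn_ge0 ?addr_ge0//.
    by apply: lerXn2r; rewrite ?nnegrE ?addr_ge0// /M -addrA lerD2l.
  by rewrite /M lerDr addr_ge0.
rewrite (le_trans (ler_normB _ _))// -mulrA mulr_natl mulr2n lerD ?key//.
- exact: Dseg.
- exact: ZM.
- by rewrite lerDl.
Qed.

Let G_unif alpha e : 0 < alpha -> 0 < e -> exists2 eta : R, 0 < eta &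
  forall eps w, 0 < eps <= 1 -> eps <= eta -> M w <= alpha -> `|G eps w| <= e.
Proof.
(* On M <= alpha also |H| <= alpha. So the tolerance is e / alpha, as the derivative gets multiplied
   by |H|, and the step is eta / alpha, as the point moves by at most eps |H|. *)
move=> al0 e0; have [eta eta0 heta] := Dg_modulus al0 (divr_gt0 e0 al0).
exists (eta / alpha); first exact: divr_gt0.
move=> eps w eps01 epseta Mal.
have [t /andP[t0 t1] ->] := G_mean w eps01; have /andP[eps0 eps1] := eps01.
have te : 0 <= t * eps <= 1 by rewrite mulr_ge0 ?(ltW eps0)//= mulr_ile1 ?(ltW eps0).
have Hal : `|H w| <= alpha by rewrite (le_trans _ Mal)// /M lerDr addr_ge0.
rewrite (@le_trans _ _ (e / alpha * `|H w|))//; last first.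
  by rewrite -mulrA ler_piMr ?(ltW e0)// ler_pdivrMl// mulr1.
have sM : `|Z w| + `|H w| <= alpha by rewrite (le_trans _ Mal)// /M -addrA lerDr.
apply: heta => //; first exact: Dseg.
- exact: le_trans (ZM w te) sM.
- by rewrite (le_trans _ sM)// lerDl.
rewrite addrAC subrr add0r normrZ ger0_norm; last by case/andP: te.
have /andP[te0 te1] := te.
apply: (@le_trans _ _ (eps * alpha)); last by rewrite -ler_pdivlMr.
by apply: ler_pM => //; rewrite ler_piMl// ltW.
Qed.

Let AG0 eps : 0 < eps <= 1 ->
  Lcl PP p k (fun w => (g (Z w + eps *: H w) w - g (Z w) w) / eps).
Proof.
move=> /andP[e0 e1]; under eq_fun do rewrite mulrC.
apply: (Lcl_scale kN); apply: (Lcl_sub kN).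
  apply: (Lcl_composition derivative_lip Ag) => [w|z]; last by apply: AZH; rewrite ltW.
  by apply: Dseg; rewrite ltW.
apply: (Lcl_composition derivative_lip Ag ZD) => z.
have := AZH z (_ : 0 <= 0 <= 1); rewrite lexx ler01 => /(_ isT).
by under eq_fun do rewrite scale0r addr0.
Qed.

Let harm01 j : 0 < (j.+1%:R^-1 : R) <= 1.
Proof. by rewrite invr_gt0 ltr0n/= invf_le1 ?ltr0n// ler1n. Qed.

(** The derivative is the pointwise limit of the difference quotients with steps 1 / (j + 1), which
    are measurable as compositions. *)
Let mDg : measurable_fun [set: T] (fun w => Dg (Z w) w (H w)).
Proof.
pose h j w := (g (Z w + (j.+1%:R^-1 : R) *: H w) w - g (Z w) w) / (j.+1%:R^-1 : R).
apply: (@measurable_fun_cvg _ T R setT h) => [j|w _].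
  by have [] := AG0 (harm01 j).
apply/cvgrPdist_le => e e0.
have [eta eta0 heta] := G_unif (lt_le_trans ltr01 (M1 w)) e0.
near=> j; rewrite distrC; apply: heta => //.
rewrite invf_ple ?posrE// (@le_trans _ _ j%:R)//; last by rewrite ler_nat.
by near: j; exact: nbhs_infty_ger.
Unshelve. all: by end_near. Qed.

Let AM : Lcl PP 2 k M.
Proof.
apply: (Lcl_add kN) => //; apply: (Lcl_add kN); first exact: (Lcl_cst _ kN).
have := AZH 0 (_ : 0 <= 0 <= 1); rewrite lexx ler01 => /(_ isT).
by under eq_fun do rewrite scale0r addr0 subr0.
Qed.

Let near01 : \forall eps \near (0 : R)^'+, 0 < eps <= 1.
Proof.
near=> eps; apply/andP; split; near: eps; first exact: nbhs_right_gt.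
by apply: nbhs_right_le.
Unshelve. all: by end_near. Qed.

Let G_vanish e : 0 < e -> \forall eps \near (0 : R)^'+, forall P, PP P ->
  (\int[P]_w (`|G eps w| ^+ p)%:E <= e%:E)%E.
Proof.
apply: (vanish_dominated kN _ (C := (2 * K) ^+ p) AM M0).
- by rewrite exprn_ge0// mulr_ge0.
- apply: filterS near01 => eps eps01; split.
    exact: (measurable_distX p (AG0 eps01).1 mDg).
  move=> w; rewrite exprn_ge0//= -powM -exprMn.
  by apply: lerXn2r; rewrite ?nnegrE ?mulr_ge0 ?exprn_ge0// G_bound.
move=> alpha e1 alpha0 e10.
have e20 : 0 < Num.min 1 e1 by rewrite lt_min ltr01.
have [eta eta0 heta] := G_unif alpha0 e20.
near=> eps => w Mw.
have h1 : `|G eps w| <= Num.min 1 e1.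
  apply: heta => //; first by near: eps; exact: near01.
  by near: eps; exact: nbhs_right_le.
apply: (@le_trans _ _ (Num.min 1 e1 ^+ p)).
  by apply: lerXn2r; rewrite ?nnegrE// ltW.
rewrite (@le_trans _ _ (Num.min 1 e1))//; last by rewrite ge_min lexx orbT.
have e21 : Num.min 1 e1 <= 1 by rewrite ge_min lexx.
by case: (p) p0 => // q _; rewrite exprS ler_piMr ?exprn_ile1// ltW.
Unshelve. all: by end_near. Qed.

Lemma Lcl_derivative : Lcl PP p k (fun w => Dg (Z w) w (H w)).
Proof.
apply: (Lcl_closed kN mDg) => e e0.
have [eps [eps01 heps]] : exists eps, 0 < eps <= 1 /\ forall P, PP P ->
    (\int[P]_w (`|G eps w| ^+ p)%:E <= e%:E)%E.
  have : \forall eps \near (0 : R)^'+, 0 < eps <= 1 /\ forall P, PP P ->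
      (\int[P]_w (`|G eps w| ^+ p)%:E <= e%:E)%E.
    by near=> eps; split; near: eps; [exact: near01|exact: G_vanish].
  by move/filter_ex.
exists (fun w => (g (Z w + eps *: H w) w - g (Z w) w) / eps); first exact: AG0.
move=> P PPP; have := heps P PPP; congr (_ <= _)%E.
by apply: eq_integral => w _; rewrite /G distrC.
Unshelve. all: by end_near. Qed.

Context (Zf : R -> Omega -> V).
Hypothesis ZfD : forall eps w, 0 < eps <= 1 -> D (Zf eps w).
Hypothesis AZf : forall eps z, 0 < eps <= 1 -> Lcl PP 2 k (fun w => `|Zf eps w - z|).
Let rho eps w := `|Zf eps w - (Z w + eps *: H w)| / eps.
Hypothesis mrho : forall eps, 0 < eps <= 1 -> measurable_fun [set: T] (rho eps).
Hypothesis rho_vanish : forall e : R, 0 < e -> \forall eps \near (0 : R)^'+,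
  forall P, PP P -> (\int[P]_w (rho eps w ^+ 2)%:E <= e%:E)%E.

Lemma Lcl_difference_quotient eps : 0 < eps <= 1 ->
  Lcl PP p k (fun w => (g (Zf eps w) w - g (Z w) w) / eps - Dg (Z w) w (H w)).
Proof.
move=> eps01; apply: (Lcl_sub kN); last exact: Lcl_derivative.
under eq_fun do rewrite mulrC.
apply: (Lcl_scale kN); apply: (Lcl_sub kN).
  by apply: (Lcl_composition derivative_lip Ag) => [w|z]; [exact: ZfD|exact: AZf].
apply: (Lcl_composition derivative_lip Ag ZD) => z.
have := AZH z (_ : 0 <= 0 <= 1); rewrite lexx ler01 => /(_ isT).
by under eq_fun do rewrite scale0r addr0.
Qed.

Let rho_ge0 eps w : 0 < eps <= 1 -> 0 <= rho eps w.
Proof. by move=> /andP[e0 _]; rewrite /rho divr_ge0// ltW. Qed.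

Let S eps w := (g (Zf eps w) w - g (Z w + eps *: H w) w) / eps.

Let mS eps : 0 < eps <= 1 -> measurable_fun [set: T] (S eps).
Proof.
move=> eps01; have eps01' : 0 <= eps <= 1 by case/andP: eps01 => e0 ->; rewrite ltW.
apply: measurable_funM => //; apply: measurable_funB.
  have [] // := @Lcl_composition g derivative_lip Ag (Zf eps).
  - by move=> w; exact: ZfD.
  - by move=> z; exact: AZf.
have [] // := @Lcl_composition g derivative_lip Ag (fun w => Z w + eps *: H w).
- by move=> w; exact: Dseg.
- by move=> z; exact: AZH.
Qed.

Let S_bound eps w : 0 < eps <= 1 ->
  `|S eps w| <= K * (2 * M w + rho eps w) ^+ a * rho eps w.
Proof.
move=> eps01; have /andP[e0 e1] := eps01.
have eps01' : 0 <= eps <= 1 by rewrite e1 ltW.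
have ie : 0 <= eps^-1 by rewrite invr_ge0 ltW.
rewrite /S normrM (ger0_norm ie) {2}/rho mulrA ler_wpM2r//.
rewrite (le_trans (derivative_lip w (ZfD w eps01) (Dseg w eps01')))//.
rewrite /lipker ler_wpM2r// ler_wpM2l//.
apply: lerXn2r; rewrite ?nnegrE ?addr_ge0 ?mulr_ge0 ?rho_ge0//.
have h1 := ZM w eps01'.
have h2 : `|Zf eps w| <= `|Z w + eps *: H w| + rho eps w.
  rewrite -lerBlDl (le_trans (lerB_dist _ _))// /rho ler_pdivlMr// ler_piMr//.
by rewrite /M; lra.
Qed.

Let S_vanish e : 0 < e -> \forall eps \near (0 : R)^'+, forall P, PP P ->
  (\int[P]_w (`|S eps w| ^+ p)%:E <= e%:E)%E.
Proof.
move=> e0; have [B B0 hB] := Lcl2_bound kN AM.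
(* AM-GM: M rho <= eta M ^ 2 + rho ^ 2 / eta *)
pose eta := e / (4 * (K + 1) * B).
have K1 : 0 < K + 1 by rewrite ltr_wpDl.
have eta0 : 0 < eta by rewrite divr_gt0// !mulr_gt0.
(* One coefficient of rho^2 for both exponents: the first summand serves p = 1, the second p = 2. *)
pose c := (K + 1) * (2 / eta + 1) + (K + 1) ^+ 2.
have c0 : 0 < c by rewrite addr_gt0 ?mulr_gt0 ?exprn_gt0// addr_gt0// divr_gt0.
near=> eps => P PPP.
have eps01 : 0 < eps <= 1 by near: eps; exact: near01.
have hrho : (\int[P]_w (rho eps w ^+ 2)%:E <= (e / (2 * c))%:E)%E.
  by move: P PPP; near: eps; apply: rho_vanish; rewrite divr_gt0// mulr_gt0.
have -> : e = 2 * (K + 1) * eta * B + c * (e / (2 * c)).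
  by rewrite /eta; field; rewrite !gt_eqF.
apply: (ge0_integral_le2 (P := P) (f := fun w => M w ^+ 2)
  (g := fun w => rho eps w ^+ 2)); try (by move=> w; exact: sqr_ge0).
- by apply: measurable_funX; exact: AM.1.
- by apply: measurable_funX; exact: mrho.
- by apply: measurable_funX; apply: measurableT_comp => //; exact: mS.
- by apply/ltW/mulr_gt0 => //; exact: mulr_gt0.
- exact: ltW.
- move=> w; rewrite exprn_ge0//=.
  have h := S_bound w eps01; have r0 := rho_ge0 w eps01.
  have m0 := M0 w.
  apply: (@le_trans _ _ ((K * (2 * M w + rho eps w) ^+ a * rho eps w) ^+ p)).
    by apply: lerXn2r; rewrite ?nnegrE//; exact: le_trans h.
  move: (M w) (rho eps w) m0 r0 {h hrho} => x y x0 y0.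
  have xy : 2 * x * y <= 2 * eta * x ^+ 2 + 2 / eta * y ^+ 2.
    exact: weighted_amgm.
  have y2 := sqr_ge0 y; have x2 := sqr_ge0 x.
  have ex : 0 <= 2 * (K + 1) * eta * x ^+ 2.
    by apply: mulr_ge0 => //; apply/ltW/mulr_gt0 => //; exact: mulr_gt0.
  have ey : 0 <= (K + 1) * (2 / eta + 1) * y ^+ 2.
    by apply: mulr_ge0 => //; apply/ltW/mulr_gt0 => //; rewrite addr_gt0// divr_gt0.
  case: pa => -[-> ->]; rewrite ?expr1 ?expr0 ?mulr1.
    apply: (@le_trans _ _ ((K + 1) * (2 * x * y + y ^+ 2))).
      rewrite -mulrA mulrDl -expr2 ler_wpM2r ?lerDl//.
      by rewrite addr_ge0// !mulr_ge0.
    apply: (@le_trans _ _ ((K + 1) * (2 * eta * x ^+ 2 + 2 / eta * y ^+ 2 + y ^+ 2))).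
      by rewrite ler_wpM2l ?lerD2r//; exact: ltW.
    have := sqr_ge0 ((K + 1) * y); rewrite /c exprMn; lra.
  rewrite exprMn (@le_trans _ _ ((K + 1) ^+ 2 * y ^+ 2))//.
    by rewrite ler_wpM2r//; apply: lerXn2r; rewrite ?nnegrE ?lerDl// ltW.
  by rewrite /c mulrDl; lra.
- exact: hB.
- exact: hrho.
Unshelve. all: by end_near. Qed.

(** The error is G, the quotient error on the straight segment, plus S, the cost of replacing the
    segment by [Zf]; S is governed by rho through the Lipschitz bound. *)
Lemma difference_quotient_vanish e : 0 < e -> \forall eps \near (0 : R)^'+,
  forall P, PP P ->
  (\int[P]_w (`|(g (Zf eps w) w - g (Z w) w) / eps - Dg (Z w) w (H w)| ^+ p)%:E <= e%:E)%E.
Proof.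
move=> e0; pose c : R := 2 ^+ p.
have c0 : 0 < c by rewrite exprn_gt0.
have e1 : 0 < e / (2 * c) by rewrite divr_gt0// mulr_gt0.
near=> eps => P PPP.
have eps01 : 0 < eps <= 1 by near: eps; exact: near01.
have -> : e = c * (e / (2 * c)) + c * (e / (2 * c)) by field; rewrite gt_eqF.
have mG : measurable_fun [set: T] (G eps).
  by apply: measurable_funB => //; have [] := AG0 eps01.
apply: (ge0_integral_le2 (P := P) (f := fun w => `|G eps w| ^+ p)
  (g := fun w => `|S eps w| ^+ p)); try (exact: ltW);
  try (by move=> w; rewrite exprn_ge0).
- by apply: measurable_funX; exact: measurableT_comp.
- by apply: measurable_funX; apply: measurableT_comp => //; exact: mS.
- apply: measurable_funX; apply: measurableT_comp => //.
  by have [] := Lcl_difference_quotient eps01.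
- move=> w; rewrite exprn_ge0//= -mulrDr.
  apply: le_trans (exprD_le p (normr_ge0 _) (normr_ge0 _)).
  apply: lerXn2r; rewrite ?nnegrE ?addr_ge0// (le_trans _ (ler_normD _ _))//.
  by rewrite le_eqVlt; apply/orP; left; apply/eqP; congr `|_|; rewrite /G /S !mulrBl; ring.
- by move: P PPP; near: eps; exact: G_vanish.
- by move: P PPP; near: eps; exact: S_vanish.
Unshelve. all: by end_near. Qed.

End quotient.
End derivative.
End differentiable_composition.

(** * Dominated probabilities, and products with the noise *)

Section dominated.
Context (R : realType) (Omega : pointedType) (d N : nat).
Context (W : nat -> Omega -> 'cV[R]_d).
Context (Theta : Type) (F : Theta -> probability (borel 'cV[R]_d) R).
Hypothesis Theta_n0 : inhabited Theta.
Hypothesis hA3 : A3 N W F.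
Hypothesis hW : forall k, (1 <= k <= N)%N -> Lcv N W F 2 k (W k).
Local Notation T := (filtered W N).
Local Notation PP := (dominated_probs N W F).

Lemma bounded_prob_integrable dT (S : measurableType dT) (P : probability S R) (X : S -> R)
    (B : R) : measurable_fun setT X -> (forall w, `|X w| <= B) ->
  P.-integrable setT (EFin \o X).
Proof.
move=> mX bX; apply: measurable_bounded_integrable => //.
- by rewrite [X in (X < _)%E](_ : _ = 1%E) ?ltry//; exact: probability_setT.
exists B; split; rewrite ?num_real// => M BM x _ /=.
by rewrite (le_trans (bX x))// ltW.
Qed.

Lemma Cblip_noise_integrable k (P : probability T R) (phi : 'M[R]_(d, k) -> R) : (k <= N)%N ->
  Cblip phi -> P.-integrable setT (EFin \o (fun w => phi (noise_path W k w))).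
Proof.
move=> kN cphi; have /CblipP[B B0 [bB _]] := cphi.
by apply: (@bounded_prob_integrable _ T P _ B) => //; exact: Cblip_noise_measurable.
Qed.

Lemma law_integral (P : probability T R) (Q : probability (borel 'M[R]_(d, N)) R)
    (phi : 'M[R]_(d, N) -> R) :
  (forall B : set (borel 'M[R]_(d, N)), measurable B -> Q B = P (noise_path W N @^-1` B)) ->
  Cblip phi ->
  (\int[P]_w (phi (noise_path W N w))%:E = \int[Q]_x (phi x)%:E)%E.
Proof.
move=> QP cphi.
have mW := @noise_path_measurable R Omega d W N N (leqnn N).
have mphi : measurable_fun [set: borel 'M[R]_(d, N)] (fun x => (phi x)%:E).
  by apply/measurable_EFinP; exact: Cblip_measurable.
have := @integral_pushforward _ _ T (borel 'M[R]_(d, N)) R (noise_path W N) mW P setT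
  (fun x => (phi x)%:E) mphi.
rewrite preimage_setT => /(_ (Cblip_noise_integrable P (leqnn N) cphi) measurableT) <-.
by apply: eq_measure_integral => B mB _; exact/esym/QP.
Qed.

Lemma dominated_le (P : probability T R) (phi : 'M[R]_(d, N) -> R) : PP P -> Cblip phi ->
  (\int[P]_w (phi (noise_path W N w))%:E <= (Ehat_cyl F phi)%:E)%E.
Proof. by move=> PPP cphi; have := PPP phi cphi; rewrite unlock. Qed.

Lemma dominated_law (Q : probability (borel 'M[R]_(d, N)) R) :
  (forall phi, Cblip phi -> (\int[Q]_x (phi x)%:E <= (Ehat_cyl F phi)%:E)%E) ->
  exists2 P : probability T R, PP P & forall phi, Cblip phi ->
    (\int[P]_w (phi (noise_path W N w))%:E = \int[Q]_x (phi x)%:E)%E.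
Proof.
move=> hQ; have [|P hP] := hA3 (Q := Q).
  by move=> phi cphi; rewrite unlock; exact: hQ.
exists P => [phi cphi|phi cphi]; last exact: law_integral.
by rewrite unlock (law_integral hP cphi); exact: hQ.
Qed.

(** Lifting the independent law of [F th] gives a dominated probability under which each W_{k+1} has
    law [F th]. Bounds known for the noise under all dominated P thus become bounds on every [F th];
    besides, dominated probabilities exist. *)
Lemma product_prob th : exists2 P, PP P & forall k (psi : 'cV[R]_d -> R), (k < N)%N ->
  Cblip psi -> (\int[P]_w (psi (W k.+1 w))%:E = (\int[F th]_y psi y)%:E)%E.
Proof.
have [Q hQ] := product_law (F th) N.
have [|P PPP hP] := dominated_law (Q := Q).
  by move=> phi cphi; rewrite hQ// lee_fin; exact: cyl_law_le_Ehat.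
exists P => // k psi kN cpsi.
have cphi : Cblip ((psi \o @nth_col R d k k.+1) \o @take_cols R d k.+1 N).
  apply: Cblip_comp (Cblip_comp _ cpsi) => x x'; [exact: take_cols_lip|exact: nth_col_lip].
have := hP _ cphi; rewrite hQ// => {}hP.
transitivity (\int[P]_w (((psi \o @nth_col R d k k.+1) \o @take_cols R d k.+1 N)
    (noise_path W N w))%:E)%E.
  by apply: eq_integral => w _; rewrite /= take_noise_path// nth_noise_path.
rewrite hP cyl_take_cols//; last exact: Rintegral_prob_cst.
congr EFin; rewrite -[RHS](cyl_cst k _ (Rintegral_prob_cst (F th))) /=.
congr cyl; apply/funext => x; apply: eq_Rintegral => y _.
by rewrite /= nth_add_col.
Qed.

Lemma dominated_probs_n0 : PP !=set0.
Proof. by case: Theta_n0 => th; have [P PPP _] := product_prob th; exists P. Qed.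

(** With C' the sublinear expectation of psi, the test function phi psi - C' phi has expectation
    exactly 0: the step over the last column is affine in psi with slope phi >= 0. Domination of its
    P-mean by 0 is the claim with C' for C. *)
Lemma conditional_bound (P : probability T R) k (phi : 'M[R]_(d, k) -> R)
    (psi : 'cV[R]_d -> R) (C : R) : PP P -> (k < N)%N -> Cblip phi -> (forall x, 0 <= phi x) ->
  Cblip psi -> (forall th, \int[F th]_y psi y <= C) ->
  (\int[P]_w (phi (noise_path W k w) * psi (W k.+1 w))%:E <=
   C%:E * \int[P]_w (phi (noise_path W k w))%:E)%E.
Proof.
move=> PPP kN cphi phi0 cpsi hC.
pose C' := Ehat1 F psi.
have C'C : C' <= C by exact: Ehat1_le.
pose chi (x : 'M[R]_(d, k.+1)) := phi (take_cols k x) * psi (nth_col k x) + - C' * phi (take_cols k x).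
have ctphi : Cblip (phi \o @take_cols R d k k.+1).
  by apply: Cblip_comp cphi => x x'; exact: take_cols_lip.
have ctpsi : Cblip (psi \o @nth_col R d k k.+1).
  by apply: Cblip_comp cpsi => x x'; exact: nth_col_lip.
have cchi : Cblip chi.
  by apply: CblipD; [exact: CblipM ctphi ctpsi|exact: (CblipZ _ ctphi)].
have := @dominated_le P (chi \o @take_cols R d k.+1 N) PPP.
have -> : Ehat_cyl F (chi \o @take_cols R d k.+1 N) = 0.
  rewrite Ehat_cylE cyl_take_cols//; last exact: Ehat1_cst.
  rewrite /= -[RHS](cyl_cst k 0 (Ehat1_cst F Theta_n0)); congr cyl; apply/funext => x.
  rewrite /chi; under eq_fun do rewrite take_add_col// take_cols_id nth_add_col.
  by rewrite Ehat1_affine// mulrC mulNr subrr.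
move=> /(_ (Cblip_comp (@take_cols_lip R d k.+1 N) cchi)).
have iphi := Cblip_noise_integrable P (ltnW kN) cphi.
have iphipsi : P.-integrable setT (EFin \o (fun w => phi (noise_path W k w) * psi (W k.+1 w))).
  have := Cblip_noise_integrable P kN (CblipM ctphi ctpsi).
  congr (_.-integrable _ _); apply/funext => w /=.
  by rewrite take_noise_path// nth_noise_path.
rewrite (_ : (fun w => _) = (fun w => (phi (noise_path W k w) * psi (W k.+1 w))%:E +
    (- C')%:E * (phi (noise_path W k w))%:E)%E); last first.
  apply/funext => w; rewrite /= /chi take_noise_path// take_noise_path//.
  by rewrite nth_noise_path// EFinD EFinM.
rewrite integralD//; last exact: integrableZl.
rewrite integralZl// => h.
have : (0 <= \int[P]_w (phi (noise_path W k w))%:E)%E.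
  by apply: integral_ge0 => w _; rewrite lee_fin.
have := integrable_fin_num measurableT iphi; have := integrable_fin_num measurableT iphipsi.
rewrite /= in h *; move: h.
case: (integral _ _ (fun w => (_ * _)%:E)) => [x| |]//.
case: (integral _ _ _) => [y| |]//.
rewrite -!EFinM -EFinD !lee_fin => h _ _ y0; rewrite mulNr subr_le0 in h.
by rewrite (le_trans h)// ler_wpM2r.
Qed.

Lemma integral_le_nondecreasing dT (S : measurableType dT) (P : probability S R)
    (h : nat -> S -> R) (f : S -> R) (c : R) :
  (forall n, measurable_fun setT (h n)) -> (forall n w, 0 <= h n w) ->
  (forall w, nondecreasing_seq (h^~ w)) -> (forall w, \forall n \near \oo, h n w = f w) ->
  (forall n, (\int[P]_w (h n w)%:E <= c%:E)%E) -> (\int[P]_w (f w)%:E <= c%:E)%E.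
Proof.
move=> mh h0 hnd hf hc.
have /cvg_lim <- // : (\int[P]_w (h n w)%:E)%E @[n --> \oo] --> (\int[P]_w (f w)%:E)%E.
  rewrite (_ : (\int[P]_w (f w)%:E)%E = (\int[P]_w limn (fun n => (h n w)%:E))%E).
    apply: cvg_monotone_convergence => //.
    - by move=> n; exact/measurable_EFinP.
    - by move=> n w _; rewrite lee_fin.
    - by move=> w _ i j ij; rewrite lee_fin; exact: hnd.
  apply: eq_integral => w _; apply/esym/cvg_lim => //.
  apply: cvg_near_cst; apply: filterS (hf w) => n -> //.
apply: lime_le; last by apply: nearW.
apply: ereal_nondecreasing_is_cvgn => i j ij; apply: ge0_le_integral => //.
- by move=> w _; rewrite lee_fin.
- exact/measurable_EFinP.
- exact/measurable_EFinP.
- by move=> w _; rewrite lee_fin; exact: hnd.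
Qed.

(** A polar set is null for each dominated P, so X and its representative have the same integrals.
    The tolerance min(1, e) absorbs the passage from the norm to its p-th power. *)
Lemma Lc_Lcl p k X : (0 < p)%N -> (k <= N)%N -> Lc N W F p k X -> Lcl PP p k X.
Proof.
move=> p0 kN [mX [X' [[B [[mB PB0] BX]] mX' _ hX']]]; split => // e e0.
pose e1 := Num.min 1 e.
have e10 : 0 < e1 by rewrite lt_min ltr01.
have [Y [phi cphi <-] hY] := hX' e1 e10.
exists (phi \o noise_path W k) => [|P PPP]; first by exists phi.
have mX'N := filtered_measurable_fun kN mX'.
have mphi := @Cblip_noise_measurable _ _ _ W _ _ _ kN cphi.
have mD1 : measurable_fun [set: T] (fun w => (`|X w - phi (noise_path W k w)| ^+ p)%:E).
  by apply/measurable_EFinP; exact: measurable_distX.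
have mD2 : measurable_fun [set: T] (fun w => (`|X' w - phi (noise_path W k w)| ^+ p)%:E).
  by apply/measurable_EFinP; exact: measurable_distX.
have -> : (\int[P]_w (`|X w - (phi \o noise_path W k) w| ^+ p)%:E =
    \int[P]_w (`|X' w - phi (noise_path W k w)| ^+ p)%:E)%E.
  apply: ge0_ae_eq_integral => //; try by move=> w _; rewrite lee_fin exprn_ge0.
  exists B; split => //.
    apply/eqP; rewrite eq_le measure_ge0 andbT -PB0.
    by apply: ereal_sup_ubound; exists P.
  move=> w /= hw; apply: contrapT => nBw; apply: hw => _.
  by rewrite (BX w nBw).
set I := (\int[P]_w _)%E.
have I0 : (0 <= I)%E by apply: integral_ge0 => w _; rewrite lee_fin exprn_ge0.
pose A := Ehat N W F (fun w => `|X' w - phi (noise_path W k w)| ^+ p).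
have IA : (I <= A)%E by apply: ereal_sup_ubound; exists P => //; rewrite unlock.
have A0 : (0 <= A)%E by exact: le_trans IA.
have Ae : (A `^ (p%:R^-1) < e1%:E)%E by exact: hY.
have pn0 : p%:R != 0 :> R by rewrite pnatr_eq0 -lt0n.
have : (A <= (e1 ^+ p)%:E)%E.
  rewrite -[A]poweRe1// -[1](mulVf pn0) poweRrM.
  rewrite -powR_mulrn ?(ltW e10)// -poweR_EFin.
  apply: gt0_ler_poweR; rewrite ?in_itv/= ?leey ?poweR_ge0 ?lee_fin ?(ltW e10)//.
  exact: ltW.
move=> /(le_trans IA)/le_trans; apply; rewrite lee_fin.
have e11 : e1 <= 1 by rewrite /e1 ge_min lexx.
rewrite (@le_trans _ _ e1)//; last by rewrite /e1 ge_min lexx orbT.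
by case: (p) p0 => // q _; rewrite exprS ler_piMr ?exprn_ile1// ltW.
Qed.

(** * Multiplication of a variable known at time k by the next noise *)

Section noise_product.
Context (k : nat) (l : 'I_d).
Hypothesis kN : (k < N)%N.
Let Wl w := W k.+1 w l ord0.

Let AWl : Lcl PP 2 k.+1 Wl.
Proof. by apply: Lc_Lcl => //; exact: hW. Qed.

Let mWl : measurable_fun [set: T] Wl. Proof. exact: AWl.1. Qed.

Let tr (n : nat) (x : R) : R := Num.min n%:R `|x|.

Let tr_ge0 n x : 0 <= tr n x. Proof. by rewrite le_min normr_ge0 ler0n. Qed.

Let psi n (y : 'cV[R]_d) : R := tr n (y l ord0) * tr n (y l ord0).

Let cpsi n : Cblip (psi n).
Proof.
have ctr : Cblip (fun y : 'cV[R]_d => tr n (y l ord0)).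
  apply/CblipP; exists (n%:R + 1); first by rewrite ltr_wpDl.
  split=> [y|y y'].
    by rewrite ger0_norm// (@le_trans _ _ n%:R)// ?lerDl// ge_min lexx.
  rewrite (le_trans (lip_minr _ _ _ _))// subrr normr0 add0r mul1r.
  rewrite (le_trans (ler_dist_dist _ _))//.
  apply: (@le_trans _ _ `|y - y'|); last by rewrite ler_peMl// lerDr.
  by have := mx_entry_le (y - y') l ord0; rewrite !mxE.
exact: CblipM.
Qed.

Let psi_ge0 n y : 0 <= psi n y. Proof. by rewrite mulr_ge0. Qed.

Let psi_le n y : psi n y <= n%:R ^+ 2.
Proof. by rewrite expr2 ler_pM// ge_min lexx. Qed.

Let mpsi n : measurable_fun [set: T] (fun w => psi n (W k.+1 w)).
Proof.
have mtr : measurable_fun [set: T] (fun w => tr n (Wl w)).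
  by apply: measurable_minr => //; exact: measurableT_comp.
exact: (measurable_funM mtr mtr).
Qed.

(** The factor 4 in C = 4 M comes from passing from X to a bounded Lipschitz phi and back, each
    passage doubling the squares. The truncation at level n multiplies the error X - phi by at most
    n^2, so phi is chosen after n; monotone convergence then removes the truncation. *)
Lemma product_second_moment : exists2 C : R, 0 < C & forall X, Lcl PP 2 k X ->
  forall P, PP P -> forall e : R, (\int[P]_w (X w ^+ 2)%:E <= e%:E)%E ->
    (\int[P]_w ((X w * Wl w) ^+ 2)%:E <= (C * e)%:E)%E.
Proof.
have [M M0 hM] := Lcl2_bound kN AWl.
exists (4 * M) => [|X AX P PPP e hX]; first by rewrite mulr_gt0.
have mX := AX.1.
have psiM n th : \int[F th]_y psi n y <= M.
  have [Q PPQ hQ] := product_prob th.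
  rewrite -lee_fin -(hQ k) //; apply: (ge0_integral_le (P := Q)) (hM Q PPQ) => //.
    exact: measurable_funX.
  move=> w; rewrite psi_ge0/= -[Wl w ^+ 2]real_normK ?num_real// expr2.
  by rewrite ler_pM// ge_min lexx orbT.
have bound n : (\int[P]_w (X w ^+ 2 * psi n (W k.+1 w))%:E <= (4 * M * e)%:E)%E.
  apply/lee_addgt0Pr => eta eta0.
  (* With this c the errors 4 M eta / c and 2 n^2 eta / c add up to eta. *)
  pose c : R := 4 * M + 2 * n%:R ^+ 2.
  have c0 : 0 < c by rewrite ltr_wpDr// ?mulr_gt0// mulr_ge0// exprn_ge0.
  have s0 : 0 < eta / c by rewrite divr_gt0.
  have [Y [phi cphi ->] hY] := AX.2 _ s0.
  have mphi := @Cblip_noise_measurable _ _ _ W _ _ _ (ltnW kN) cphi.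
  have mphi2 : measurable_fun [set: T] (fun w => phi (noise_path W k w) * phi (noise_path W k w)).
    exact: measurable_funM.
  have mXY := measurable_distX 2 mX mphi.
  have phi2 : (\int[P]_w (phi (noise_path W k w) * phi (noise_path W k w))%:E
      <= (2 * e + 2 * (eta / c))%:E)%E.
    apply: (ge0_integral_le2 (P := P) (f := fun w => X w ^+ 2)
      (g := fun w => `|X w - phi (noise_path W k w)| ^+ 2)) (hX) (hY P PPP) => //.
    - exact: measurable_funX.
    - by move=> w; exact: sqr_ge0.
    - move=> w; rewrite -expr2 sqr_ge0/= real_normK ?num_real//.
      by have := sqr_ge0 (2 * X w - phi (noise_path W k w)); lra.
  have phipsi : (\int[P]_w (phi (noise_path W k w) * phi (noise_path W k w) * psi n (W k.+1 w))%:E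
      <= (M * (2 * e + 2 * (eta / c)))%:E)%E.
    apply: le_trans (conditional_bound PPP kN (CblipM cphi cphi) _ (cpsi n) (psiM n)) _.
      by move=> x; rewrite -expr2 sqr_ge0.
    by rewrite EFinM lee_wpmul2l// lee_fin ltW.
  rewrite -EFinD.
  have -> : 4 * M * e + eta = 2 * (M * (2 * e + 2 * (eta / c))) + 2 * n%:R ^+ 2 * (eta / c).
    by rewrite /c; field; exact: lt0r_neq0 c0.
  apply: (ge0_integral_le2 (P := P)
    (f := fun w => phi (noise_path W k w) * phi (noise_path W k w) * psi n (W k.+1 w))
    (g := fun w => `|X w - phi (noise_path W k w)| ^+ 2)) phipsi (hY P PPP) => //.
  - exact: measurable_funM.
  - by apply: measurable_funM => //; exact: measurable_funX.
  - by move=> w; rewrite mulr_ge0// -expr2 sqr_ge0.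
  - move=> w; rewrite mulr_ge0 ?sqr_ge0//= real_normK ?num_real//.
    have := psi_le n (W k.+1 w); have := psi_ge0 n (W k.+1 w).
    move: (psi n _) (phi _) (n%:R ^+ 2) => q y B q0 qB.
    apply: (@le_trans _ _ (2 * (y * y * q) + 2 * q * (X w - y) ^+ 2)).
      have : 0 <= q * (X w - 2 * y) ^+ 2 by rewrite mulr_ge0 ?sqr_ge0.
      by lra.
    by rewrite lerD2l ler_wpM2r ?sqr_ge0// ler_wpM2l.
apply: (@integral_le_nondecreasing _ T P (fun n w => X w ^+ 2 * psi n (W k.+1 w))) => //.
- by move=> n; apply: measurable_funM => //; exact: measurable_funX.
- by move=> n w; rewrite mulr_ge0 ?sqr_ge0.
- move=> w i j ij; rewrite ler_wpM2l ?sqr_ge0// /psi.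
  have tij : tr i (W k.+1 w l ord0) <= tr j (W k.+1 w l ord0).
    rewrite le_min !ge_min lexx orbT andbT; apply/orP; left.
    by rewrite ler_nat.
  exact: ler_pM.
- move=> w; near=> n; rewrite exprMn; congr (_ * _).
  have -> : psi n (W k.+1 w) = `|Wl w| * `|Wl w|.
    rewrite /psi /tr min_r//; near: n; exact: nbhs_infty_ger.
  by rewrite -expr2 real_normK ?num_real.
Unshelve. all: by end_near. Qed.

(** [Lcl_mul] would only give L^1. In X W - Y Y' = (X - Y) W + Y (W - Y') the first term falls under
    [product_second_moment], as X - Y is known at time k, and the second under the bound of Y, which
    is chosen before Y'. *)
Lemma Lcl_noise_product X : Lcl PP 2 k X -> Lcl PP 2 k.+1 (fun w => X w * Wl w).
Proof.
move=> AX; have [C C0 hC] := product_second_moment.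
have mX := AX.1.
have mXW : measurable_fun [set: T] (fun w => X w * Wl w) by exact: measurable_funM.
split=> // e e0.
have e1 : 0 < e / (4 * C) by rewrite divr_gt0// mulr_gt0.
have [Y LY hY] := AX.2 _ e1.
have [B B0 bB] := Lipk_bounded LY.
have e2 : 0 < e / (4 * B ^+ 2) by rewrite divr_gt0// mulr_gt0// exprn_gt0.
have [Y' LY' hY'] := AWl.2 _ e2.
have LYk := Lipk_widen (leqnSn k) LY.
exists (fun w => Y w * Y' w) => [|P PPP]; first exact: LipkM.
have mY := Lipk_measurable kN LYk; have mY' := Lipk_measurable kN LY'.
have AD : Lcl PP 2 k (fun w => X w - Y w).
  by apply: (Lcl_sub (ltnW kN)) => //; apply: Lipk_Lcl => //; exact: ltnW.
have h1 : (\int[P]_w (((X w - Y w) * Wl w) ^+ 2)%:E <= (C * (e / (4 * C)))%:E)%E.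
  apply: hC => //; have := hY P PPP; congr (_ <= _)%E.
  by apply: eq_integral => w _; rewrite real_normK ?num_real.
have -> : e = 2 * (C * (e / (4 * C))) + 2 * B ^+ 2 * (e / (4 * B ^+ 2)).
  by field; rewrite !gt_eqF.
apply: (ge0_integral_le2 (P := P) (f := fun w => ((X w - Y w) * Wl w) ^+ 2)
  (g := fun w => `|Wl w - Y' w| ^+ 2)) h1 (hY' P PPP) => //.
- by apply: measurable_funX; apply: measurable_funM => //; exact: measurable_funB.
- exact: measurable_distX.
- by apply: measurable_distX => //; exact: measurable_funM.
- by rewrite mulr_ge0// exprn_ge0// ltW.
- by move=> w; exact: sqr_ge0.
- move=> w; rewrite sqr_ge0/= !real_normK ?num_real//.
  have hb : Y w ^+ 2 <= B ^+ 2.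
    by rewrite -[Y w ^+ 2]real_normK ?num_real// lerXn2r ?nnegrE// ltW.
  apply: (@le_trans _ _ (2 * ((X w - Y w) * Wl w) ^+ 2 + 2 * Y w ^+ 2 * (Wl w - Y' w) ^+ 2)).
    by have := sqr_ge0 ((X w - Y w) * Wl w - Y w * (Wl w - Y' w)); lra.
  by rewrite lerD2l ler_wpM2r ?sqr_ge0// ler_wpM2l.
Qed.

End noise_product.
End dominated.

(** * Weak compactness *)

(** Dini's theorem: the open sets {f n < e} increase with n and cover the compact set. *)
Lemma dini_vanish (R : realType) (V : normedModType R) (K : set V) (f : nat -> V -> R) (e : R) :
  compact K -> 0 < e -> (forall n, continuous (f n)) ->
  (forall n x, f n.+1 x <= f n x) -> (forall x, f n x @[n --> \oo] --> 0) ->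
  exists n0, forall n x, (n0 <= n)%N -> K x -> f n x <= e.
Proof.
move=> cK e0 cf decf f0.
have {}decf m n x : (m <= n)%N -> f n x <= f m x.
  move=> /subnK <-; elim: (n - m)%N => // i ih.
  by rewrite addSn (le_trans (decf _ _)).
rewrite compact_cover in cK.
have [||G _ hG] := cK _ setT (fun n => [set x | f n x < e]).
- move=> n _; have /continuousP/(_ `]-oo, e[%classic (interval_open _ _)) := cf n.
  rewrite (_ : f n @^-1` _ = [set x | f n x < e]); first exact.
  by apply/seteqP; split => x; rewrite /= in_itv.
- move=> x _; have /cvgrPdist_lt/(_ e e0)[n _ hn] := f0 x.
  exists n => //=; have := hn n (leqnn n); rewrite /= sub0r normrN.
  exact: le_lt_trans (ler_norm _).
exists (\max_(i <- finmap.enum_fset G) i) => n x Gn /hG[i /= Gi fi].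
rewrite (le_trans _ (ltW fi))// decf// (leq_trans _ Gn)//.
by rewrite (big_rem i)//= leq_maxl.
Qed.

Section means.
Context (R : realType) (Omega : pointedType) (d N : nat).
Context (W : nat -> Omega -> 'cV[R]_d).
Local Notation T := (filtered W N).
Context (PP : set (probability T R)).

Lemma Lcl1_integrable k X (P : probability T R) : (k <= N)%N -> Lcl PP 1 k X -> PP P ->
  P.-integrable setT (EFin \o X).
Proof.
move=> kN AX PPP; have mX := AX.1.
have [Y LY hY] := AX.2 1 ltr01; have [B B0 bB] := Lipk_bounded LY.
apply/integrableP; split; first exact/measurable_EFinP.
apply: (@le_lt_trans _ _ (1 * 1 + B * 1)%:E); last exact: ltry.
have mY := Lipk_measurable kN LY.
suff : (\int[P]_w (`|X w|)%:E <= (1 * 1 + B * 1)%:E)%E by [].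
apply: (ge0_integral_le2 (P := P) (f := fun w => `|X w - Y w| ^+ 1) (g := fun=> 1)) => //.
- exact: measurable_distX.
- exact: measurableT_comp.
- exact: ltW.
- move=> w; rewrite normr_ge0 expr1 mul1r mulr1/=.
  rewrite -lerBlDr (le_trans _ (lerB_dist _ _))// lerD2l lerN2; exact: bB.
- exact: hY.
- by rewrite integral_prob_cst.
Qed.

Lemma Rintegral_dist (P : probability T R) X Y (e : R) :
  P.-integrable setT (EFin \o X) -> P.-integrable setT (EFin \o Y) ->
  (\int[P]_w (`|X w - Y w|)%:E <= e%:E)%E ->
  `|\int[P]_w X w - \int[P]_w Y w| <= e.
Proof.
move=> iX iY h; rewrite -RintegralB//.
have iXY : P.-integrable setT (EFin \o (fun w => X w - Y w)).
  by have := integrableB measurableT iX iY; congr (_.-integrable _ _); apply/funext.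
rewrite -lee_fin EFin_normr_Rintegral//.
have mXY : measurable_fun [set: T] (EFin \o (fun w => X w - Y w)).
  by have /integrableP[] := iXY.
exact: le_trans (le_abse_integral P measurableT mXY) h.
Qed.

End means.

Section compactness.
Context (R : realType) (Omega : pointedType) (d N : nat).
Context (W : nat -> Omega -> 'cV[R]_d).
Context (Theta : Type) (F : Theta -> probability (borel 'cV[R]_d) R).
Hypothesis Theta_n0 : inhabited Theta.
Hypothesis hA3 : A3 N W F.
Hypothesis hW : forall k, (1 <= k <= N)%N -> Lcv N W F 2 k (W k).
Local Notation T := (filtered W N).
Local Notation PP := (dominated_probs N W F).

Lemma Lcl_mx_norm p k q1 q2 (Z : Omega -> 'M[R]_(q1, q2)) : (0 < p)%N -> (k <= N)%N ->
  (forall i j, Lcl PP p k (fun w => Z w i j)) -> Lcl PP p k (fun w => `|Z w|).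
Proof.
move=> p0 kN AZ.
rewrite (_ : (fun w => _) =
    (fun w => \big[Num.max/0]_(ij : 'I_q1 * 'I_q2) `|Z w ij.1 ij.2|)); last first.
  by apply/funext => w; rewrite [LHS]/Num.norm/= mx_normrE.
elim: (index_enum _) => [|ij s ih].
  by under eq_fun do rewrite big_nil; exact: Lcl_cst.
under eq_fun do rewrite big_cons.
by apply: Lcl_max => //; apply: Lcl_abs.
Qed.

Lemma noise_path_second_moment : exists2 C : R, 0 < C & forall P, PP P ->
  (\int[P]_w (`|noise_path W N w| ^+ 2)%:E <= C%:E)%E.
Proof.
apply: (Lcl2_bound (leqnn N)); apply: Lcl_mx_norm => // i j.
have j1N : (j.+1 <= N)%N := ltn_ord j.
apply: (Lcl_widen (k := j.+1)) => //.
under eq_fun do rewrite mxE.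
by apply: Lc_Lcl => //; exact: hW.
Qed.

Section cluster.
Context (Pn : nat -> probability T R).
Hypothesis PPn : forall n, PP (Pn n).
Context (U : set_system nat).
Hypothesis UU : UltraFilter U.

Let mean (P : probability T R) (phi : 'M[R]_(d, N) -> R) : R :=
  \int[P]_w phi (noise_path W N w).

Let int phi (P : probability T R) : Cblip phi -> P.-integrable setT (EFin \o (fun w => phi (noise_path W N w))).
Proof. exact: (@Cblip_noise_integrable _ _ _ _ W N). Qed.

Let mean_le phi psi P : Cblip phi -> Cblip psi -> (forall x, phi x <= psi x) ->
  mean P phi <= mean P psi.
Proof.
by move=> cphi cpsi h; apply: le_Rintegral => //; exact: int.
Qed.

Let mean_cst (c : R) P : mean P (fun=> c) = c.
Proof.
rewrite /mean Rintegral_cst// [X in fine X](_ : _ = 1%E) ?mulr1//.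
exact: probability_setT.
Qed.

Let meanD phi psi P : Cblip phi -> Cblip psi ->
  mean P (fun x => phi x + psi x) = mean P phi + mean P psi.
Proof. by move=> cphi cpsi; rewrite /mean RintegralD//; exact: int. Qed.

Let meanZ c phi P : Cblip phi -> mean P (fun x => c * phi x) = c * mean P phi.
Proof. by move=> cphi; rewrite /mean RintegralZl//; exact: int. Qed.

Let mean_norm_le phi B P : Cblip phi -> (forall x, `|phi x| <= B) -> `|mean P phi| <= B.
Proof.
move=> cphi bB; rewrite ler_norml; apply/andP; split.
  rewrite -[leLHS](mean_cst _ P); apply: mean_le => //; first exact: Cblip_cst.
  by move=> x; have := bB x; rewrite ler_norml => /andP[].
rewrite -[leRHS](mean_cst _ P); apply: mean_le => //; first exact: Cblip_cst.
by move=> x; have := bB x; rewrite ler_norml => /andP[].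
Qed.

Let L (phi : 'M[R]_(d, N) -> R) : R := lim (mean (Pn n) phi @[n --> U]).

Let L_cvg phi : Cblip phi -> mean (Pn n) phi @[n --> U] --> L phi.
Proof.
move=> cphi; have /CblipP[B B0 [bB _]] := cphi.
have [|l _ hl] := @ultra_compact_cvg _ _ _ U (fun n => mean (Pn n) phi) UU
    (@segment_compact R (- B) B).
  apply: filterE => n /=; rewrite in_itv/= -ler_norml; exact: mean_norm_le.
by apply/cvg_ex; exists l.
Qed.

Let L_le phi c : Cblip phi -> (forall n, mean (Pn n) phi <= c) -> L phi <= c.
Proof.
move=> cphi h; apply: limr_le; first by apply/cvg_ex; exists (L phi); exact: L_cvg.
exact: filterE.
Qed.

(** The bound must be uniform in m to survive the limit along U. Dini's theorem makes f n small on a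
    ball, for all m at once, and outside the ball Chebyshev's inequality applies with the second
    moment common to all dominated probabilities. *)
Let L_daniell (f : nat -> 'M[R]_(d, N) -> R) : (forall n, Cblip (f n)) ->
  (forall n x, 0 <= f n.+1 x <= f n x) -> (forall x, f n x @[n --> \oo] --> 0) ->
  L (f n) @[n --> \oo] --> 0.
Proof.
move=> cf decf f0.
have f_ge0 n x : 0 <= f n x by have /andP[h1 h2] := decf n x; exact: le_trans h2.
have f_le n x : f n x <= f 0%N x.
  by elim: n => // n; apply: le_trans; have /andP[] := decf n x.
have L_ge0 n : 0 <= L (f n).
  apply: limr_ge; first by apply/cvg_ex; exists (L (f n)); exact: L_cvg.
  by apply: filterE => m; exact: Rintegral_ge0.
have /CblipP[B B0 [bB _]] := cf 0%N.
have [C C0 hC] := noise_path_second_moment.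
apply/cvgrPdist_le => e e0.
(* As r >= 1, a path of norm above r has squared norm above r, so there f n <= B <= (B / r)
   |path|^2, of mean at most B C / r <= e / 2. *)
pose r := 1 + 2 * B * C / e.
have r1 : 1 <= r by rewrite lerDl divr_ge0// ?(ltW e0)// !mulr_ge0// ltW.
have r0 : 0 < r by exact: lt_le_trans r1.
have e20 : 0 < e / 2 by rewrite divr_gt0.
have f_dec n x : f n.+1 x <= f n x by have /andP[] := decf n x.
have [n0 hn0] := dini_vanish (@mx_ball_compact R d N r) e20
  (fun n => Cblip_continuous (cf n)) f_dec f0.
near=> n; rewrite sub0r normrN ger0_norm//.
have n0n : (n0 <= n)%N by near: n; exact: nbhs_infty_ge.
apply: L_le => // m.
have mM : measurable_fun [set: T] (fun w => `|noise_path W N w|).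
  apply: measurable_mx_norm => i j.
  apply: (eq_measurable_fun (fun w : T => W j.+1 w i ord0)).
    by move=> w _; rewrite mxE.
  by apply: noise_entry_measurable; rewrite /= ltn_ord.
have : (\int[Pn m]_w (f n (noise_path W N w))%:E <= (e / 2 * 1 + B / r * C)%:E)%E.
  apply: (ge0_integral_le2 (P := Pn m) (f := fun=> 1)
    (g := fun w => `|noise_path W N w| ^+ 2)) => //.
  - exact: measurable_funX.
  - exact: Cblip_noise_measurable.
  - exact: ltW.
  - by rewrite divr_ge0// ltW.
  - move=> w; rewrite f_ge0/= mulr1.
    have [Mr|Mr] := leP `|noise_path W N w| r.
      by rewrite (le_trans (hn0 _ _ n0n Mr))// lerDl mulr_ge0 ?exprn_ge0// divr_ge0// ltW.
    apply: (@le_trans _ _ B).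
      by rewrite (le_trans (f_le _ _))// (le_trans (ler_norm _)).
    apply: (@le_trans _ _ (B / r * `|noise_path W N w| ^+ 2)); last by rewrite lerDr ltW.
    rewrite -mulrA ler_peMr ?(ltW B0)// -ler_pdivrMl ?invr_gt0// invrK mulr1.
    by rewrite expr2 (le_trans (ltW Mr))// ler_peMr// (le_trans r1)// ltW.
  - by rewrite integral_prob_cst.
  - exact: hC.
have -> : (\int[Pn m]_w (f n (noise_path W N w))%:E = (mean (Pn m) (f n))%:E)%E.
  by rewrite /mean /Rintegral fineK//; apply: integrable_fin_num => //; exact: int.
rewrite lee_fin => /le_trans; apply.
rewrite mulr1 [leRHS]splitr lerD2l mulrAC ler_pdivrMr// /r mulrDr.
have -> : e / 2 * (2 * B * C / e) = B * C by field; rewrite gt_eqF.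
by rewrite lerDr mulr1 ltW.
Unshelve. all: by end_near. Qed.

(** Approximation by test functions is uniform over dominated probabilities, hence valid for P and
    all [Pn n] together, and convergence passes to the closure. One P and one U serve every X, so
    the cost and its variation can be followed simultaneously. *)
Lemma dominated_cluster : exists2 P, PP P & forall X, Lcl PP 1 N X ->
  \int[Pn n]_w X w @[n --> U] --> \int[P]_w X w.
Proof.
have [||||Q hQ] := @daniell_riesz R 'M[R]_(d, N) L _ _ _ _ L_daniell.
- move=> phi psi cphi cpsi; rewrite /L.
  have -> : (fun n => mean (Pn n) (fun x => phi x + psi x)) =
      (fun n => mean (Pn n) phi + mean (Pn n) psi).
    by apply/funext => n; exact: meanD.
  apply: cvg_lim => //; exact: (cvgD (L_cvg cphi) (L_cvg cpsi)).
- move=> c phi cphi; rewrite /L.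
  have -> : (fun n => mean (Pn n) (fun x => c * phi x)) = (fun n => c * mean (Pn n) phi).
    by apply/funext => n; exact: meanZ.
  apply: cvg_lim => //; apply: cvgMl_tmp; exact: L_cvg.
- move=> phi psi cphi cpsi h; apply: ler_lim.
  + by apply/cvg_ex; exists (L phi); exact: L_cvg.
  + by apply/cvg_ex; exists (L psi); exact: L_cvg.
  + by apply: filterE => n; exact: mean_le.
- apply: cvg_lim => //.
  by apply: cvg_near_cst; apply: filterE => n; exact: mean_cst.
have [|P PPP hP] := dominated_law hA3 (Q := Q).
  move=> phi cphi; rewrite hQ// lee_fin; apply: L_le => // n.
  have := dominated_le (PPn n) cphi; rewrite -lee_fin; congr (_ <= _)%E.
  by rewrite /mean /Rintegral fineK//; apply: integrable_fin_num => //; exact: int.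
exists P => // X AX.
apply/cvgrPdist_le => e e0.
have e3 : 0 < e / 3 by rewrite divr_gt0.
have [Y LY hY] := AX.2 _ e3.
have AY : Lcl PP 1 N Y by exact: Lipk_Lcl.
have close P' : PP P' -> `|\int[P']_w X w - \int[P']_w Y w| <= e / 3.
  move=> PPP'; apply: Rintegral_dist; [exact: Lcl1_integrable AX PPP'|exact: Lcl1_integrable AY PPP'|].
  by have := hY P' PPP'; under eq_integral do rewrite expr1.
have [phi cphi YE] := LY.
have Ycvg : \int[Pn n]_w Y w @[n --> U] --> \int[P]_w Y w.
  rewrite YE (_ : \int[P]_w _ = L phi); first exact: L_cvg.
  by rewrite /Rintegral hP// hQ.
near=> n.
have h1 := close P PPP; have h2 := close (Pn n) (PPn n).
have h3 : `|\int[P]_w Y w - \int[Pn n]_w Y w| <= e / 3.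
  by near: n; exact: cvgr_dist_le.
move: h1 h2 h3; rewrite !ler_norml => /andP[? ?] /andP[? ?] /andP[? ?].
by apply/andP; split; lra.
Unshelve. all: by end_near. Qed.

End cluster.

End compactness.

(** * The directional derivative of a supremum *)

Section directional_derivative_of_sup.
Context (R : realType) (Idx : Type) (PP : set Idx).
Hypothesis PP0 : PP !=set0.

Let S (f : Idx -> R) : R := sup (f @` PP).

Let S_ge f K p : (forall p, PP p -> `|f p| <= K) -> PP p -> f p <= S f.
Proof.
move=> bf Pp; apply: ub_le_sup; last by exists p.
by exists K => _ [p' Pp' <-]; rewrite (le_trans (ler_norm _))// bf.
Qed.

Let S_le f c : (forall p, PP p -> f p <= c) -> S f <= c.
Proof.
move=> h; apply: ge_sup => [|_ [p Pp <-]]; last exact: h.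
by case: PP0 => p Pp; exists (f p); exists p.
Qed.

(* Danskin's argument: the right derivative at 0 of the convex function
   eps |-> sup_p (a p + eps t p) is the largest t p over the maximizers of a,
   which are cluster points of approximate maximizers. *)
Lemma sup_right_derivative (a t : Idx -> R) (j : R -> Idx -> R) (K : R) :
  (forall p, PP p -> `|a p| <= K) -> (forall p, PP p -> `|t p| <= K) ->
  (forall e : R, 0 < e -> \forall eps \near (0 : R)^'+, forall p, PP p ->
     `|(j eps p - a p) / eps - t p| <= e) ->
  (forall pn : nat -> Idx, (forall n, PP (pn n)) -> exists2 p, PP p &
     exists U : set_system nat, [/\ ProperFilter U, \oo `<=` U,
       a (pn n) @[n --> U] --> a p & t (pn n) @[n --> U] --> t p]) ->
  exists p, [/\ PP p, a p = S a,
    (S (j eps) - S a) / eps @[eps --> (0 : R)^'+] --> t p &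
    forall p', PP p' -> a p' = S a -> t p' <= t p].
Proof.
move=> ba bt jat cluster.
pose at_ (eps : R) p := a p + eps * t p.
pose q (eps : R) := (S (at_ eps) - S a) / eps.
have K0 : 0 <= K by case: PP0 => p Pp; exact: le_trans (ba p Pp).
have bat eps : 0 <= eps -> forall p, PP p -> `|at_ eps p| <= K + eps * K.
  move=> e0 p Pp; rewrite (le_trans (ler_normD _ _))// lerD ?ba//.
  by rewrite normrM (ger0_norm e0) ler_wpM2l// bt.
have q_ge p eps : 0 < eps -> PP p -> a p = S a -> t p <= q eps.
  move=> e0 Pp ap; rewrite ler_pdivlMr// mulrC lerBrDl -ap.
  exact: (S_ge (bat eps (ltW e0)) Pp).
(* [at_ e1] is the convex combination of [at_ e2] and [a] with weight e1 / e2. Quotients of a convex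
   function are monotone, so the right derivative is their infimum [q0]. *)
have q_mono e1 e2 : 0 < e1 -> e1 <= e2 -> q e1 <= q e2.
  move=> e10 e12; have e20 := lt_le_trans e10 e12.
  rewrite /q ler_pdivrMr// lerBlDr; apply: S_le => p Pp.
  have h1 := S_ge ba Pp; have h2 := S_ge (bat e2 (ltW e20)) Pp.
  have r0 : 0 <= e1 / e2 by rewrite divr_ge0// ltW.
  have r1 : e1 / e2 <= 1 by rewrite ler_pdivrMr// mul1r.
  have -> : (S (at_ e2) - S a) / e2 * e1 + S a =
      e1 / e2 * S (at_ e2) + (1 - e1 / e2) * S a by ring.
  have -> : at_ e1 p = e1 / e2 * at_ e2 p + (1 - e1 / e2) * a p.
    by rewrite /at_; field; rewrite gt_eqF.
  by rewrite lerD// ler_wpM2l// subr_ge0.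
have q_lb eps : 0 < eps -> - K <= q eps.
  move=> e0; rewrite ler_pdivlMr// lerBrDr -lerBrDl; apply: S_le => p Pp.
  rewrite lerBrDr; have := S_ge (bat eps (ltW e0)) Pp; apply: le_trans.
  rewrite /at_ lerD2l mulrC ler_wpM2l//; first exact: ltW.
  by have := bt p Pp; rewrite ler_norml => /andP[].
pose Q := [set q eps | eps in [set eps | 0 < eps]].
have Q0 : Q !=set0 by exists (q 1); exists 1 => //=; exact: ltr01.
have Qlb : has_lbound Q by exists (- K) => _ [eps /= e0 <-]; exact: q_lb.
pose q0 := inf Q.
have q0_le eps : 0 < eps -> q0 <= q eps by move=> e0; apply: (ge_inf Qlb); exists eps.
pose en (i : nat) : R := i.+1%:R^-1.
have en0 i : 0 < en i by rewrite invr_gt0.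
have en_cvg : en i @[i --> \oo] --> 0 by exact: cvg_harmonic.
(* Maximizers of [at_ (en i)] up to the square of [en i]: such an error still vanishes after
   division by [en i]. *)
have /choice[pn hpn] : forall i, exists p, PP p /\
    S a + en i * q0 - en i ^+ 2 <= a p + en i * t p.
  move=> i; have e2 : 0 < en i ^+ 2 by rewrite exprn_gt0.
  have hs : has_sup (at_ (en i) @` PP).
    split; first by case: PP0 => p Pp; exists (at_ (en i) p); exists p.
    exists (K + en i * K) => _ [p Pp <-].
    by rewrite (le_trans (ler_norm _))// bat// ltW.
  have [_ [p Pp <-] hp] := sup_adherent e2 hs.
  exists p; split => //; rewrite -/(at_ _ _) (le_trans _ (ltW hp))// lerD2r.
  by have := q0_le _ (en0 i); rewrite /q ler_pdivlMr// mulrC lerBrDl.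
have [p Pp [U [UF nU ap tp]]] := cluster pn (fun i => (hpn i).1).
have en_U : en i @[i --> U] --> 0 by move=> B /en_cvg; exact: nU.
have apS : a p = S a.
  apply/eqP; rewrite eq_le (S_ge ba Pp)/=.
  have h : S a + en i * q0 - en i ^+ 2 - en i * K @[i --> U] --> S a + 0 * q0 - 0 ^+ 2 - 0 * K.
    apply: cvgB; [apply: cvgB; [apply: cvgD; [exact: cvg_cst|]|]|].
    - by apply: cvgMr_tmp.
    - rewrite expr2; under eq_fun do rewrite expr2; exact: cvgM.
    - by apply: cvgMr_tmp.
  rewrite !mul0r expr0n addr0 !subr0 in h.
  rewrite -(cvg_lim (@Rhausdorff R) h) -(cvg_lim (@Rhausdorff R) ap).
  apply: ler_lim; [by apply/cvg_ex; eexists; exact: h|by apply/cvg_ex; eexists; exact: ap|].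
  apply: filterE => i; have [Pi hi] := hpn i.
  rewrite lerBlDr (le_trans hi)// lerD2l ler_wpM2l//; first exact: ltW.
  by rewrite (le_trans (ler_norm _))// bt.
(* Since a (pn i) <= S a, cancelling S a and dividing by [en i] leaves q0 - en i <= t (pn i). *)
have tpq : q0 <= t p.
  have h : q0 - en i @[i --> U] --> q0 - 0 by apply: cvgB => //; exact: cvg_cst.
  rewrite subr0 in h.
  rewrite -(cvg_lim (@Rhausdorff R) h) -(cvg_lim (@Rhausdorff R) tp).
  apply: ler_lim; [by apply/cvg_ex; eexists; exact: h|by apply/cvg_ex; eexists; exact: tp|].
  apply: filterE => i; have [Pi hi] := hpn i.
  have := S_ge ba Pi => hS.
  rewrite -(ler_pM2l (en0 i)) mulrBr -expr2.
  by rewrite -(lerD2l (S a)) addrA (le_trans hi)// lerD2r.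
have tp_max p' : PP p' -> a p' = S a -> t p' <= q0.
  by move=> Pp' ap'; apply: lb_le_inf => // _ [eps /= e0 <-]; exact: q_ge.
have tpE : t p = q0 by apply/eqP; rewrite eq_le tpq tp_max.
exists p; split => //; last by rewrite tpE.
rewrite tpE; apply/cvgrPdist_le => e e0.
have e20 : 0 < e / 2 by rewrite divr_gt0.
have [_ [eps1 /= e10 <-] hq] := inf_adherent e20 (conj Q0 Qlb).
near=> eps.
have eps0 : 0 < eps by near: eps; exact: nbhs_right_gt.
have eps1' : eps <= eps1 by near: eps; exact: nbhs_right_le.
have h1 : q eps <= q0 + e / 2 by rewrite (le_trans (q_mono _ _ eps0 eps1'))// ltW.
have h2 := q0_le _ eps0.
have hj : forall p, PP p -> `|(j eps p - a p) / eps - t p| <= e / 2.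
  by near: eps; exact: jat.
have hj' p1 : PP p1 -> `|j eps p1 - at_ eps p1| <= eps * (e / 2).
  move=> Pp1; have := hj p1 Pp1.
  rewrite -(ler_pM2l eps0) -{1}(gtr0_norm eps0) -normrM; congr (`|_| <= _).
  by rewrite /at_; field; rewrite gt_eqF.
have bj p1 : PP p1 -> `|j eps p1| <= K + eps * K + eps * (e / 2).
  move=> Pp1; have -> : j eps p1 = at_ eps p1 + (j eps p1 - at_ eps p1) by ring.
  by rewrite (le_trans (ler_normD _ _))// lerD ?hj'// bat// ltW.
have h3 : S (j eps) <= S (at_ eps) + eps * (e / 2).
  apply: S_le => p1 Pp1; have := hj' p1 Pp1; rewrite ler_norml => /andP[_].
  by rewrite lerBlDl => /le_trans; apply; rewrite lerD2r (S_ge (bat _ (ltW eps0))).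
have h4 : S (at_ eps) <= S (j eps) + eps * (e / 2).
  apply: S_le => p1 Pp1; have := hj' p1 Pp1; rewrite distrC ler_norml => /andP[_].
  by rewrite lerBlDl => /le_trans; apply; rewrite lerD2r (S_ge bj).
have h5 : `|(S (j eps) - S a) / eps - q eps| <= e / 2.
  rewrite /q -mulrBl opprB addrA subrK normrM (gtr0_norm (_ : 0 < eps^-1)) ?invr_gt0//.
  rewrite ler_pdivrMr// mulrC ler_norml; apply/andP; split; lra.
move: h5; rewrite !ler_norml => /andP[h5 h6]; apply/andP; split; lra.
Unshelve. all: by end_near. Qed.

End directional_derivative_of_sup.

(** * Coefficients of the control problem *)

Lemma mulmx_norm_le (R : realType) p q r (A : 'M[R]_(p, q)) (B : 'M[R]_(q, r)) :
  `|A *m B| <= q%:R * (`|A| * `|B|).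
Proof.
apply: mx_norm_le => [|i j]; first by rewrite mulr_ge0// mulr_ge0.
rewrite mxE (le_trans (ler_norm_sum _ _ _))//.
apply: (@le_trans _ _ (\sum_(l < q) `|A| * `|B|)); last first.
  by rewrite sumr_const card_ord mulr_natl.
by apply: ler_sum => l _; rewrite normrM ler_pM// mx_entry_le.
Qed.

Lemma row_mx_norm_le (R : realType) p q r (A : 'M[R]_(p, q)) (B : 'M[R]_(p, r)) :
  `|A| <= `|row_mx A B| /\ `|B| <= `|row_mx A B|.
Proof.
split; apply: mx_norm_le => // i j.
  by have := mx_entry_le (row_mx A B) i (lshift r j); rewrite row_mxEl.
by have := mx_entry_le (row_mx A B) i (rshift q j); rewrite row_mxEr.
Qed.

Section coefficients.
Context (R : realType) (Omega : pointedType) (d N n m : nat).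
Context (W : nat -> Omega -> 'cV[R]_d).
Context (Theta : Type) (F : Theta -> probability (borel 'cV[R]_d) R).
Local Notation T := (filtered W N).
Local Notation PP := (dominated_probs N W F).
Local Notation V := ('cV[R]_n * 'cV[R]_m)%type.

Lemma pair_ball_compact (r : R) : compact [set z : V | `|z| <= r].
Proof.
have := compact_setX (@mx_ball_compact R n 1 r) (@mx_ball_compact R m 1 r).
congr compact; apply/seteqP; split => z /=; rewrite prod_normE ge_max.
  by move=> [-> ->].
by move=> /andP[].
Qed.

Definition Lclv q1 q2 k (Z : Omega -> 'M[R]_(q1, q2)) :=
  forall i j, Lcl PP 2 k (fun w => Z w i j).

Lemma Lclv_sub q1 q2 k (X Y : Omega -> 'M[R]_(q1, q2)) : (k <= N)%N ->
  Lclv k X -> Lclv k Y -> Lclv k (fun w => X w - Y w).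
Proof.
move=> kN AX AY i j; under eq_fun do rewrite !mxE.
exact: (Lcl_sub kN (AX i j) (AY i j)).
Qed.

Lemma Lclv_add q1 q2 k (X Y : Omega -> 'M[R]_(q1, q2)) : (k <= N)%N ->
  Lclv k X -> Lclv k Y -> Lclv k (fun w => X w + Y w).
Proof.
move=> kN AX AY i j; under eq_fun do rewrite !mxE.
exact: (Lcl_add kN (AX i j) (AY i j)).
Qed.

Lemma Lclv_scale q1 q2 k c (X : Omega -> 'M[R]_(q1, q2)) : (k <= N)%N ->
  Lclv k X -> Lclv k (fun w => c *: X w).
Proof.
by move=> kN AX i j; under eq_fun do rewrite !mxE; exact: (Lcl_scale kN _ (AX i j)).
Qed.

Lemma Lclv_cst q1 q2 k (A : 'M[R]_(q1, q2)) : (k <= N)%N -> Lclv k (fun=> A).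
Proof. by move=> kN i j; exact: Lcl_cst. Qed.

Lemma Lclv_pair k (X : Omega -> 'cV[R]_n) (v : Omega -> 'cV[R]_m) (z : V) : (k <= N)%N ->
  Lclv k X -> Lclv k v -> Lcl PP 2 k (fun w => `|(X w, v w) - z|).
Proof.
move=> kN AX Av.
rewrite (_ : (fun w => _) = (fun w => Num.max `|X w - z.1| `|v w - z.2|)).
  apply: (Lcl_max kN); apply: Lcl_mx_norm => //; apply: Lclv_sub => //; exact: Lclv_cst.
by apply/funext => w; rewrite prod_normE.
Qed.

(* g is the i-th entry of a vector coefficient with Jacobian (A, B), so that
   scalar and vector coefficients are treated alike; its Lipschitz constant
   grows with exponent a *)
Definition smooth_coef (dom : set V) (k p a : nat) (g : V -> Omega -> R) q (i : 'I_q)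
    (A : V -> Omega -> 'M[R]_(q, n)) (B : V -> Omega -> 'M[R]_(q, m)) : Prop :=
  [/\ forall z z' (t : R), dom z -> dom z' -> 0 <= t <= 1 -> dom (z + t *: (z' - z)),
      forall z w, dom z -> diff_within dom (g^~ w) z
        (fun h => (A z w *m h.1 + B z w *m h.2) i ord0),
      exists2 L : R, 0 <= L & forall z w, dom z ->
        `|A z w| + `|B z w| <= L * (1 + `|z|) ^+ a,
      forall alpha e : R, 0 < alpha -> 0 < e -> exists2 eta : R, 0 < eta &
        forall z z' w, dom z -> dom z' -> `|z| <= alpha -> `|z'| <= alpha ->
          `|z - z'| <= eta -> `|A z w - A z' w| <= e /\ `|B z w - B z' w| <= e &
      forall z, dom z -> Lcl PP p k (g z)].

Section smooth.
Context (dom : set V) (k p a : nat) (g : V -> Omega -> R) (q : nat) (i : 'I_q).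
Context (A : V -> Omega -> 'M[R]_(q, n)) (B : V -> Omega -> 'M[R]_(q, m)).
Hypothesis kN : (k <= N)%N.
Hypothesis pa : (p = 1%N /\ a = 1%N) \/ (p = 2%N /\ a = 0%N).
Hypothesis sg : smooth_coef dom k p a g i A B.

Let Dg (z : V) (w : Omega) (h : V) : R := (A z w *m h.1 + B z w *m h.2) i ord0.

Let jac_le (A1 : 'M[R]_(q, n)) (B1 : 'M[R]_(q, m)) (h : V) :
  `|(A1 *m h.1 + B1 *m h.2) i ord0| <= (n%:R + m%:R) * (`|A1| + `|B1|) * `|h|.
Proof.
have hh : `|h.1| <= `|h| /\ `|h.2| <= `|h| by rewrite prod_normE !le_max !lexx orbT.
rewrite (le_trans (mx_entry_le _ _ _))// (le_trans (ler_normD _ _))//.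
rewrite mulrDl mulrDl; apply: lerD.
  rewrite (le_trans (mulmx_norm_le _ _))// -mulrA ler_wpM2l// ler_pM ?lerDl//.
  by case: hh.
rewrite (le_trans (mulmx_norm_le _ _))// -mulrA ler_wpM2l// ler_pM ?lerDr//.
by case: hh.
Qed.

Let DgZ z w (t : R) h : dom z -> Dg z w (t *: h) = t * Dg z w h.
Proof. by move=> _; rewrite /Dg /= -!scalemxAr -scalerDr mxE. Qed.

Let Dg_bound : exists2 K : R, 0 <= K &
  forall z w h, dom z -> `|Dg z w h| <= K * (1 + `|z|) ^+ a * `|h|.
Proof.
have [_ _ [L L0 hL] _ _] := sg.
exists ((n%:R + m%:R) * L) => [|z w h Dz]; first by rewrite mulr_ge0.
rewrite (le_trans (jac_le _ _ _))// ler_wpM2r// -mulrA ler_wpM2l//.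
exact: hL.
Qed.

Let Dg_modulus (alpha e : R) : 0 < alpha -> 0 < e ->
  exists2 eta : R, 0 < eta & forall z z' w h, dom z -> dom z' ->
    `|z| <= alpha -> `|z'| <= alpha -> `|z - z'| <= eta ->
    `|Dg z w h - Dg z' w h| <= e * `|h|.
Proof.
move=> al0 e0; have [_ _ _ hmod _] := sg.
pose c : R := 2 * (n%:R + m%:R) + 1.
have c0 : 0 < c by rewrite ltr_wpDl// mulr_ge0.
have [eta eta0 heta] := hmod alpha (e / c) al0 (divr_gt0 e0 c0).
exists eta => // z z' w h Dz Dz' zal z'al zz'.
have [hA hB] := heta z z' w Dz Dz' zal z'al zz'.
have -> : Dg z w h - Dg z' w h =
    ((A z w - A z' w) *m h.1 + (B z w - B z' w) *m h.2) i ord0.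
  by rewrite /Dg !mulmxBl !mxE; ring.
rewrite (le_trans (jac_le _ _ _))// ler_wpM2r//.
apply: (@le_trans _ _ ((n%:R + m%:R) * (e / c + e / c))).
  by rewrite ler_wpM2l// lerD.
rewrite (_ : _ * _ = e * ((2 * (n%:R + m%:R)) / c)); last by ring.
by rewrite ler_piMr ?ler_pdivrMr ?mul1r ?lerDl//; exact: ltW.
Qed.

Lemma coef_composition (X : Omega -> 'cV[R]_n) (v : Omega -> 'cV[R]_m) :
  (forall w, dom (X w, v w)) -> Lclv k X -> Lclv k v ->
  Lcl PP p k (fun w => g (X w, v w) w).
Proof.
move=> dXv AX Av; have [hc hd _ _ hA] := sg; have [K K0 hK] := Dg_bound.
have lip z z' w : dom z -> dom z' -> `|g z w - g z' w| <= lipker K a z z'.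
  exact: (derivative_lip K0 hc hd DgZ hK).
apply: (Lcl_composition kN pair_ball_compact K0 pa lip hA (Z := fun w => (X w, v w)) dXv) => z.
exact: Lclv_pair.
Qed.

Section quotient.
Context (X Xh : Omega -> 'cV[R]_n) (v dv : Omega -> 'cV[R]_m) (Xf : R -> Omega -> 'cV[R]_n).
Hypothesis AX : Lclv k X.
Hypothesis AXh : Lclv k Xh.
Hypothesis Av : Lclv k v.
Hypothesis Adv : Lclv k dv.
Hypothesis AXf : forall eps, 0 < eps <= 1 -> Lclv k (Xf eps).
Hypothesis domZ : forall w, dom (X w, v w).
Hypothesis domZH : forall w, dom (X w + Xh w, v w + dv w).
Hypothesis domf : forall eps w, 0 < eps <= 1 -> dom (Xf eps w, v w + eps *: dv w).
Hypothesis Xf_vanish : forall e : R, 0 < e -> \forall eps \near (0 : R)^'+, forall P, PP P ->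
  (\int[P]_w (`|eps^-1 *: (Xf eps w - X w) - Xh w| ^+ 2)%:E <= e%:E)%E.

Let Z w : V := (X w, v w).
Let H w : V := (Xh w, dv w).
Let Zf eps w : V := (Xf eps w, v w + eps *: dv w).

Let AZH eps z : 0 <= eps <= 1 -> Lcl PP 2 k (fun w => `|Z w + eps *: H w - z|).
Proof.
by move=> _; apply: Lclv_pair => //; apply: Lclv_add => //; exact: Lclv_scale.
Qed.

Let AH : Lcl PP 2 k (fun w => `|H w|).
Proof.
by have := Lclv_pair 0 kN AXh Adv; under eq_fun do rewrite subr0.
Qed.

Let AZf eps z : 0 < eps <= 1 -> Lcl PP 2 k (fun w => `|Zf eps w - z|).
Proof.
move=> eps01; apply: Lclv_pair => //; first exact: AXf.
by apply: Lclv_add => //; exact: Lclv_scale.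
Qed.

(** The control is perturbed exactly linearly, so only the state component contributes to the
    distance. *)
Let rhoE eps w : 0 < eps <= 1 ->
  `|Zf eps w - (Z w + eps *: H w)| / eps = `|eps^-1 *: (Xf eps w - X w) - Xh w|.
Proof.
move=> /andP[e0 _]; rewrite prod_normE/= subrr normr0 max_l//.
rewrite -[X in _ / X](gtr0_norm e0) mulrC -normfV -normrZ.
by congr `|_|; rewrite opprD addrA scalerBr scalerA mulVf ?gt_eqF// scale1r.
Qed.

Let mrho eps : 0 < eps <= 1 ->
  measurable_fun [set: T] (fun w => `|Zf eps w - (Z w + eps *: H w)| / eps).
Proof.
move=> eps01; apply: (eq_measurable_fun
    (fun w : T => `|eps^-1 *: (Xf eps w - X w) - Xh w|)).
  by move=> w _; rewrite rhoE.
have [] // : Lcl PP 2 k (fun w => `|eps^-1 *: (Xf eps w - X w) - Xh w|).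
apply: Lcl_mx_norm => //; apply: Lclv_sub => //; apply: Lclv_scale => //.
by apply: Lclv_sub => //; exact: AXf.
Qed.

Let rho_vanish (e : R) : 0 < e -> \forall eps \near (0 : R)^'+, forall P, PP P ->
  (\int[P]_w ((`|Zf eps w - (Z w + eps *: H w)| / eps) ^+ 2)%:E <= e%:E)%E.
Proof.
move=> e0; near=> eps => P PPP.
have eps01 : 0 < eps <= 1.
  apply/andP; split; near: eps; first exact: nbhs_right_gt.
  by apply: nbhs_right_le.
under eq_integral do rewrite rhoE//.
by move: P PPP; near: eps; exact: Xf_vanish.
Unshelve. all: by end_near. Qed.

Lemma coef_derivative :
  Lcl PP p k (fun w => (A (Z w) w *m Xh w + B (Z w) w *m dv w) i ord0).
Proof.
have [hc hd _ _ hA] := sg; have [K K0 hK] := Dg_bound.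
exact: (Lcl_derivative kN pair_ball_compact K0 pa hc hd DgZ hK Dg_modulus hA
  (Z := Z) (H := H) domZ domZH AZH AH).
Qed.

Lemma coef_quotient eps : 0 < eps <= 1 -> Lcl PP p k (fun w =>
  (g (Zf eps w) w - g (Z w) w) / eps - (A (Z w) w *m Xh w + B (Z w) w *m dv w) i ord0).
Proof.
have [hc hd _ _ hA] := sg; have [K K0 hK] := Dg_bound.
exact: (Lcl_difference_quotient kN pair_ball_compact K0 pa hc hd DgZ hK Dg_modulus hA
  (Z := Z) (H := H) domZ domZH AZH AH (Zf := Zf) domf AZf).
Qed.

Lemma coef_quotient_vanish e : 0 < e -> \forall eps \near (0 : R)^'+, forall P, PP P ->
  (\int[P]_w (`|(g (Zf eps w) w - g (Z w) w) / eps -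
     (A (Z w) w *m Xh w + B (Z w) w *m dv w) i ord0| ^+ p)%:E <= e%:E)%E.
Proof.
have [hc hd _ _ hA] := sg; have [K K0 hK] := Dg_bound.
exact: (difference_quotient_vanish kN pair_ball_compact K0 pa hc hd DgZ hK Dg_modulus hA
  (Z := Z) (H := H) domZ domZH AZH AH (Zf := Zf) domf AZf mrho rho_vanish).
Qed.

End quotient.
End smooth.
End coefficients.

(** * Families that vanish in p-th mean, uniformly over the measures *)

Section vanishing_families.
Context (R : realType) (Omega : pointedType) (d N : nat).
Context (W : nat -> Omega -> 'cV[R]_d).
Local Notation T := (filtered W N).
Context (PP : set (probability T R)).

Definition vanishing (p : nat) (Y : R -> Omega -> R) : Prop :=
  (forall eps, 0 < eps <= 1 -> measurable_fun [set: T] (Y eps)) /\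
  forall e : R, 0 < e -> \forall eps \near (0 : R)^'+, forall P, PP P ->
    (\int[P]_w (`|Y eps w| ^+ p)%:E <= e%:E)%E.

Lemma near_right01 : \forall eps \near (0 : R)^'+, 0 < eps <= 1.
Proof.
near=> eps; apply/andP; split; near: eps; first exact: nbhs_right_gt.
by apply: nbhs_right_le.
Unshelve. all: by end_near. Qed.

Lemma vanishing_le p (Y1 Y2 Y : R -> Omega -> R) : vanishing p Y1 -> vanishing p Y2 ->
  (forall eps, 0 < eps <= 1 -> measurable_fun [set: T] (Y eps)) ->
  (forall eps w, 0 < eps <= 1 -> `|Y eps w| <= `|Y1 eps w| + `|Y2 eps w|) ->
  vanishing p Y.
Proof.
move=> [m1 v1] [m2 v2] mY hY; split => // e e0.
pose c : R := 2 ^+ p.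
have c0 : 0 < c by rewrite exprn_gt0.
have e1 : 0 < e / (2 * c) by rewrite divr_gt0// mulr_gt0.
near=> eps => P PPP.
have eps01 : 0 < eps <= 1 by near: eps; exact: near_right01.
have -> : e = c * (e / (2 * c)) + c * (e / (2 * c)) by field; rewrite gt_eqF.
apply: (ge0_integral_le2 (P := P) (f := fun w => `|Y1 eps w| ^+ p)
  (g := fun w => `|Y2 eps w| ^+ p)); try (exact: ltW);
  try (by move=> w; rewrite exprn_ge0).
- by apply: measurable_funX; apply: measurableT_comp => //; exact: m1.
- by apply: measurable_funX; apply: measurableT_comp => //; exact: m2.
- by apply: measurable_funX; apply: measurableT_comp => //; exact: mY.
- move=> w; rewrite exprn_ge0//= -mulrDr.
  apply: le_trans (exprD_le p (normr_ge0 _) (normr_ge0 _)).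
  by apply: lerXn2r; rewrite ?nnegrE ?addr_ge0// hY.
- by move: P PPP; near: eps; exact: v1.
- by move: P PPP; near: eps; exact: v2.
Unshelve. all: by end_near. Qed.

Lemma vanishingD p (Y1 Y2 : R -> Omega -> R) : vanishing p Y1 -> vanishing p Y2 ->
  vanishing p (fun eps w => Y1 eps w + Y2 eps w).
Proof.
move=> v1 v2; apply: (vanishing_le v1 v2) => [eps eps01|eps w _]; last exact: ler_normD.
by apply: measurable_funD; [exact: v1.1|exact: v2.1].
Qed.

Lemma vanishing0 p : (0 < p)%N -> vanishing p (fun _ _ => 0).
Proof.
move=> p0; split => // e e0; apply: filterE => eps P _.
under eq_integral do rewrite normr0 expr0n gtn_eqF//=.
by rewrite integral0 lee_fin ltW.
Qed.

Lemma vanishing_sum p (I : Type) (s : seq I) (Y : I -> R -> Omega -> R) : (0 < p)%N ->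
  (forall i, vanishing p (Y i)) -> vanishing p (fun eps w => \sum_(i <- s) Y i eps w).
Proof.
move=> p0 vY; elim: s => [|i s ih].
  rewrite (_ : (fun _ _ => _) = (fun _ _ => 0)); first exact: vanishing0.
  by apply/funext => eps; apply/funext => w; rewrite big_nil.
rewrite (_ : (fun _ _ => _) = (fun eps w => Y i eps w + \sum_(j <- s) Y j eps w)).
  exact: vanishingD.
by apply/funext => eps; apply/funext => w; rewrite big_cons.
Qed.

Lemma vanishing_eq p (Y1 Y2 : R -> Omega -> R) : (forall eps w, 0 < eps <= 1 -> Y1 eps w = Y2 eps w) ->
  vanishing p Y1 -> vanishing p Y2.
Proof.
move=> h [m1 v1]; split=> [eps eps01|e e0].
  by apply: (eq_measurable_fun (Y1 eps : T -> R)) (m1 _ eps01) => w _; exact: h.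
near=> eps => P PPP.
have eps01 : 0 < eps <= 1 by near: eps; exact: near_right01.
under eq_integral do rewrite -h//.
by move: P PPP; near: eps; exact: v1.
Unshelve. all: by end_near. Qed.

Lemma vanishing_mx_norm p q1 q2 (Z : R -> Omega -> 'M[R]_(q1, q2)) : (0 < p)%N ->
  (forall i j, vanishing p (fun eps w => Z eps w i j)) ->
  vanishing p (fun eps w => `|Z eps w|).
Proof.
move=> p0 vZ.
apply: (vanishing_eq (Y1 := fun eps w =>
    \big[Num.max/0]_(ij : 'I_q1 * 'I_q2) `|Z eps w ij.1 ij.2|)).
  by move=> eps w _; rewrite [RHS]/Num.norm/= mx_normrE.
elim: (index_enum _) => [|ij s ih].
  apply: (vanishing_eq (Y1 := fun _ _ => 0)); last exact: vanishing0.
  by move=> eps w _; rewrite big_nil.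
apply: (vanishing_eq (Y1 := fun eps w => Num.max `|Z eps w ij.1 ij.2|
    (\big[Num.max/0]_(ij <- s) `|Z eps w ij.1 ij.2|))).
  by move=> eps w _; rewrite big_cons.
apply: (vanishing_le (vZ ij.1 ij.2) ih) => [eps eps01|eps w _].
  by apply: measurable_maxr; [apply: measurableT_comp => //; exact: (vZ _ _).1|exact: ih.1].
move: (\big[_/_]_(_ <- _) _) => x.
rewrite ger0_norm ?le_max ?normr_ge0//.
by rewrite ge_max lerDl normr_ge0/= (le_trans (ler_norm x))// lerDr.
Qed.

End vanishing_families.

(** * Convex combinations in the completion of order 2 *)

Section linear_classes.
Context (R : realType) (Omega : pointedType) (d N : nat).
Context (W : nat -> Omega -> 'cV[R]_d).
Context (Theta : Type) (F : Theta -> probability (borel 'cV[R]_d) R).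
Local Notation T := (filtered W N).
Local Notation PP := (dominated_probs N W F).
Hypothesis PP0 : PP !=set0.

Lemma Ehat_le (X : Omega -> R) (e : \bar R) :
  (forall P, PP P -> (\int[P]_w (X w)%:E <= e)%E) -> (Ehat N W F X <= e)%E.
Proof. by move=> h; apply: ge_ereal_sup => _ [P PPP <-]; rewrite unlock; exact: h. Qed.

Lemma Ehat_ge (X : Omega -> R) (P : probability T R) :
  PP P -> (\int[P]_w (X w)%:E <= Ehat N W F X)%E.
Proof. by move=> PPP; apply: ereal_sup_ubound; exists P => //; rewrite unlock. Qed.

(** Polarity asks for a supremum equal to 0, and an empty supremum would be -oo; hence the dominated
    probability from [PP0]. *)
Lemma quasi_surely_setI (A B : set Omega) : quasi_surely N W F A ->
  quasi_surely N W F B -> quasi_surely N W F (A `&` B).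
Proof.
have null C : polar N W F C -> forall P, PP P -> P C = 0%E.
  move=> [_ C0] P PPP; apply/eqP; rewrite eq_le measure_ge0 andbT -C0.
  by apply: ereal_sup_ubound; exists P.
move=> [A' [pA hA]] [B' [pB hB]]; exists (A' `|` B'); split; last first.
  by rewrite setCU => w [nA nB]; split; [exact: hA|exact: hB].
split; first exact: measurableU pA.1 pB.1.
have PU P : PP P -> P (A' `|` B') = 0%E.
  move=> PPP; apply/eqP; rewrite eq_le measure_ge0 andbT.
  have h : (P (A' `|` B') <= P A' + P B')%E.
    by apply: measureU2; [exact: pA.1|exact: pB.1].
  by rewrite (le_trans h)// !null// adde0.
apply/eqP; rewrite eq_le; apply/andP; split.
  by apply: ge_ereal_sup => _ [P PPP <-]; rewrite PU.
by case: PP0 => P PPP; rewrite -(PU P PPP); apply: ereal_sup_ubound; exists P.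
Qed.

Let sq_conv (t x y : R) : 0 <= t <= 1 ->
  `|x + t * (y - x)| ^+ 2 <= `|x| ^+ 2 + `|y| ^+ 2.
Proof.
move=> /andP[t0 t1]; rewrite !real_normK ?num_real//.
rewrite -subr_ge0.
have -> : x ^+ 2 + y ^+ 2 - (x + t * (y - x)) ^+ 2 =
  t * (1 - t) * (y - x) ^+ 2 + t * x ^+ 2 + (1 - t) * y ^+ 2 by ring.
have t1' : 0 <= 1 - t by rewrite subr_ge0.
by rewrite !addr_ge0// mulr_ge0 ?sqr_ge0// mulr_ge0.
Qed.

Let Ehat_conv (X Y : Omega -> R) (t : R) : 0 <= t <= 1 ->
  measurable_fun [set: T] X -> measurable_fun [set: T] Y ->
  (Ehat N W F (fun w => `|X w + t * (Y w - X w)| ^+ 2)%R <=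
   Ehat N W F (fun w => `|X w| ^+ 2)%R + Ehat N W F (fun w => `|Y w| ^+ 2)%R)%E.
Proof.
move=> t01 mX mY; apply: Ehat_le => P PPP.
have mX2 : measurable_fun [set: T] (fun w => `|X w| ^+ 2).
  by apply: measurable_funX; exact: measurableT_comp.
have mY2 : measurable_fun [set: T] (fun w => `|Y w| ^+ 2).
  by apply: measurable_funX; exact: measurableT_comp.
have mXY2 : measurable_fun [set: T] (fun w => `|X w + t * (Y w - X w)| ^+ 2).
  apply: measurable_funX; apply: measurableT_comp => //; apply: measurable_funD => //.
  by apply: measurable_funM => //; exact: measurable_funB.
apply: le_trans (leeD (Ehat_ge _ PPP) (Ehat_ge _ PPP)).
rewrite -ge0_integralD//; try exact/measurable_EFinP.
apply: ge0_le_integral => //.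
- exact/measurable_EFinP.
- by apply: emeasurable_funD; exact/measurable_EFinP.
- by move=> w _; rewrite -EFinD lee_fin sq_conv.
Qed.

Let Ehat_norm_lt (X : Omega -> R) (e : R) : 0 < e ->
  (Ehat_norm N W F 2 X < e%:E)%E <-> (Ehat N W F (fun w => `|X w| ^+ 2)%R < (e ^+ 2)%:E)%E.
Proof.
move=> e0; rewrite /Ehat_norm.
set A := Ehat _ _ _ _.
have A0 : (0 <= A)%E.
  case: PP0 => P PPP; apply: le_trans (Ehat_ge _ PPP).
  by apply: integral_ge0 => w _; rewrite lee_fin exprn_ge0.
have e2 : (0 <= (e ^+ 2)%:E)%E by rewrite lee_fin exprn_ge0// ltW.
have eE : e%:E = ((e ^+ 2)%:E `^ (2%:R^-1))%E.
  by rewrite poweR_EFin powR12_sqrt ?exprn_ge0 ?sqrtr_sqr ?gtr0_norm// ltW.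
have in0 (x : \bar R) : (0 <= x)%E -> x \in `[0%E, +oo%E] by move=> x0; rewrite in_itv/= x0 leey.
have i2 : 0 <= (2%:R^-1 : R) by rewrite invr_ge0.
have r2 : 0 <= (2%:R : R) by [].
split => h; rewrite ltNge; apply/negP => h1.
  have h2 := gt0_ler_poweR i2 (in0 _ e2) (in0 _ A0) h1.
  by have := le_lt_trans h2 h; rewrite -eE ltxx.
have e1 : (0 <= e%:E)%E by rewrite lee_fin ltW.
have h2 := gt0_ler_poweR r2 (in0 _ e1) (in0 _ (poweR_ge0 A 2%:R^-1)) h1.
rewrite -poweRrM mulVf// poweRe1// poweR_EFin powR_mulrn in h2; last exact: ltW.
by have := le_lt_trans h2 h; rewrite ltxx.
Qed.

(** Admissibility is expressed with [Lc], so representatives and their quasi-sure equality must be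
    carried along. The bound |x + t (y - x)|^2 <= |x|^2 + |y|^2 replaces Minkowski's inequality: two
    errors e / 2 give e^2 / 2 < e^2. *)
Lemma Lc2_segment k X Y t : (k <= N)%N -> 0 <= t <= 1 -> Lc N W F 2 k X -> Lc N W F 2 k Y ->
  Lc N W F 2 k (fun w => X w + t * (Y w - X w)).
Proof.
move=> kN t01 [mX [X' [qX mX' EX hX]]] [mY [Y' [qY mY' EY hY]]].
split.
  by apply: measurable_funD => //; apply: measurable_funM => //; exact: measurable_funB.
have [mX'N mY'N] := (filtered_measurable_fun kN mX', filtered_measurable_fun kN mY').
exists (fun w => X' w + t * (Y' w - X' w)); split.
- have [B [pB hB]] := quasi_surely_setI qX qY.
  by exists B; split => // w /hB[/= -> ->].
- by apply: measurable_funD => //; apply: measurable_funM => //; exact: measurable_funB.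
- by apply: (le_lt_trans (Ehat_conv t01 mX'N mY'N)); rewrite lte_add_pinfty.
move=> e e0; have e2 : 0 < e / 2 by rewrite divr_gt0.
have [_ [phi cphi <-] /(Ehat_norm_lt _ e2) h1] := hX _ e2.
have [_ [psi cpsi <-] /(Ehat_norm_lt _ e2) h2] := hY _ e2.
exists ((fun x => phi x + t * (psi x - phi x)) \o noise_path W k).
  by exists (fun x => phi x + t * (psi x - phi x)) => //; apply: CblipD => //; apply: CblipZ; exact: CblipB.
apply/(Ehat_norm_lt _ e0).
rewrite (_ : (fun w => _) = (fun w => `|(X' w - phi (noise_path W k w)) +
   t * ((Y' w - psi (noise_path W k w)) - (X' w - phi (noise_path W k w)))| ^+ 2)%R); last first.
  by apply/funext => w; congr (`|_| ^+ _); rewrite /=; ring.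
have mphi := @Cblip_noise_measurable _ _ _ W _ _ _ kN cphi.
have mpsi := @Cblip_noise_measurable _ _ _ W _ _ _ kN cpsi.
apply: (le_lt_trans (Ehat_conv t01 (measurable_funB mX'N mphi) (measurable_funB mY'N mpsi))).
apply: (lt_trans (lteD h1 h2)).
rewrite -EFinD lte_fin.
have : 0 < e ^+ 2 by rewrite exprn_gt0.
have -> : (e / 2) ^+ 2 = e ^+ 2 / 4 by field.
by move=> ?; lra.
Qed.

End linear_classes.

(** * The variational equation *)

Section control.
Context (R : realType) (Omega : pointedType) (d n m N : nat).
Context (W : nat -> Omega -> 'cV[R]_d).
Context (Theta : Type) (F : Theta -> probability (borel 'cV[R]_d) R).
Context (U : nat -> set 'cV[R]_m) (x0 : 'cV[R]_n).
Context (c : coefficients R Omega d n m) (D : jacobians R Omega d n m).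
Hypothesis N_gt0 : (0 < N)%N.
Hypothesis d_gt0 : (0 < d)%N.
Hypothesis Theta_n0 : inhabited Theta.
Hypothesis hA3 : A3 N W F.
Hypothesis hW : forall k, (1 <= k <= N)%N -> Lcv N W F 2 k (W k).
Hypothesis hU : forall k, (k < N)%N -> U k !=set0 /\ convex_set (U k).
Hypothesis hD : differentiable_coefficients N U c D.
Hypothesis hH1 : H1 N W F U c.
Hypothesis hH2 : H2 N U D.
Hypothesis hH3 : H3 N U D.
Local Notation T := (filtered W N).
Local Notation PP := (dominated_probs N W F).
Local Notation V := ('cV[R]_n * 'cV[R]_m)%type.

Let dom k : set V := [set z | U k z.2].

Lemma modulus_small (om : R -> R) (e : R) : modulus om -> 0 < e ->
  exists2 eta : R, 0 < eta & forall r, 0 <= r <= eta -> om r <= e.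
Proof.
move=> [om0 _ omz /cvgrPdist_le/(_ _)] + e0 => /(_ _ e0)[eta /= eta0 h].
exists (eta / 2); first by rewrite divr_gt0.
move=> r /andP[r0 reta]; have [->|rn0] := eqVneq r 0; first by rewrite omz ltW.
have {rn0} r0' : 0 < r by rewrite lt_neqAle eq_sym rn0.
have := h r; rewrite /= sub0r normrN gtr0_norm// => /(_ _ r0').
rewrite sub0r normrN ger0_norm ?om0//; apply.
by rewrite (le_lt_trans reta)// ltr_pdivrMr// ltr_pMr// ltr1n.
Qed.

Lemma control_segment k u v (t : R) : (k < N)%N -> U k u -> U k v -> 0 <= t <= 1 ->
  U k (u + t *: (v - u)).
Proof.
move=> kN Uu Uv /andP[t0 t1]; have [_ cU] := hU kN.
pose l : {i01 R} := Itv01 t0 t1.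
have := cU v u l (mem_set Uv) (mem_set Uu); rewrite inE.
congr (U k _); rewrite /conv/=.
by rewrite scalerBr scalerBl scale1r addrC -addrA; congr (_ + _); rewrite addrC.
Qed.

Let dom_segment k z z' (t : R) : (k < N)%N -> dom k z -> dom k z' -> 0 <= t <= 1 ->
  dom k (z + t *: (z' - z)).
Proof. by move=> kN Uz Uz' t01; exact: control_segment. Qed.

(** Pairs carry the maximum norm while the modulus takes the sum of the two distances, hence the
    radius eta / 2. *)
Let jac_modulus k q (A : nat -> 'cV[R]_n -> 'cV[R]_m -> Omega -> 'M[R]_(q, n))
    (B : nat -> 'cV[R]_n -> 'cV[R]_m -> Omega -> 'M[R]_(q, m)) : (k < N)%N ->
  (forall alpha : R, 0 < alpha -> exists2 om : R -> R, modulus om &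
    forall w (x x' : 'cV[R]_n) (u u' : 'cV[R]_m), U k u -> U k u' ->
    `|x| <= alpha -> `|x'| <= alpha -> `|u| <= alpha -> `|u'| <= alpha ->
    `|row_mx (A k x u w) (B k x u w) - row_mx (A k x' u' w) (B k x' u' w)|
      <= om (`|x - x'| + `|u - u'|)) ->
  forall alpha e : R, 0 < alpha -> 0 < e -> exists2 eta : R, 0 < eta &
    forall (z z' : V) w, dom k z -> dom k z' -> `|z| <= alpha -> `|z'| <= alpha ->
      `|z - z'| <= eta -> `|A k z.1 z.2 w - A k z'.1 z'.2 w| <= e /\
        `|B k z.1 z.2 w - B k z'.1 z'.2 w| <= e.
Proof.
move=> kN h alpha e al0 e0; have [om mom hom] := h alpha al0.
have [eta eta0 heta] := modulus_small mom e0.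
exists (eta / 2); first by rewrite divr_gt0.
move=> z z' w Uz Uz'; rewrite !prod_normE !ge_max => /andP[z1 z2] /andP[z'1 z'2] /andP[d1 d2].
have : `|row_mx (A k z.1 z.2 w - A k z'.1 z'.2 w) (B k z.1 z.2 w - B k z'.1 z'.2 w)| <= e.
  rewrite -add_row_mx -opp_row_mx (le_trans (hom w _ _ _ _ Uz Uz' z1 z'1 z2 z'2))//.
  by apply: heta; rewrite addr_ge0//= [eta]splitr lerD.
have [hA hB] := row_mx_norm_le (A k z.1 z.2 w - A k z'.1 z'.2 w) (B k z.1 z.2 w - B k z'.1 z'.2 w).
by move=> he; split; [exact: le_trans he|exact: le_trans he].
Qed.

Let entry_diff (q : nat) (E : set V) (g : V -> 'cV[R]_q) z (G : V -> 'cV[R]_q) i :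
  diff_within E g z G -> diff_within E (fun z => g z i ord0 : R) z (fun h => G h i ord0).
Proof.
move=> h e e0; apply: filterS (h e e0) => y /= hy.
by apply: le_trans hy; have := mx_entry_le (g y - g z - G (y - z)) i ord0; rewrite !mxE.
Qed.

Let norm_pair (z : V) : `|z.1| <= `|z| /\ `|z.2| <= `|z|.
Proof. by rewrite prod_normE !le_max !lexx orbT. Qed.

Lemma drift_smooth k i : (k < N)%N -> smooth_coef N W F (dom k) k 2 0
  (fun z w => drift c k z.1 z.2 w i ord0) i
  (fun z w => drift_x D k z.1 z.2 w) (fun z w => drift_u D k z.1 z.2 w).
Proof.
move=> kN; split => [z z' t|z w Uz|||z Uz].
- exact: dom_segment.
- have [hd _ _] := hD.1 k w z.1 z.2 kN Uz.
  have {hd} := entry_diff i hd; rewrite -surjective_pairing; exact.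
- have [L L0 hL] := hH2; exists L; first exact: ltW.
  move=> z w Uz; rewrite expr0 mulr1; have [hl _] := hL k w z.1 z.2 kN Uz.
  (* [H2] bounds the drift jointly with each diffusion coefficient; d > 0 provides one. *)
  apply: le_trans (hl (Ordinal d_gt0)).
  by rewrite -addrA lerDl addr_ge0.
- apply: jac_modulus => // alpha al0; have [om mom hom] := hH3 al0; exists om => //.
  move=> w x x' u u' Uu Uu' h1 h2 h3 h4.
  have [h _ _] := hom k w x x' u u' kN Uu Uu' h1 h2 h3 h4.
  by apply: le_trans h; rewrite lerDl.
- apply: Lc_Lcl => //; first exact: ltnW.
  by have [h _ _] := hH1.1 k z.1 z.2 kN Uz; exact: h.
Qed.

Lemma diffu_smooth l k i : (k < N)%N -> smooth_coef N W F (dom k) k 2 0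
  (fun z w => diffu c l k z.1 z.2 w i ord0) i
  (fun z w => diffu_x D l k z.1 z.2 w) (fun z w => diffu_u D l k z.1 z.2 w).
Proof.
move=> kN; split => [z z' t|z w Uz|||z Uz].
- exact: dom_segment.
- have [_ hd _] := hD.1 k w z.1 z.2 kN Uz.
  have {hd} := entry_diff i (hd l); rewrite -surjective_pairing; exact.
- have [L L0 hL] := hH2; exists L; first exact: ltW.
  move=> z w Uz; rewrite expr0 mulr1; have [hl _] := hL k w z.1 z.2 kN Uz.
  apply: le_trans (hl l).
  by rewrite -[leRHS]addrA lerDr addr_ge0.
- apply: (jac_modulus (A := diffu_x D l) (B := diffu_u D l)) => // alpha al0.
  have [om mom hom] := hH3 al0; exists om => //.
  move=> w x x' u u' Uu Uu' h1 h2 h3 h4.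
  have [_ h _] := hom k w x x' u u' kN Uu Uu' h1 h2 h3 h4.
  by apply: le_trans (h l); rewrite lerDl.
- apply: Lc_Lcl => //; first exact: ltnW.
  by have [_ h _] := hH1.1 k z.1 z.2 kN Uz; exact: h.
Qed.

Lemma rcost_smooth k : (k < N)%N -> smooth_coef N W F (dom k) k 1 1
  (fun z w => rcost c k z.1 z.2 w) (ord0 : 'I_1)
  (fun z w => rcost_x D k z.1 z.2 w) (fun z w => rcost_u D k z.1 z.2 w).
Proof.
move=> kN; split => [z z' t|z w Uz|||z Uz].
- exact: dom_segment.
- have [_ _ hd] := hD.1 k w z.1 z.2 kN Uz.
  by move: hd; rewrite -surjective_pairing; exact.
(* The factor 2 compares |x| + |u| with the maximum norm of the pair. *)
- have [L L0 hL] := hH2; exists (2 * L); first by rewrite mulr_ge0// ltW.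
  move=> z w Uz; have [_ hl] := hL k w z.1 z.2 kN Uz.
  apply: (@le_trans _ _ (L * (1 + `|z.1| + `|z.2|))).
    by apply: le_trans hl; rewrite lerDl.
  rewrite expr1 (mulrC 2) -mulrA ler_pM2l//; have [h1 h2] := norm_pair z; lra.
- apply: jac_modulus => // alpha al0; have [om mom hom] := hH3 al0; exists om => //.
  move=> w x x' u u' Uu Uu' h1 h2 h3 h4.
  have [_ _ h] := hom k w x x' u u' kN Uu Uu' h1 h2 h3 h4.
  by apply: le_trans h; rewrite lerDl.
- apply: Lc_Lcl => //; first exact: ltnW.
  by have [_ _ h] := hH1.1 k z.1 z.2 kN Uz; exact: h.
Qed.

(** The terminal cost is read as a function of (x, u) constant in u, over the whole space. Its
    bounds in [H2] and [H3] are quantified jointly with a control value, so a point p0 of U 0 is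
    fixed; this explains L (1 + |p0|) and the radius alpha + |p0|. *)
Lemma tcost_smooth : smooth_coef N W F setT N 1 1
  (fun z w => tcost c z.1 w) (ord0 : 'I_1)
  (fun z w => tcost_x D z.1 w) (fun _ _ => 0 : 'M[R]_(1, m)).
Proof.
have [[p0 Up0] _] := hU N_gt0.
split => // [z w _||alpha e al0 e0|z _].
- move=> e e0; have := hD.2 w z.1 e e0.
  rewrite /within/= => h.
  have h1 : (z' : V).1 @[z' --> z] --> z.1 by exact: cvg_fst.
  have h2 : \forall y \near nbhs z, setT (y : V).1 ->
      `|tcost c y.1 w - tcost c z.1 w - (tcost_x D z.1 w *m (y.1 - z.1)) ord0 ord0|
        <= e * `|y.1 - z.1| by exact: (h1 _ h).
  apply: filterS h2 => y hy _.
  rewrite mul0mx addr0; apply: le_trans (hy I) _.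
  by apply: ler_wpM2l; [exact: ltW|have [] := norm_pair (y - z)].
- have [L L0 hL] := hH2; exists (L * (1 + `|p0|)).
    by rewrite mulr_ge0 ?ltW// ltr_wpDr.
  move=> z w _; have [_ hl] := hL 0%N w z.1 p0 N_gt0 Up0.
  rewrite normr0 addr0 expr1.
  apply: (@le_trans _ _ (L * (1 + `|z.1| + `|p0|))).
    by apply: le_trans hl; rewrite lerDr addr_ge0.
  rewrite -mulrA ler_pM2l// mulrDl mul1r mulrDr mulr1.
  have [h1 _] := norm_pair z; have : 0 <= `|p0| * `|z| by rewrite mulr_ge0.
  lra.
- have al1 : 0 < alpha + `|p0| by rewrite ltr_wpDr.
  have [om mom hom] := hH3 al1; have [eta eta0 heta] := modulus_small mom e0.
  exists eta => // z z' w _ _ z1 z2 zz'.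
  rewrite subrr normr0 (ltW e0); split => //.
  have [h1 _] := norm_pair z; have [h2 _] := norm_pair z'.
  have a1 : `|z.1| <= alpha + `|p0| by rewrite (le_trans h1)// (le_trans z1)// lerDl.
  have a2 : `|z'.1| <= alpha + `|p0| by rewrite (le_trans h2)// (le_trans z2)// lerDl.
  have a3 : `|p0| <= alpha + `|p0| by rewrite lerDr ltW.
  have [_ _ h] := hom 0%N w z.1 z'.1 p0 p0 N_gt0 Up0 Up0 a1 a2 a3 a3.
  apply: le_trans (heta (`|z.1 - z'.1| + `|p0 - p0|) _).
    by apply: le_trans h; rewrite lerDr.
  rewrite subrr normr0 addr0 normr_ge0/=; have [h3 _] := norm_pair (z - z').
  exact: le_trans zz'.
- by apply: Lc_Lcl => //; exact: hH1.2.
Qed.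

Let near01 := @near_right01 R.

Lemma perturb_admissible us u (eps : R) : 0 <= eps <= 1 -> admissible N W F U us ->
  admissible N W F U u -> admissible N W F U (perturb us u eps).
Proof.
move=> eps01 aus au k kN; have [Uus Lus] := aus k kN; have [Uu Lu] := au k kN.
split=> [w|i]; first exact: control_segment.
have := Lc2_segment (dominated_probs_n0 Theta_n0 hA3) (ltnW kN) eps01 (Lus i) (Lu i).
by congr (Lc _ _ _ _ _); apply/funext => w; rewrite /perturb !mxE.
Qed.

Lemma admissible_Lclv u k : admissible N W F U u -> (k < N)%N -> Lclv N W F k (u k).
Proof.
move=> au kN i j; have [_ Lu] := au k kN; rewrite (ord1 j).
by apply: Lc_Lcl => //; exact: ltnW.
Qed.

Lemma state_Lclv u k : admissible N W F U u -> (k <= N)%N -> Lclv N W F k (state W x0 c u k).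
Proof.
move=> au; elim: k => [|k ih] kN; first exact: Lclv_cst.
have kN' := ltnW kN; have Ax := ih kN'; have Au := admissible_Lclv au kN.
have Du w : dom k (state W x0 c u k w, u k w) by have [h _] := au k kN; exact: h.
have pa2 : (2 = 1 /\ 0 = 1)%N \/ (2 = 2 /\ 0 = 0)%N by right.
move=> i j; rewrite (ord1 j) /=.
have Ab := coef_composition kN' pa2 (drift_smooth i kN) Du Ax Au.
have As l := coef_composition kN' pa2 (diffu_smooth l i kN) Du Ax Au.
have := Lcl_add kN (Lcl_widen (leqnSn k) Ab) (Lcl_sum kN (index_enum _) (isT : (0 < 2)%N)
  (fun l => Lcl_noise_product Theta_n0 hA3 hW l kN (As l))).
congr Lcl; apply/funext => w; rewrite !mxE summxE; congr (_ + _).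
by apply: eq_bigr => l _; rewrite !mxE mulrC.
Qed.

Lemma pathcost_Lcl u : admissible N W F U u -> Lcl PP 1 N (pathcost N W x0 c u).
Proof.
move=> au; have [[p0 Up0] _] := hU N_gt0.
have pa1 : (1 = 1 /\ 1 = 1)%N \/ (1 = 2 /\ 1 = 0)%N by left.
apply: (Lcl_add (leqnn N)).
  apply: (Lcl_sum (leqnn N)) => // k; have kN := ltn_ord k.
  apply: (Lcl_widen (ltnW kN)).
  apply: (coef_composition (ltnW kN) pa1 (rcost_smooth kN)).
  - by move=> w; have [h _] := au k kN; exact: h.
  - by apply: state_Lclv => //; exact: ltnW.
  - exact: admissible_Lclv.
apply: (coef_composition (v := fun=> 0) (leqnn N) pa1 tcost_smooth) => //.
  exact: state_Lclv.
exact: Lclv_cst.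
Qed.

Let quotient_linear_sum (I : finType) (b1 b0 bd r : R) (s1 s0 sd w : I -> R) :
  (b1 - b0) / r - bd + \sum_l ((s1 l - s0 l) / r - sd l) * w l
  = r^-1 * (b1 + \sum_l w l * s1 l - (b0 + \sum_l w l * s0 l)) - (bd + \sum_l w l * sd l).
Proof.
rewrite (_ : \sum_l ((s1 l - s0 l) / r - sd l) * w l
  = r^-1 * (\sum_l w l * s1 l - \sum_l w l * s0 l) - \sum_l w l * sd l); first by ring.
by rewrite -sumrB mulr_sumr -sumrB; apply: eq_bigr => l _; ring.
Qed.

Section variation.
Context (us u : nat -> Omega -> 'cV[R]_m).
Hypothesis aus : admissible N W F U us.
Hypothesis au : admissible N W F U u.

Let X k := state W x0 c us k.
Let Xf k eps := state W x0 c (perturb us u eps) k.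
Let Xh k := var_state W x0 c D us u k.

Let a_perturb eps : 0 < eps <= 1 -> admissible N W F U (perturb us u eps).
Proof. by move=> /andP[e0 e1]; apply: perturb_admissible => //; rewrite ltW. Qed.

Let domZ k w : (k < N)%N -> dom k (X k w, us k w).
Proof. by move=> kN; have [h _] := aus kN; exact: h. Qed.

Let domZH k w : (k < N)%N -> dom k (X k w + Xh k w, us k w + (u k w - us k w)).
Proof. by move=> kN; rewrite /dom/= addrC subrK; have [h _] := au kN; exact: h. Qed.

Let domf k eps w : (k < N)%N -> 0 < eps <= 1 ->
  dom k (Xf k eps w, us k w + eps *: (u k w - us k w)).
Proof. by move=> kN eps01; have [h _] := a_perturb eps01 kN; exact: h. Qed.

Let Adv k : (k < N)%N -> Lclv N W F k (fun w => u k w - us k w).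
Proof. by move=> kN; apply: Lclv_sub; rewrite ?(ltnW kN)//; exact: admissible_Lclv. Qed.

Let AXf k eps : (k <= N)%N -> 0 < eps <= 1 -> Lclv N W F k (Xf k eps).
Proof. by move=> kN eps01; apply: state_Lclv => //; exact: a_perturb. Qed.

Let norm_quotient k : (forall i, vanishing PP 2
    (fun eps w => (eps^-1 *: (Xf k eps w - X k w) - Xh k w) i ord0)) ->
  forall e : R, 0 < e -> \forall eps \near (0 : R)^'+, forall P, PP P ->
    (\int[P]_w (`|eps^-1 *: (Xf k eps w - X k w) - Xh k w| ^+ 2)%:E <= e%:E)%E.
Proof.
move=> vX.
have [|_ v] := vanishing_mx_norm (PP := PP) (p := 2)
    (Z := fun eps w => eps^-1 *: (Xf k eps w - X k w) - Xh k w) isT.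
  by move=> i j; rewrite (ord1 j); exact: vX.
move=> e e0; apply: filterS (v e e0) => eps h P PPP.
by have := h P PPP; under eq_integral do rewrite normr_id.
Qed.

(** The claims are proved together: the error at time k + 1 is [qb] plus the sum of the [qs] times
    the noise, and these vanish because Xh is approximable and the error vanishes at time k.
    [product_second_moment] transfers the smallness of [qs] to its product with the noise. *)
Lemma var_state_quotient k : (k <= N)%N -> Lclv N W F k (Xh k) /\
  forall i, vanishing PP 2 (fun eps w => (eps^-1 *: (Xf k eps w - X k w) - Xh k w) i ord0).
Proof.
elim: k => [|k ih] kN.
  split; first exact: Lclv_cst.
  move=> i; apply: (vanishing_eq (Y1 := fun _ _ => 0)); last exact: vanishing0.
  by move=> eps w _; rewrite /Xf /X /Xh /= subrr scaler0 subr0 mxE.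
have kN' := ltnW kN; have [AXh vX] := ih kN'.
have pa2 : (2 = 1 /\ 0 = 1)%N \/ (2 = 2 /\ 0 = 0)%N by right.
have AX := state_Lclv aus kN'; have Aus := admissible_Lclv aus kN.
have vXn := norm_quotient vX.
have Db i := coef_derivative kN' pa2 (drift_smooth i kN) AX AXh Aus (Adv kN)
  (fun w => domZ w kN) (fun w => domZH w kN).
have Ds l i := coef_derivative kN' pa2 (diffu_smooth l i kN) AX AXh Aus (Adv kN)
  (fun w => domZ w kN) (fun w => domZH w kN).
have Qb i eps (h : 0 < eps <= 1) := coef_quotient kN' pa2 (drift_smooth i kN) AX AXh Aus (Adv kN)
  (fun eps h => AXf kN' h) (fun w => domZ w kN) (fun w => domZH w kN)
  (fun eps w h => domf w kN h) h.
have Qs l i eps (h : 0 < eps <= 1) := coef_quotient kN' pa2 (diffu_smooth l i kN) AX AXh Aus (Adv kN)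
  (fun eps h => AXf kN' h) (fun w => domZ w kN) (fun w => domZH w kN)
  (fun eps w h => domf w kN h) h.
have Vb i e (e0 : 0 < e) := coef_quotient_vanish kN' pa2 (drift_smooth i kN) AX AXh Aus (Adv kN)
  (fun eps h => AXf kN' h) (fun w => domZ w kN) (fun w => domZH w kN)
  (fun eps w h => domf w kN h) vXn e0.
have Vs l i e (e0 : 0 < e) := coef_quotient_vanish kN' pa2 (diffu_smooth l i kN) AX AXh Aus (Adv kN)
  (fun eps h => AXf kN' h) (fun w => domZ w kN) (fun w => domZH w kN)
  (fun eps w h => domf w kN h) vXn e0.
split.
  move=> i j; rewrite (ord1 j).
  have := Lcl_add kN (Lcl_widen (leqnSn k) (Db i)) (Lcl_sum kN (index_enum _) (isT : (0 < 2)%N)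
    (fun l => Lcl_noise_product Theta_n0 hA3 hW l kN (Ds l i))).
  congr Lcl; apply/funext => w; rewrite /Xh /= !mxE summxE; congr (_ + _).
  by apply: eq_bigr => l _; rewrite !mxE mulrC.
move=> i.
pose qb eps w := (drift c k (Xf k eps w) (us k w + eps *: (u k w - us k w)) w i ord0
  - drift c k (X k w) (us k w) w i ord0) / eps
  - (drift_x D k (X k w) (us k w) w *m Xh k w
     + drift_u D k (X k w) (us k w) w *m (u k w - us k w)) i ord0.
pose qs l eps w := (diffu c l k (Xf k eps w) (us k w + eps *: (u k w - us k w)) w i ord0
  - diffu c l k (X k w) (us k w) w i ord0) / eps
  - (diffu_x D l k (X k w) (us k w) w *m Xh k w
     + diffu_u D l k (X k w) (us k w) w *m (u k w - us k w)) i ord0.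
have vqb : vanishing PP 2 qb.
  by split=> [eps eps01|e e0]; [have [] := Qb i eps eps01|exact: (Vb i e e0)].
have vqs l : vanishing PP 2 (fun eps w => qs l eps w * W k.+1 w l ord0).
  have [C C0 hC] := product_second_moment Theta_n0 hA3 hW l kN.
  split=> [eps eps01|e e0].
    by have [] := Lcl_noise_product Theta_n0 hA3 hW l kN (Qs l i eps eps01).
  have e1 : 0 < e / C by rewrite divr_gt0.
  near=> eps => P PPP.
  have eps01 : 0 < eps <= 1 by near: eps; exact: near01.
  have hq : (\int[P]_w (`|qs l eps w| ^+ 2)%:E <= (e / C)%:E)%E.
    by move: P PPP; near: eps; exact: (Vs l i _ e1).
  have := hC _ (Qs l i eps eps01) P PPP (e / C).
  rewrite mulrCA divff ?gt_eqF// mulr1 => h.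
  under eq_integral do rewrite real_normK ?num_real//.
  apply: h; move: hq; under eq_integral do rewrite real_normK ?num_real//.
  exact.
apply: vanishing_eq (vanishingD vqb (vanishing_sum (index_enum _) (isT : (0 < 2)%N) vqs)).
move=> eps w eps01; have eps0 : eps != 0 by case/andP: eps01 => h _; rewrite gt_eqF.
rewrite quotient_linear_sum /Xf /X /Xh /=.
have entry (B : 'cV[R]_n) (w' : 'I_d -> R) (S : 'I_d -> 'cV[R]_n) :
    (B + \sum_(l < d) w' l *: S l) i ord0 = B i ord0 + \sum_(l < d) w' l * S l i ord0.
  by rewrite mxE summxE; congr (_ + _); apply: eq_bigr => l _; rewrite mxE.
have entries (A1 A2 A3 : 'cV[R]_n) :
    (eps^-1 *: (A1 - A2) - A3) i ord0 = eps^-1 * (A1 i ord0 - A2 i ord0) - A3 i ord0.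
  by rewrite !mxE.
by rewrite entries !entry.
Unshelve. all: end_near.
Qed.

Lemma var_cost_Lcl : Lcl PP 1 N (var_cost N W x0 c D us u).
Proof.
have pa1 : (1 = 1 /\ 1 = 1)%N \/ (1 = 2 /\ 1 = 0)%N by left.
apply: (Lcl_add (leqnn N)).
  apply: (Lcl_sum (leqnn N)) => // k; have kN := ltn_ord k.
  apply: (Lcl_widen (ltnW kN)).
  exact: (coef_derivative (ltnW kN) pa1 (rcost_smooth kN) (state_Lclv aus (ltnW kN))
    (var_state_quotient (ltnW kN)).1 (admissible_Lclv aus kN) (Adv kN)
    (fun w => domZ w kN) (fun w => domZH w kN)).
have V0 : Lclv N W F N (fun=> 0 : 'cV[R]_m) by exact: Lclv_cst.
(* The terminal cost has no control argument; 0 stands in for the control and its variation. *)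
have := coef_derivative (v := fun=> 0) (dv := fun=> 0) (leqnn N) pa1 tcost_smooth
  (state_Lclv aus (leqnn N)) (var_state_quotient (leqnn N)).1 V0 V0
  (fun w => I) (fun w => I).
by congr Lcl; apply/funext => w; rewrite mul0mx addr0.
Qed.

Lemma cost_quotient : vanishing PP 1 (fun eps w =>
  (pathcost N W x0 c (perturb us u eps) w - pathcost N W x0 c us w) / eps
    - var_cost N W x0 c D us u w).
Proof.
have pa1 : (1 = 1 /\ 1 = 1)%N \/ (1 = 2 /\ 1 = 0)%N by left.
have vr (k : 'I_N) : vanishing PP 1 (fun eps w =>
    (rcost c k (Xf k eps w) (us k w + eps *: (u k w - us k w)) w
      - rcost c k (X k w) (us k w) w) / eps
    - (rcost_x D k (X k w) (us k w) w *m Xh k w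
       + rcost_u D k (X k w) (us k w) w *m (u k w - us k w)) ord0 ord0).
  have kN := ltn_ord k; have [AXh vX] := var_state_quotient (ltnW kN).
  split=> [eps eps01|e e0].
    by have [] := coef_quotient (ltnW kN) pa1 (rcost_smooth kN) (state_Lclv aus (ltnW kN)) AXh
      (admissible_Lclv aus kN) (Adv kN) (fun eps h => AXf (ltnW kN) h) (fun w => domZ w kN)
      (fun w => domZH w kN) (fun eps w h => domf w kN h) eps01.
  exact: (coef_quotient_vanish (ltnW kN) pa1 (rcost_smooth kN) (state_Lclv aus (ltnW kN)) AXh
    (admissible_Lclv aus kN) (Adv kN) (fun eps h => AXf (ltnW kN) h) (fun w => domZ w kN)
    (fun w => domZH w kN) (fun eps w h => domf w kN h) (norm_quotient vX) e0).
have V0 : Lclv N W F N (fun=> 0 : 'cV[R]_m) by exact: Lclv_cst.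
have vt : vanishing PP 1 (fun eps w =>
    (tcost c (Xf N eps w) w - tcost c (X N w) w) / eps
    - (tcost_x D (X N w) w *m Xh N w + (0 : 'M[R]_(1, m)) *m 0) ord0 ord0).
  have [AXh vX] := var_state_quotient (leqnn N).
  split=> [eps eps01|e e0].
    by have [] := coef_quotient (v := fun=> 0) (dv := fun=> 0) (leqnn N) pa1 tcost_smooth
      (state_Lclv aus (leqnn N)) AXh V0 V0
      (fun eps h => AXf (leqnn N) h) (fun w => I) (fun w => I) (fun eps w h => I) eps01.
  exact: (coef_quotient_vanish (v := fun=> 0) (dv := fun=> 0) (leqnn N) pa1 tcost_smooth
      (state_Lclv aus (leqnn N)) AXh V0 V0
      (fun eps h => AXf (leqnn N) h) (fun w => I) (fun w => I) (fun eps w h => I)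
      (norm_quotient vX) e0).
apply: vanishing_eq (vanishingD (vanishing_sum (index_enum _) (isT : (0 < 1)%N) vr) vt).
move=> eps w eps01; rewrite sumrB -mulr_suml sumrB mulmx0 addr0.
by rewrite /pathcost /var_cost /Xf /X /Xh /perturb; ring.
Qed.

End variation.
End control.

(** * Finite expectations and their suprema in the extended reals *)

Section means.
Context (R : realType) (Omega : pointedType) (d N : nat).
Context (W : nat -> Omega -> 'cV[R]_d).
Context (Theta : Type) (F : Theta -> probability (borel 'cV[R]_d) R).
Local Notation T := (filtered W N).
Local Notation PP := (dominated_probs N W F).
Hypothesis PP0 : PP !=set0.

Let mean (X : Omega -> R) (P : probability T R) : R := \int[P]_w X w.

Lemma Lcl1_expectation X P : Lcl PP 1 N X -> PP P -> 'E_P[X]%E = (\int[P]_w X w)%:E.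
Proof.
move=> AX PPP; rewrite unlock /Rintegral fineK//.
by apply: integrable_fin_num => //; exact: Lcl1_integrable AX PPP.
Qed.

Lemma Lcl1_mean_bound X : Lcl PP 1 N X -> exists K : R, forall P, PP P -> `|\int[P]_w X w| <= K.
Proof.
move=> AX; have [Y LY hY] := AX.2 1 ltr01; have [B B0 bB] := Lipk_bounded LY.
have AY : Lcl PP 1 N Y by exact: Lipk_Lcl.
exists (1 + B) => P PPP.
have iX := Lcl1_integrable (leqnn N) AX PPP; have iY := Lcl1_integrable (leqnn N) AY PPP.
have h : `|\int[P]_w X w - \int[P]_w Y w| <= 1 by apply: Rintegral_dist => //; exact: hY.
have bY : `|\int[P]_w Y w| <= B.
  rewrite -lee_fin EFin_normr_Rintegral//.
  rewrite -(integral_prob_cst P B).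
  apply: le_trans (le_abse_integral _ _ _) _ => //; first exact: measurable_int iY.
  apply: ge0_le_integral => //.
    by apply: measurableT_comp => //; exact: measurable_int iY.
  by move=> w _; rewrite lee_fin.
by rewrite -(subrK (\int[P]_w Y w) (\int[P]_w X w)) (le_trans (ler_normD _ _))// lerD.
Qed.

Lemma ereal_sup_mean X (A : set (probability T R)) : A `<=` PP -> A !=set0 -> Lcl PP 1 N X ->
  ereal_sup [set 'E_P[X]%E | P in A] = (sup (mean X @` A))%:E.
Proof.
move=> APP A0 AX; rewrite -ereal_sup_EFin.
- rewrite image_comp; congr ereal_sup; apply: eq_imagel => P AP.
  by rewrite Lcl1_expectation//; exact: APP.
- have [K hK] := Lcl1_mean_bound AX; exists K => _ [P AP <-].
  by rewrite (le_trans (ler_norm _))// hK//; exact: APP.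
- by case: A0 => P AP; exists (mean X P); exists P.
Qed.

End means.

Theorem theorem4p3 (R : realType) (Omega : pointedType) (d n m N : nat)
    (W : nat -> Omega -> 'cV[R]_d)
    (Theta : Type) (F : Theta -> probability (borel 'cV[R]_d) R)
    (U : nat -> set 'cV[R]_m) (x0 : 'cV[R]_n)
    (c : coefficients R Omega d n m) (D : jacobians R Omega d n m)
    (N_gt0 : (0 < N)%N) (d_gt0 : (0 < d)%N) (Theta_n0 : inhabited Theta)
    (hA1 : A1 N W F) (hA2 : A2 F) (hA3 : A3 N W F)
    (hW : forall k, (1 <= k <= N)%N -> Lcv N W F 2 k (W k))
    (hU : forall k, (k < N)%N -> U k !=set0 /\ convex_set (U k))
    (hD : differentiable_coefficients N U c D)
    (hH1 : H1 N W F U c) (hH2 : H2 N U D) (hH3 : H3 N U D)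
    (us : nat -> Omega -> 'cV[R]_m) (hus : optimal N W F U x0 c us)
    (u : nat -> Omega -> 'cV[R]_m) (hu : admissible N W F U u) :
  (forall eps : R, 0 < eps <= 1 -> admissible N W F U (perturb us u eps)) /\
  exists Pu : probability (filtered W N) R,
    let Th := var_cost N W x0 c D us u in
    [/\ optimal_probs N W F x0 c us Pu,
        Pu.-integrable setT (EFin \o Th),
        ((eps^-1)%:E * (J N W F x0 c (perturb us u eps) - J N W F x0 c us))%E
          @[eps --> (0 : R)^'+] --> 'E_Pu[Th]%E &
        'E_Pu[Th]%E = ereal_sup [set 'E_P[Th]%E | P in optimal_probs N W F x0 c us]].
Proof.
have aus := hus.1.
have aeps (eps : R) : 0 < eps <= 1 -> admissible N W F U (perturb us u eps).
  by move=> /andP[e0 e1]; apply: perturb_admissible => //; rewrite ltW.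
split=> //.
have PP0 := dominated_probs_n0 Theta_n0 hA3.
set PP := dominated_probs N W F in PP0.
pose mean X (P : probability (filtered W N) R) : R := \int[P]_w X w.
have Acost v : admissible N W F U v -> Lcl PP 1 N (pathcost N W x0 c v).
  exact: (pathcost_Lcl x0 N_gt0 d_gt0 Theta_n0 hA3 hW hU hD hH1 hH2 hH3).
pose Th := var_cost N W x0 c D us u.
have ATh : Lcl PP 1 N Th by exact: (var_cost_Lcl x0 N_gt0 d_gt0 Theta_n0 hA3 hW hU hD hH1 hH2 hH3).
have J_sup v : admissible N W F U v ->
    J N W F x0 c v = (sup (mean (pathcost N W x0 c v) @` PP))%:E.
  by move=> av; exact: (ereal_sup_mean (@subset_refl _ PP) PP0 (Acost v av)).
have [K1 hK1] := Lcl1_mean_bound (Acost us aus).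
have [K2 hK2] := Lcl1_mean_bound ATh.
pose j eps := mean (pathcost N W x0 c (perturb us u eps)).
(* The index set is the dominated probabilities; a, t and j are the means of the cost of u^*, of
   Theta^u and of the cost of u^eps. *)
have [||e e0|Pn PPn|P [PPP aP lP tP]] := @sup_right_derivative _ _ PP PP0
    (mean (pathcost N W x0 c us)) (mean Th) j (Num.max K1 K2).
- by move=> P PPP; rewrite le_max hK1.
- by move=> P PPP; rewrite le_max hK2 ?orbT.
- have [_ vq] := cost_quotient x0 N_gt0 d_gt0 Theta_n0 hA3 hW hU hD hH1 hH2 hH3 aus hu.
  near=> eps => P PPP.
  have eps01 : 0 < eps <= 1 by near: eps; exact: near_right01.
  have Aq : Lcl PP 1 N (fun w => (pathcost N W x0 c (perturb us u eps) w
      - pathcost N W x0 c us w) / eps).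
    under eq_fun do rewrite mulrC.
    by apply: (Lcl_scale (leqnn N)); apply: (Lcl_sub (leqnn N)); apply: Acost => //; exact: aeps.
  have iu := Lcl1_integrable (leqnn N) (Acost _ (aeps _ eps01)) PPP.
  have ius := Lcl1_integrable (leqnn N) (Acost _ aus) PPP.
  have iq := Lcl1_integrable (leqnn N) Aq PPP.
  have iT := Lcl1_integrable (leqnn N) ATh PPP.
  have -> : (j eps P - mean (pathcost N W x0 c us) P) / eps = \int[P]_w
      ((pathcost N W x0 c (perturb us u eps) w - pathcost N W x0 c us w) / eps).
    rewrite /j /mean -RintegralB//.
    under [RHS]eq_Rintegral do rewrite mulrC.
    rewrite RintegralZl 1?mulrC//.
    by have := integrableB measurableT iu ius; congr (_.-integrable _ _); apply/funext.
  apply: Rintegral_dist => //.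
  by move: P PPP {iu ius iq iT}; near: eps; exact: vq.
(* An ultrafilter finer than \oo plays the role of a convergent subsequence, for both means at
   once. *)
- have [V [VV nV]] := ultraFilterLemma (F := \oo) _.
  have [P PPP hP] := dominated_cluster hA3 hW PPn VV.
  exists P => //; exists V; split => //; [exact: ultra_proper|exact: (hP _ (Acost us aus))|exact: (hP _ ATh)].
have Popt : optimal_probs N W F x0 c us P.
  split => //; rewrite (Lcl1_expectation (Acost us aus))//.
  by rewrite -[RHS]/(J N W F x0 c us) J_sup//; congr EFin.
exists P; split => //.
- exact: Lcl1_integrable ATh PPP.
- rewrite (Lcl1_expectation ATh)//.
  (* For eps in (0, 1] both costs are finite, so the extended quotient is the embedding of a real
     one. *)
  have JE eps : 0 < eps <= 1 ->
      ((eps^-1)%:E * (J N W F x0 c (perturb us u eps) - J N W F x0 c us))%E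
      = ((sup (j eps @` PP) - sup (mean (pathcost N W x0 c us) @` PP)) / eps)%:E.
    by move=> eps01; rewrite !J_sup ?(mulrC _ eps^-1)//; exact: aeps.
  apply: cvg_EFin.
    by apply: filterS (@near_right01 R) => eps /JE ->.
  apply: cvg_trans lP; apply: near_eq_cvg.
  by apply: filterS (@near_right01 R) => eps eps01 /=; rewrite JE.
apply/eqP; rewrite eq_le; apply/andP; split; first by apply: ereal_sup_ubound; exists P.
apply: ge_ereal_sup => _ [P' [PPP' aP'] <-].
rewrite !(Lcl1_expectation ATh)// lee_fin; apply: tP => //.
by apply: EFin_inj; rewrite -J_sup// -(Lcl1_expectation (Acost us aus)).
Unshelve. all: by end_near. Qed.
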